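(* Let $\mathcal K$ be a finite set of $\mathcal A$-invariant subalgebras $\mathfrak k$ of $\mathfrak g$ with $\mathfrak h\subsetneq\mathfrak k\subseteq\mathfrak g$, containing $\mathfrak g$, which is an upper semilattice (for any $\mathfrak k,\mathfrak l\in\mathcal K$ the smallest subalgebra of $\mathfrak g$ containing $\mathfrak k$ and $\mathfrak l$ belongs to $\mathcal K$). Put $\mathcal K^\#=\mathcal K\setminus\{\mathfrak g\}$. Then the polyhedron $/\mathcal K^\#/$ is a strong deformation retract of the compact space $X[\mathcal K]:=\bigcup_{\mathfrak k\in\mathcal K^\#}X[\mathfrak k]$.
   Context: $\mathfrak g$ is the Lie algebra of a compact Lie group with Euclidean inner product $Q$ satisfying $Q([X,Y],Z)=Q(X,[Y,Z])$. Linear operators are symmetric if $Q(AX,Y)=Q(X,AY)$. For symmetric $A$ and $a\in\mathbb R$, $F_a$ is the span of eigenvectors with eigenvalue $\le a$; $A$ is filtering if $[F_a,F_b]\subseteq F_{a+b}$ for all $a,b$; $\mathfrak F_+$ is the set of filtering symmetric operators with nonnegative spectrum and trace $1$. $\mathfrak h\subsetneq\mathfrak g$ is a fixed subalgebra and $\mathcal A$ a compact group of automorphisms of $\mathfrak g$ preserving $\mathfrak h$ and $Q$. For an $\mathcal A$-invariant subalgebra $\mathfrak k\supseteq\mathfrak h$, $\mathfrak k\ne\mathfrak g$: $\bar\chi^{\mathfrak k}=\frac{1}{\dim(\mathfrak g/\mathfrak k)}(1_{\mathfrak g}-1_{\mathfrak k})$ ($1_{\mathfrak k}$ the $Q$-orthogonal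 projection onto $\mathfrak k$); $D[\mathfrak k]$ is the set of symmetric operators with nonnegative spectrum and trace $1$ commuting with all elements of $\mathcal A$, annihilating $\mathfrak k$ and commuting with $\mathrm{ad}(X)$ for all $X\in\mathfrak k$; $X[\mathfrak k]=D[\mathfrak k]\cap\mathfrak F_+$. For a chain $\varphi=(\mathfrak f_1\supsetneq\dots\supsetneq\mathfrak f_r)$ of members of $\mathcal K^\#$, $/\varphi/$ is the convex hull of $\{\bar\chi^{\mathfrak f_1},\dots,\bar\chi^{\mathfrak f_r}\}$, and $/\mathcal K^\#/$ is the union of $/\varphi/$ over all such chains ($r\ge1$). *)

(* Defs.v *)
From HB Require Import structures.
From mathcomp Require Import all_boot all_order all_algebra.
From mathcomp Require Import all_classical all_reals all_analysis.
Import numFieldNormedType.Exports.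
Set Implicit Arguments. Unset Strict Implicit. Unset Printing Implicit Defensive.
Import Order.TTheory GRing.Theory Num.Theory.
Local Open Scope ring_scope.
Local Open Scope classical_set_scope.

(* The Lie algebra g is modelled as R^n = 'rV[R]_n (row vectors).
   Linear operators on g are matrices A : 'M[R]_n acting on the right:
   X |-> X *m A.  Subspaces / subalgebras are {vspace 'rV[R]_n}. *)

Definition ip (R : realType) (n : nat) (Q : 'M[R]_n) (x y : 'rV[R]_n) : R :=
  (x *m Q *m y^T) 0 0.

Definition inner_product (R : realType) (n : nat) (Q : 'M[R]_n) : Prop :=
  Q^T = Q /\ forall x : 'rV[R]_n, x != 0 -> 0 < ip Q x x.

(* (br, Q) is a real Lie algebra with a Q-invariant (Euclidean) inner product,
   i.e. the Lie algebra of a compact Lie group with Q([X,Y],Z) = Q(X,[Y,Z]). *)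
Definition compact_lie_algebra (R : realType) (n : nat)
    (br : 'rV[R]_n -> 'rV[R]_n -> 'rV[R]_n) (Q : 'M[R]_n) : Prop :=
  inner_product Q /\
  (forall (a : R) x y z, br (a *: x + y) z = a *: br x z + br y z) /\
  (forall x y, br x y = - br y x) /\
  (forall x y z, br x (br y z) + br y (br z x) + br z (br x y) = 0) /\
  (forall x y z, ip Q (br x y) z = ip Q x (br y z)).

Definition subalgebra (R : realType) (n : nat)
    (br : 'rV[R]_n -> 'rV[R]_n -> 'rV[R]_n) (k : {vspace 'rV[R]_n}) : Prop :=
  forall x y, x \in k -> y \in k -> br x y \in k.

Definition lie_automorphism (R : realType) (n : nat)
    (br : 'rV[R]_n -> 'rV[R]_n -> 'rV[R]_n) (a : 'M[R]_n) : Prop :=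
  a \in unitmx /\ forall x y, br (x *m a) (y *m a) = br x y *m a.

Definition compact_aut_group (R : realType) (n : nat)
    (br : 'rV[R]_n -> 'rV[R]_n -> 'rV[R]_n) (Q : 'M[R]_n)
    (h : {vspace 'rV[R]_n}) (cA : set 'M[R]_n) : Prop :=
  [/\ cA 1%:M,
      (forall a b, cA a -> cA b -> cA (a *m b)),
      (forall a, cA a -> cA (invmx a)),
      (forall a, cA a -> lie_automorphism br a /\
                        (forall x, x \in h -> x *m a \in h) /\
                        (forall x y, ip Q (x *m a) (y *m a) = ip Q x y))
    & compact cA].

Definition A_invariant (R : realType) (n : nat) (cA : set 'M[R]_n)
    (k : {vspace 'rV[R]_n}) : Prop :=
  forall a x, cA a -> x \in k -> x *m a \in k.

Definition is_join_subalgebra (R : realType) (n : nat)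
    (br : 'rV[R]_n -> 'rV[R]_n -> 'rV[R]_n) (k l m : {vspace 'rV[R]_n}) : Prop :=
  [/\ subalgebra br m, (k <= m)%VS, (l <= m)%VS &
      forall m', subalgebra br m' -> (k <= m')%VS -> (l <= m')%VS -> (m <= m')%VS].

Definition symmetric_op (R : realType) (n : nat) (Q : 'M[R]_n) (A : 'M[R]_n) :=
  forall x y, ip Q (x *m A) y = ip Q x (y *m A).

Definition eigvec (R : realType) (n : nat) (A : 'M[R]_n) (lam : R) (x : 'rV[R]_n) :=
  x != 0 /\ x *m A = lam *: x.

Definition inF (R : realType) (n : nat) (A : 'M[R]_n) (a : R) (x : 'rV[R]_n) : Prop :=
  exists s : seq (R * R * 'rV[R]_n),
    (forall p, p \in s -> p.1.2 <= a /\ eigvec A p.1.2 p.2) /\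
    x = \sum_(p <- s) p.1.1 *: p.2.

Definition filtering (R : realType) (n : nat)
    (br : 'rV[R]_n -> 'rV[R]_n -> 'rV[R]_n) (A : 'M[R]_n) : Prop :=
  forall a b x y, inF A a x -> inF A b y -> inF A (a + b) (br x y).

Definition nonneg_spectrum (R : realType) (n : nat) (A : 'M[R]_n) : Prop :=
  forall lam x, eigvec A lam x -> 0 <= lam.

Definition Fplus (R : realType) (n : nat)
    (br : 'rV[R]_n -> 'rV[R]_n -> 'rV[R]_n) (Q : 'M[R]_n) : set 'M[R]_n :=
  [set A | [/\ symmetric_op Q A, filtering br A, nonneg_spectrum A & \tr A = 1]].

Definition Dk (R : realType) (n : nat)
    (br : 'rV[R]_n -> 'rV[R]_n -> 'rV[R]_n) (Q : 'M[R]_n) (cA : set 'M[R]_n)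
    (k : {vspace 'rV[R]_n}) : set 'M[R]_n :=
  [set A | [/\ symmetric_op Q A, nonneg_spectrum A, \tr A = 1 /\
              (forall a, cA a -> a *m A = A *m a),
              (forall x, x \in k -> x *m A = 0) &
              (forall X y, X \in k -> br X (y *m A) = br X y *m A)]].

Definition Xk (R : realType) (n : nat)
    (br : 'rV[R]_n -> 'rV[R]_n -> 'rV[R]_n) (Q : 'M[R]_n) (cA : set 'M[R]_n)
    (k : {vspace 'rV[R]_n}) : set 'M[R]_n :=
  Dk br Q cA k `&` Fplus br Q.

(* the Q-orthogonal projection 1_k onto k (unique since Q is positive definite) *)
Definition oproj (R : realType) (n : nat) (Q : 'M[R]_n) (k : {vspace 'rV[R]_n}) : 'M[R]_n :=
  xget 0 [set P : 'M[R]_n | forall x, x *m P \in k /\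
                            forall y, y \in k -> ip Q (x - x *m P) y = 0].

Definition chibar (R : realType) (n : nat) (Q : 'M[R]_n) (k : {vspace 'rV[R]_n}) : 'M[R]_n :=
  ((n - \dim k)%:R)^-1 *: (1%:M - oproj Q k).

Definition Ksharp (R : realType) (n : nat) (K : seq {vspace 'rV[R]_n}) :=
  [seq k <- K | k != fullv].

Definition XK (R : realType) (n : nat)
    (br : 'rV[R]_n -> 'rV[R]_n -> 'rV[R]_n) (Q : 'M[R]_n) (cA : set 'M[R]_n)
    (K : seq {vspace 'rV[R]_n}) : set 'M[R]_n :=
  [set A | exists2 k, k \in Ksharp K & Xk br Q cA k A].

Definition is_chain (R : realType) (n : nat) (K : seq {vspace 'rV[R]_n})
    (phi : seq {vspace 'rV[R]_n}) : Prop :=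
  [/\ (0 < size phi)%N, (forall k, k \in phi -> k \in Ksharp K) &
      sorted (fun k l : {vspace 'rV[R]_n} => (l <= k)%VS && (l != k)) phi].

Definition simplex (R : realType) (n : nat) (Q : 'M[R]_n)
    (phi : seq {vspace 'rV[R]_n}) : set 'M[R]_n :=
  [set A | exists w : 'I_(size phi) -> R,
     [/\ (forall i, 0 <= w i), \sum_i w i = 1 &
         A = \sum_i w i *: chibar Q (nth 0%VS phi i)]].

Definition polyhedron (R : realType) (n : nat) (Q : 'M[R]_n)
    (K : seq {vspace 'rV[R]_n}) : set 'M[R]_n :=
  [set A | exists2 phi, is_chain K phi & simplex Q phi A].

Definition strong_deformation_retract (R : realType) (n : nat)
    (Y X : set 'M[R]_n) : Prop :=
  Y `<=` X /\
  exists H : 'M[R]_n -> R -> 'M[R]_n,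
    [/\ {within [set p : 'M[R]_n * R | X p.1 /\ 0 <= p.2 <= 1],
          continuous (fun p => H p.1 p.2)},
        (forall x t, X x -> 0 <= t <= 1 -> X (H x t)),
        (forall x, X x -> H x 0 = x),
        (forall x, X x -> Y (H x 1)) &
        (forall y t, Y y -> 0 <= t <= 1 -> H y t = y)].

(* Main.v *)
(** Every piece [X[k]] is compact and star-shaped about [chibar k], and it is a
    retract of a compact real algebraic set: membership is certified by a square
    root of the operator and a fourth root of the square of the operator
    [A3 - A2 - A1] that it induces on the tensor cube of [g], the filtering
    property saying that the structure tensor lies in the nonpositive
    eigenspaces.  A compact real algebraic set is a neighbourhood retract: follow
    a discretised gradient descent of its squared equation, whose length is
    bounded by a Kurdyka-Lojasiewicz inequality, which follows from the
    monotonicity of semialgebraic functions.  So [X[k]] is an absolute extensor.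

    A filtering operator that kills [k] and [l] kills the subalgebra they
    generate, so [X[k]] and [X[l]] meet in [X[k v l]].  Adding the pieces in
    order of decreasing dimension of [k], any retraction [r] of the union onto
    the polyhedron that preserves every [X[k]] is joined to the identity by a
    homotopy fixing the polyhedron and preserving the pieces.

    To build [r], write a point of the polyhedron as [sum u_k (1 - 1_k)] with [u]
    supported on a chain, and recover [u_k] from the levels
    [d_l = sum_(l not <= k) u_k] as the positive part of
    [min_(l not <= k) d_l - max_(l <= k) d_l].  For any continuous extension of
    the levels that vanishes exactly on the [A] killing [l], the same formula
    gives weights supported on a chain. *)
Require Import Defs.
From HB Require Import structures.
From mathcomp Require Import all_boot all_order all_algebra.
From mathcomp Require Import all_classical all_reals all_analysis.
From mathcomp Require Import ring lra.
From mathcomp Require ordered_qelim qe_rcf polyrcf mxtens.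
Import numFieldNormedType.Exports.
Import Order.TTheory GRing.Theory Num.Theory.
Local Open Scope ring_scope.
Local Open Scope classical_set_scope.

Set Implicit Arguments. Unset Strict Implicit. Unset Printing Implicit Defensive.

(** * Semialgebraic families *)

(** Convex combinations of filtering operators need not be filtering, so the straight-line homotopy
    from the identity to a retraction may leave the pieces. Extension arguments replace it.
    Star-shapedness alone would only contract a piece; the local regularity that makes it an
    absolute extensor comes from algebraicity.

    The obstacle is that positivity and filtering are spectral conditions. Both become polynomial
    equations through roots. A symmetric [T] with [T^2 = A] forces [A >= 0]. With [L = A3 - A2 - A1]
    and a symmetric [S] with [S^4 = L^2], the square [S^2] is automatically positive, so it is
    [|L|], and [|L| + L] kills exactly the nonpositive eigenspaces of [L]. Roots of arbitrary sign
    still certify membership, while positive roots are unique and depend continuously on the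
    operator; hence [X[k]] is a retract of the algebraic set.

    Semialgebraic geometry enters through functions of one variable only: quantifier elimination,
    eventual monotonicity near 0 and lexicographic choice. The variation of the chosen curve serves
    directly as desingularising function, without Puiseux series or smoothness of the curve. *)

Module ord := ordered_qelim.ord.

Section Definability.
Variable R : realType.
Implicit Types (P : seq R -> Prop) (g : seq R -> R).

(** Variable [i] of a formula reads entry [i] of the environment, and 0 past its end; elements of
    [R] may occur as constants. Quantifying over a variable means overwriting an entry with
    [set_nth]. *)
Definition definable P :=
  exists f : ord.formula R,
    forall e, ord.holds e f <-> P e.

Definition poly_env g := exists t : GRing.term R, forall e, GRing.eval e t = g e.

Lemma poly_env_var i : poly_env (fun e => nth 0 e i).
Proof. by exists (GRing.Var R i). Qed.

Lemma poly_env_cst (c : R) : poly_env (fun=> c).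
Proof. by exists (GRing.Const c). Qed.

Lemma poly_envD g1 g2 : poly_env g1 -> poly_env g2 ->
  poly_env (fun e => g1 e + g2 e).
Proof. by move=> [t1 h1] [t2 h2]; exists (GRing.Add t1 t2) => e /=; rewrite h1 h2. Qed.

Lemma poly_envM g1 g2 : poly_env g1 -> poly_env g2 ->
  poly_env (fun e => g1 e * g2 e).
Proof. by move=> [t1 h1] [t2 h2]; exists (GRing.Mul t1 t2) => e /=; rewrite h1 h2. Qed.

Lemma definable_ext P1 P2 : (forall e, P1 e <-> P2 e) ->
  definable P1 -> definable P2.
Proof. by move=> h [f hf]; exists f => e; rewrite hf. Qed.

Lemma definable_le g1 g2 : poly_env g1 -> poly_env g2 ->
  definable (fun e => g1 e <= g2 e).
Proof.
by move=> [t1 h1] [t2 h2]; exists (ord.Le t1 t2) => e /=; rewrite h1 h2.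
Qed.

Lemma definable_lt g1 g2 : poly_env g1 -> poly_env g2 ->
  definable (fun e => g1 e < g2 e).
Proof.
by move=> [t1 h1] [t2 h2]; exists (ord.Lt t1 t2) => e /=; rewrite h1 h2.
Qed.

Lemma definable_eq g1 g2 : poly_env g1 -> poly_env g2 ->
  definable (fun e => g1 e = g2 e).
Proof.
by move=> [t1 h1] [t2 h2]; exists (ord.Equal t1 t2) => e /=; rewrite h1 h2.
Qed.

Lemma definable_true : definable (fun=> True).
Proof. by exists (ord.Bool true) => e; split. Qed.

Lemma definable_and P1 P2 : definable P1 -> definable P2 ->
  definable (fun e => P1 e /\ P2 e).
Proof.
by move=> [f1 h1] [f2 h2]; exists (ord.And f1 f2) => e /=; rewrite h1 h2.
Qed.

Lemma definable_imp P1 P2 : definable P1 -> definable P2 ->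
  definable (fun e => P1 e -> P2 e).
Proof.
by move=> [f1 h1] [f2 h2]; exists (ord.Implies f1 f2) => e /=; rewrite h1 h2.
Qed.

Lemma definable_not P : definable P -> definable (fun e => ~ P e).
Proof. by move=> [f1 h1]; exists (ord.Not f1) => e /=; rewrite h1. Qed.

Lemma definable_ex i P : definable P ->
  definable (fun e => exists x, P (set_nth 0 e i x)).
Proof.
move=> [f1 h1]; exists (ord.Exists i f1) => e /=.
by split=> -[x]; exists x; apply/h1.
Qed.

Lemma definable_all i P : definable P ->
  definable (fun e => forall x, P (set_nth 0 e i x)).
Proof.
move=> [f1 h1]; exists (ord.Forall i f1) => e /=.
by split=> + x => /(_ x)/h1.
Qed.

Lemma definable_forall_ord n (P : 'I_n -> seq R -> Prop) :
  (forall i, definable (P i)) -> definable (fun e => forall i, P i e).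
Proof.
move=> hP; have : forall r : seq 'I_n, definable (fun e => forall i, i \in r -> P i e).
  elim=> [|j r IH].
    by apply: definable_ext definable_true => e; split.
  apply: definable_ext (definable_and (hP j) IH) => e; split.
    by move=> [h1 h2] i; rewrite in_cons => /orP[/eqP->|/h2].
  by move=> h; split=> [|i ir]; apply: h; rewrite in_cons ?eqxx ?ir ?orbT.
move=> /(_ (enum 'I_n)); apply: definable_ext => e; split.
  by move=> h i; apply: h; rewrite mem_enum.
by move=> h i _.
Qed.

(** Tarski's quantifier elimination for real closed fields. Inverses are removed from the terms
    first, so that every atom compares two polynomials. *)
Lemma definable_quantifier_free P : definable P ->
  exists f : ord.formula R,
    [/\ ord.qf_form f, ord.rformula f &
        forall e, ord.qf_eval e f <-> P e].
Proof.
move=> [f hf]; pose qe := ord.quantifier_elim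
  (fun i bc => qe_rcf.qfr_to_formula (@qe_rcf.wproj R i bc)).
have wf := @qe_rcf.wf_QE_wproj R.
have vl := @qe_rcf.valid_QE_wproj R.
pose f' := ord.to_rform f.
have rf' : ord.rformula f' by exact: ord.to_rform_rformula.
have /andP[q1 q2] := ord.quantifier_elim_wf wf rf'.
exists (qe f'); split=> // e.
rewrite -hf -(ord.to_rformP e f) -/f'; split.
  by move=> /(ord.quantifier_elim_rformP wf vl e rf').
by move=> h; apply/(ord.quantifier_elim_rformP wf vl e rf').
Qed.

Lemma eval_poly_var (e : seq R) i (t : GRing.term R) : GRing.rterm t ->
  exists p : {poly R}, forall x, GRing.eval (set_nth 0 e i x) t = p.[x].
Proof.
elim: t => //=.
- move=> j _; have [->|ji] := eqVneq j i.
    by exists 'X => x; rewrite hornerX nth_set_nth /= eqxx.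
  by exists (nth 0 e j)%:P => x; rewrite hornerC nth_set_nth /= (negbTE ji).
- by move=> c _; exists c%:P => x; rewrite hornerC.
- by move=> c _; exists c%:R%:P => x; rewrite hornerC.
- move=> t1 h1 t2 h2 /andP[/h1[p1 {}h1] /h2[p2 {}h2]].
  by exists (p1 + p2) => x; rewrite hornerD h1 h2.
- by move=> t1 h1 /h1[p1 {}h1]; exists (- p1) => x; rewrite hornerN h1.
- by move=> t1 h1 k /h1[p1 {}h1]; exists (p1 *+ k) => x; rewrite hornerMn h1.
- move=> t1 h1 t2 h2 /andP[/h1[p1 {}h1] /h2[p2 {}h2]].
  by exists (p1 * p2) => x; rewrite hornerM h1 h2.
- by move=> t1 h1 k /h1[p1 {}h1]; exists (p1 ^+ k) => x; rewrite horner_exp h1.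
Qed.

(** The substitute for o-minimality: along [F] the sign of every polynomial, and through
    [germ_const] every definable condition, is eventually decided. *)
Definition germ (F : set_system R) :=
  forall p : {poly R}, exists s, \forall t \near F, Num.sg p.[t] = s.

(** After quantifier elimination an atom is read off the sign of one polynomial in the [i]-th
    variable, and Boolean combinations preserve eventual constancy. *)
Lemma germ_const (F : set_system R) {FF : ProperFilter F} P e i : germ F ->
  definable P ->
  (\forall t \near F, P (set_nth 0 e i t)) \/
  (\forall t \near F, ~ P (set_nth 0 e i t)).
Proof.
move=> gF /definable_quantifier_free[f [qf rf fP]].
suff [b hb] : exists b, \forall t \near F,
    ord.qf_eval (set_nth 0 e i t) f = b.
  case: b hb => hb; [left|right]; apply: filterS hb => t ht; rewrite -fP ht //.
have cmp t1 t2 : GRing.rterm t1 && GRing.rterm t2 ->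
    exists s, \forall t \near F, Num.sg (GRing.eval (set_nth 0 e i t) t1
                                         - GRing.eval (set_nth 0 e i t) t2) = s.
  move=> /andP[/(eval_poly_var e i)[p1 h1] /(eval_poly_var e i)[p2 h2]].
  have [s hs] := gF (p1 - p2); exists s; apply: filterS hs => t.
  by rewrite h1 h2 hornerD hornerN.
elim: f qf rf {fP} => //=.
- by move=> b _ _; exists b; exact: nearW.
- move=> t1 t2 _ /cmp[s hs]; exists (s == 0); apply: filterS hs => t <-.
  by rewrite sgr_eq0 subr_eq0.
- move=> t1 t2 _ /cmp[s hs]; exists (s == -1); apply: filterS hs => t <-.
  by rewrite sgr_cp0 subr_lt0.
- move=> t1 t2 _ /cmp[s hs]; exists (s != 1); apply: filterS hs => t <-.
  by rewrite sgr_cp0 subr_gt0 leNgt.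
- move=> f1 h1 f2 h2 /andP[/h1 {}h1 /h2 {}h2] /andP[/h1[b1 H1] /h2[b2 H2]].
  by exists (b1 && b2); apply: filterS2 H1 H2 => t -> ->.
- move=> f1 h1 f2 h2 /andP[/h1 {}h1 /h2 {}h2] /andP[/h1[b1 H1] /h2[b2 H2]].
  by exists (b1 || b2); apply: filterS2 H1 H2 => t -> ->.
- move=> f1 h1 f2 h2 /andP[/h1 {}h1 /h2 {}h2] /andP[/h1[b1 H1] /h2[b2 H2]].
  by exists (b1 ==> b2); apply: filterS2 H1 H2 => t -> ->.
- move=> f1 h1 /h1 {}h1 /h1[b1 H1].
  by exists (~~ b1); apply: filterS H1 => t ->.
Qed.

Lemma germ_right (a : R) : germ (a^'+).
Proof.
move=> p; have [->|p0] := eqVneq p 0.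
  by exists 0; apply: nearW => t; rewrite horner0 sgr0.
have [y hy] := polyrcf.neighpr_wit (ltr_pwDr (@ltr01 R) (lexx a)) p0.
exists (polyrcf.sgp_right p a).
have hr : a < polyrcf.next_root p a (a + 1).
  by move: hy; rewrite /polyrcf.neighpr in_itv /= => /andP[/lt_trans]; apply.
near=> t; apply: (@polyrcf.sgr_neighpr _ (a + 1)).
rewrite /polyrcf.neighpr in_itv /=; apply/andP; split; first by near: t; exact: nbhs_right_gt.
by near: t; exact: nbhs_right_lt.
Unshelve. all: by end_near. Qed.

Lemma germ_left (a : R) : germ (a^'-).
Proof.
move=> p; have [->|p0] := eqVneq p 0.
  by exists 0; apply: nearW => t; rewrite horner0 sgr0.
have a1 : a - 1 < a by rewrite ltrBlDr ltrDl.
have [y hy] := polyrcf.neighpl_wit a1 p0.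
have hr : polyrcf.prev_root p (a - 1) a < a.
  by move: hy; rewrite /polyrcf.neighpl in_itv /= => /andP[/lt_trans]; apply.
exists (Num.sg p.[y]); near=> t; apply: (polyrcf.sgr_neighpl_same _ hy).
rewrite /polyrcf.neighpl in_itv /=; apply/andP; split.
  by near: t; exact: nbhs_left_gt.
by near: t; exact: nbhs_left_lt.
Unshelve. all: by end_near. Qed.

End Definability.

(** * Monotonicity near 0 of definable functions of one variable *)

Section Monotonicity.
Variable R : realType.
Implicit Types (g : R -> R).

(** A connectedness argument without continuity of [g]. At the infimum [c] of the points where [g]
    has dropped below [g a], the left condition gives [g a <= g c], and the right condition keeps
    [g] above [g c] just after [c], so [c] is not an infimum. *)
Lemma locally_nondecreasing_itv g (d : R) :
  (forall t, 0 < t < d -> \forall s \near t^'+, g t <= g s) ->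
  (forall t, 0 < t < d -> \forall s \near t^'-, g s <= g t) ->
  forall s t, 0 < s -> s <= t -> t < d -> g s <= g t.
Proof.
move=> hr hl a b a0 ab bd; rewrite leNgt; apply/negP => gba.
pose B := [set u | [/\ a <= u, u <= b & g u < g a]].
have B0 : B !=set0 by exists b.
have hinf : has_inf B by split=> //; exists a => u [].
pose c := inf B.
have ac : a <= c by apply: lb_le_inf => // u [].
have cb : c <= b by apply: ge_inf => //; exact: hinf.2.
have c0d : 0 < c < d by rewrite (lt_le_trans a0 ac) (le_lt_trans cb bd).
have below u : a <= u -> u < c -> g a <= g u.
  move=> au uc; rewrite leNgt; apply/negP => gu.
  have : c <= u.
    apply: ge_inf; first exact: hinf.2.
    by split=> //; apply: le_trans (ltW uc) cb.
  by rewrite leNgt uc.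
have gac : g a <= g c.
  have [->//|ac'] := eqVneq a c.
  have {}ac' : a < c by rewrite lt_neqAle ac' ac.
  have : \forall s \near c^'-, g a <= g c.
    have h1 := hl c c0d; near=> s.
    have : g s <= g c by near: s.
    apply: le_trans; apply: below.
      by near: s; exact: nbhs_left_ge.
    by near: s; exact: nbhs_left_lt.
  by case/(@filter_ex _ (c^'-)).
have [e /= e0 he] := hr c c0d.
have : c + e <= c.
  rewrite {2}/c; apply: lb_le_inf => // u [au ub gu].
  rewrite leNgt; apply/negP => uce.
  have [uc|cu] := ltP u c.
    by have := below u au uc; rewrite leNgt gu.
  have [uE|uc] := eqVneq u c; first by move: gu; rewrite uE ltNge gac.
  have {}cu : c < u by rewrite lt_neqAle eq_sym uc cu.
  have := he u; rewrite /= ltr0_norm ?subr_lt0// opprB ltrBlDl => /(_ uce cu).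
  by move=> /(le_trans gac); rewrite leNgt gu.
by rewrite gerDl leNgt e0.
Unshelve. all: by end_near. Qed.

(** A strict local minimum is the only minimum of [g] on some rational interval around it, so the
    interval determines the point. Then []0, d[] would be countable, against its positive Lebesgue
    measure. *)
Lemma not_all_strict_local_min g (d : R) : 0 < d ->
  (forall t, 0 < t < d -> \forall s \near t^'+, g t < g s) ->
  (forall t, 0 < t < d -> \forall s \near t^'-, g t < g s) -> False.
Proof.
move=> d0 hr hl.
have pq t : exists pq : rat * rat, 0 < t < d ->
    [/\ ratr pq.1 < t, t < ratr pq.2 &
     forall s, ratr pq.1 < s -> s < ratr pq.2 -> s != t -> g t < g s].
  have [t0d|] := boolP (0 < t < d); last by exists (0, 0).
  have [e1 /= e10 h1] := hr t t0d.
  have [e2 /= e20 h2] := hl t t0d.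
  have /rat_in_itvoo[q] : t < t + e1 by rewrite ltrDl.
  rewrite in_itv /= => /andP[tq qe].
  have /rat_in_itvoo[p] : t - e2 < t by rewrite gtrBl.
  rewrite in_itv /= => /andP[ep pt].
  exists (p, q) => _; split => //= s ps sq st.
  have [lts|lst|ts] := ltgtP t s.
  - by apply: h1 => //=; rewrite ltr0_norm ?subr_lt0// opprB ltrBlDl (lt_trans sq).
  - by apply: h2 => //=; rewrite gtr0_norm ?subr_gt0// ltrBlDl -ltrBlDr (lt_trans ep).
  - by move: st; rewrite ts eqxx.
have [F hF] := choice pq.
have cI : countable [set` `]0, d[%R].
  have : {in [set` `]0, d[%R] &, injective F}.
    move=> s t; rewrite !inE /= !in_itv /= => s0d t0d Fst.
    have [s1 s2 hs] := hF s s0d; have [t1 t2 ht] := hF t t0d.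
    apply/eqP/negPn/negP => st.
    rewrite Fst in s1 s2 hs.
    have := hs t t1 t2; rewrite eq_sym => /(_ st) h1.
    have := ht s s1 s2 st; rewrite ltNge => /negP; apply; exact: ltW.
  move=> Finj; apply/countable_injP; exists (choice.pickle \o F) => s t sI tI.
  by move=> /(pcan_inj choice.pickleK)/Finj; apply.
have := countable_lebesgue_measure0 cI; rewrite lebesgue_measure_itv /= lte_fin d0.
by rewrite sube0 => /eqP; rewrite eqe gt_eqF.
Qed.

Definition one_sided_type (F : R -> set_system R) g (d : R) :=
  (forall t, 0 < t < d -> \forall s \near F t, g t < g s) \/
  (forall t, 0 < t < d -> \forall s \near F t, g s < g t) \/
  (forall t, 0 < t < d -> \forall s \near F t, g s = g t).

(** Of the three left types, the first makes every point a strict local minimum, and the third makes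
    [g] constant on an interval to the left of [d / 2], against strict growth on the right. *)
Lemma nondecreasing_of_right_gt g (d : R) : 0 < d ->
  (forall t, 0 < t < d -> \forall s \near t^'+, g t < g s) ->
  one_sided_type (fun t => t^'-) g d ->
  forall s t, 0 < s -> s <= t -> t < d -> g s <= g t.
Proof.
move=> d0 hr [hl|[hl|hl]].
- by have := not_all_strict_local_min d0 hr hl.
- apply: locally_nondecreasing_itv => t /[dup] t0d.
    by move=> /hr; apply: filterS => s; exact: ltW.
  by move=> /hl; apply: filterS => s; exact: ltW.
- have d20 : 0 < d / 2 < d by rewrite divr_gt0//= ltr_pdivrMr// ltr_pMr// ltr1n.
  have /andP[d2p d2d] := d20.
  have : \forall s \near (d / 2)^'-, False.
    have [e /= e0 he] := hl _ d20; near=> s.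
    have s0d : 0 < s < d.
      apply/andP; split; first by near: s; exact: nbhs_left_gt.
      by apply: lt_trans d2d; near: s; exact: nbhs_left_lt.
    have sd2 : s < d / 2 by near: s; exact: nbhs_left_lt.
    have se : d / 2 - e < s by near: s; apply: nbhs_left_gt; rewrite gtrBl.
    have hE u : s <= u -> u < d / 2 -> g u = g (d / 2).
      move=> su ud; apply: he => //=; rewrite gtr0_norm ?subr_gt0// ltrBlDl -ltrBlDr.
      exact: lt_le_trans su.
    have : \forall u \near s^'+, False.
      have hs := hr _ s0d; near=> u.
      have : g s < g u by near: u.
      have su : s <= u by apply: ltW; near: u; exact: nbhs_right_gt.
      have ud : u < d / 2 by near: u; exact: nbhs_right_lt.
      by rewrite (hE s)// (hE u)// ltxx.
    by case/filter_ex.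
  by case/filter_ex.
Unshelve. all: by end_near. Qed.

Lemma monotone_of_types g (d : R) : 0 < d ->
  one_sided_type (fun t => t^'+) g d -> one_sided_type (fun t => t^'-) g d ->
  (forall s t, 0 < s -> s <= t -> t < d -> g s <= g t) \/
  (forall s t, 0 < s -> s <= t -> t < d -> g t <= g s).
Proof.
move=> d0 [hr|[hr|hr]] hl.
- by left; exact: nondecreasing_of_right_gt.
- right=> s t s0 st td; rewrite -lerN2.
  apply: (@nondecreasing_of_right_gt (fun x => - g x) d) => // [u u0d|].
    by apply: filterS (hr u u0d) => v; rewrite ltrN2.
  case: hl => [hl|[hl|hl]]; [right; left|left|right; right];
    by move=> u u0d; apply: filterS (hl u u0d) => v; rewrite ?ltrN2// => ->.
- case: hl => [hl|hl]; last first.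
    left; apply: locally_nondecreasing_itv => t t0d.
      by apply: filterS (hr t t0d) => s ->.
    by case: hl => hl; apply: filterS (hl t t0d) => s; [exact: ltW|move=> ->].
  right=> s t s0 st td; rewrite -lerN2.
  apply: (@locally_nondecreasing_itv (fun x => - g x) d) => // u u0d.
    by apply: filterS (hr u u0d) => v ->.
  by apply: filterS (hl u u0d) => v; rewrite lerN2 => /ltW.
Qed.

Definition definable_fun g (d : R) := exists2 P : seq R -> Prop, definable P &
  forall e, 0 < nth 0 e 0 < d -> (P e <-> nth 0 e 1 = g (nth 0 e 0)).

Lemma definable_subst (P : seq R -> Prop) i j : i != j -> definable P ->
  definable (fun e => P (set_nth 0 e i (nth 0 e j))).
Proof.
move=> ij dP.
have := definable_ex i (definable_and
  (definable_eq (poly_env_var R i) (poly_env_var R j)) dP).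
apply: definable_ext => e; split=> [[x]|h].
  by rewrite !nth_set_nth /= eqxx eq_sym (negbTE ij) => -[-> ].
by exists (nth 0 e j); rewrite !nth_set_nth /= eqxx eq_sym (negbTE ij).
Qed.

(** Entries 0 and 2 hold two arguments; entries 3 and 4 hold their values and are quantified away.
    Entry 1 is the value slot of the graph formula. *)
Lemma definable_fun_rel g d (c : R -> R -> Prop) :
  definable (fun e => c (nth 0 e 3) (nth 0 e 4)) -> definable_fun g d ->
  exists2 C, definable C & forall e, 0 < nth 0 e 0 < d -> 0 < nth 0 e 2 < d ->
    (C e <-> c (g (nth 0 e 0)) (g (nth 0 e 2))).
Proof.
move=> D3 [P dP hP].
have D1 := definable_subst (isT : 1 != 3)%N dP.
have D2 := definable_subst (isT : 0 != 2)%N (definable_subst (isT : 1 != 4)%N dP).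
have DD := definable_ex 3 (definable_ex 4 (definable_and D1 (definable_and D2 D3))).
eexists; first exact: DD.
move=> e e0 e2 /=; split.
  move=> [y [z []]].
  rewrite !hP ?nth_set_nth /= ?nth_set_nth //= ?nth_set_nth //=.
  by move=> -> [->].
move=> h; exists (g (nth 0 e 0)), (g (nth 0 e 2)).
rewrite !hP ?nth_set_nth /= ?nth_set_nth //= ?nth_set_nth //=.
Qed.

Lemma definable_near (o : R -> R -> Prop) (C : seq R -> Prop) (c : R -> R -> Prop) d :
  definable (fun e => o (nth 0 e 0) (nth 0 e 2)) -> definable C ->
  (forall e, 0 < nth 0 e 0 < d -> 0 < nth 0 e 2 < d ->
     (C e <-> c (nth 0 e 0) (nth 0 e 2))) ->
  exists2 Q, definable Q & forall e, 0 < nth 0 e 0 < d ->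
    (Q e <-> \forall s \near within (o (nth 0 e 0)) (nbhs (nth 0 e 0)), c (nth 0 e 0) s).
Proof.
move=> dO dC hC.
have D0 := definable_lt (poly_env_cst 0) (poly_env_var R 5).
have D1 := definable_lt (poly_env_var R 0) (poly_envD (poly_env_var R 2) (poly_env_var R 5)).
have D2 := definable_lt (poly_env_var R 2) (poly_envD (poly_env_var R 0) (poly_env_var R 5)).
have DD := definable_ex 5 (definable_and D0
  (definable_all 2 (definable_imp dO (definable_imp D1 (definable_imp D2 dC))))).
eexists; first exact: DD.
move=> e /andP[e0 ed] /=; split.
  move=> [del []]; rewrite !nth_set_nth /= => del0 h.
  suff : \forall s \near nth 0 e 0, o (nth 0 e 0) s -> c (nth 0 e 0) s by [].
  near=> s => os.
  have s1 : nth 0 e 0 < s + del.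
    by rewrite -ltrBlDr; near: s; apply: lt_nbhsr; rewrite gtrBl.
  have s2 : s < nth 0 e 0 + del by near: s; apply: lt_nbhsl; rewrite ltrDl.
  have s0 : 0 < s by near: s; exact: lt_nbhsr.
  have sd : s < d by near: s; exact: lt_nbhsl.
  have := h s; rewrite !nth_set_nth /= !nth_set_nth /= => /(_ os s1 s2).
  by rewrite hC !nth_set_nth /= ?nth_set_nth /= ?e0 ?ed // s0.
move=> [del /= del0 h].
(* The radius is cut down so that [s] stays in []0, d[], where [C] is known to express [c]. *)
exists (Num.min del (Num.min (nth 0 e 0) (d - nth 0 e 0))); split.
  by rewrite nth_set_nth /= !lt_min del0 e0 subr_gt0.
move=> s; rewrite !nth_set_nth /= !nth_set_nth /= => os.
rewrite -!ltrBlDl !lt_min => /and3P[a1 a2 _] /and3P[b1 _ b2].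
rewrite hC !nth_set_nth /= ?nth_set_nth /= ?e0 //.
  by apply: h => //=; rewrite ltr_norml; apply/andP; split; lra.
by apply/andP; split; lra.
Unshelve. all: by end_near. Qed.

Lemma definable_eventually_const (Q : seq R -> Prop) (q : R -> Prop) (d : R) :
  0 < d -> definable Q ->
  (forall e, 0 < nth 0 e 0 < d -> (Q e <-> q (nth 0 e 0))) ->
  exists d', [/\ 0 < d', d' <= d &
    (forall t, 0 < t < d' -> q t) \/ (forall t, 0 < t < d' -> ~ q t)].
Proof.
move=> d0 dQ hQ.
have hq t : 0 < t < d -> (Q (set_nth 0 [::] 0 t) <-> q t) by move=> td; rewrite hQ.
have [[a /= a0 h]|[a /= a0 h]] := @germ_const _ (0^'+) _ Q [::] 0 (germ_right 0) dQ;
  exists (Num.min a d); rewrite lt_min a0 d0 ge_min lexx orbT; split=> //;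
  [left|right] => t /andP[t0]; rewrite lt_min => /andP[ta td].
- by apply/hq; [rewrite t0 td|apply: h => //=; rewrite sub0r normrN gtr0_norm].
- move=> /hq; rewrite t0 td => /(_ isT); apply: h => //=.
  by rewrite sub0r normrN gtr0_norm.
Qed.

(** On each side of [t] the sign of [g s - g t] is eventually constant in [s]. Which sign occurs is
    a definable condition on [t], hence the same for all small [t]. The two resulting one-sided
    types force monotonicity. *)
Lemma definable_fun_monotone g (d : R) : 0 < d -> definable_fun g d ->
  exists d', [/\ 0 < d', d' <= d &
  (forall s t, 0 < s -> s <= t -> t < d' -> g s <= g t) \/
  (forall s t, 0 < s -> s <= t -> t < d' -> g t <= g s)].
Proof.
move=> d0 dg.
have [C1 dC1 hC1] := definable_fun_rel (c := fun x y => x < y)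
  (definable_lt (poly_env_var R 3) (poly_env_var R 4)) dg.
have [C2 dC2 hC2] := definable_fun_rel (c := fun x y => y < x)
  (definable_lt (poly_env_var R 4) (poly_env_var R 3)) dg.
have types (o : R -> R -> Prop) (F := fun t => within (o t) (nbhs t))
    (FF : forall t, ProperFilter (F t)) :
    (forall t, germ (F t)) -> definable (fun e => o (nth 0 e 0) (nth 0 e 2)) ->
    exists d', [/\ 0 < d', d' <= d & one_sided_type F g d'].
  move=> gF dO.
  have F0 t : 0 < t < d -> \forall s \near F t, 0 < s < d.
    move=> /andP[t0 td]; suff : \forall s \near t, o t s -> 0 < s < d by [].
    near=> s => _.
    by apply/andP; split; near: s; [exact: lt_nbhsr|exact: lt_nbhsl].
  have [Q1 dQ1 hQ1] := definable_near (c := fun x y => g x < g y) dO dC1 hC1.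
  have [Q2 dQ2 hQ2] := definable_near (c := fun x y => g y < g x) dO dC2 hC2.
  have [d1 [d10 d1d]] := definable_eventually_const
    (q := fun t => \forall s \near F t, g t < g s) d0 dQ1 hQ1.
  case=> h1; first by exists d1; split=> //; left.
  have hQ2' e : 0 < nth 0 e 0 < d1 -> (Q2 e <-> \forall s \near F (nth 0 e 0), g s < g (nth 0 e 0)).
    by move=> /andP[x y]; apply: hQ2; rewrite x (lt_le_trans y).
  have [d2 [d20 d2d]] := definable_eventually_const
    (q := fun t => \forall s \near F t, g s < g t) d10 dQ2 hQ2'.
  case=> h2; first by exists d2; split=> //; [exact: le_trans d1d|right; left].
  exists d2; split=> //; first exact: le_trans d1d.
  right; right=> t t0d.
  have /andP[t0 td2] := t0d.
  have td1 : 0 < t < d1 by rewrite t0 (lt_le_trans td2).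
  have td : 0 < t < d by rewrite t0 (lt_le_trans td2)// (le_trans d2d).
  (* Both strict types are excluded for all small [t]; since each comparison is decided along [F t],
     only equality remains. *)
  have [n1|n1] := @germ_const _ (F t) _ C1 [:: t] 2 (gF t) dC1.
    exfalso; apply: (h1 t td1); apply: filterS2 n1 (F0 _ td) => s Cs s0.
    by move: Cs; rewrite hC1 //= ?nth_set_nth.
  have [n2|n2] := @germ_const _ (F t) _ C2 [:: t] 2 (gF t) dC2.
    exfalso; apply: (h2 t t0d); apply: filterS2 n2 (F0 _ td) => s Cs s0.
    by move: Cs; rewrite hC2 //= ?nth_set_nth.
  apply: filterS3 n1 n2 (F0 _ td) => s + + s0.
  rewrite hC1//= ?nth_set_nth//= hC2//= ?nth_set_nth//=.
  by move=> /negP + /negP; rewrite -!leNgt => a b; apply/eqP; rewrite eq_le a b.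
have v0 := poly_env_var R 0; have v2 := poly_env_var R 2.
have [d1 [d10 d1d T1]] := types (fun t s => t < s) (fun t => at_right_proper_filter t) (@germ_right R) (definable_lt v0 v2).
have [d2 [d20 d2d T2]] := types (fun t s => s < t) (fun t => at_left_proper_filter t) (@germ_left R) (definable_lt v2 v0).
have typeS F e e' : e <= e' -> one_sided_type F g e' -> one_sided_type F g e.
  move=> ee' [T|[T|T]]; [left|right; left|right; right] => t /andP[t0 te];
    by apply: T; rewrite t0 (lt_le_trans te).
exists (Num.min d1 d2); rewrite lt_min d10 d20 ge_min d1d /=; split=> //.
apply: monotone_of_types; first by rewrite lt_min d10.
  by apply: typeS T1; rewrite ge_min lexx.
by apply: typeS T2; rewrite ge_min lexx orbT.
Unshelve. all: by end_near. Qed.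

End Monotonicity.

(** * Definable selection of a monotone curve *)

Section DefinableChoice.
Variable R : realType.

Lemma definable_same_env (P : seq R -> Prop) e e' : definable P ->
  (forall i, nth 0 e i = nth 0 e' i) -> P e -> P e'.
Proof.
by move=> [f hf] ee /hf h; apply/hf; apply: ord.eq_holds h => i.
Qed.

Lemma definable_forall_block (l : seq nat) (P : seq R -> Prop) : definable P ->
  definable (fun e => forall e', (forall i, i \notin l -> nth 0 e' i = nth 0 e i) -> P e').
Proof.
move=> dP; elim: l => [|i l IH].
  apply: definable_ext (dP) => e; split=> [Pe e' h|]; last by apply.
  by apply: (definable_same_env dP _ Pe) => i; rewrite h.
apply: definable_ext (definable_all i IH) => e; split=> h.
  move=> e' he'; apply: (h (nth 0 e' i)) => j jl.
  rewrite nth_set_nth /=; case: eqVneq => [->//|ji].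
  by apply: he'; rewrite in_cons negb_or ji jl.
move=> x e' he'; apply: h => j; rewrite in_cons negb_or => /andP[ji jl].
by rewrite he'// nth_set_nth /= (negbTE ji).
Qed.

(** Layout of environments from here on: entry 0 is the parameter, entries 1 to [N] the point, and
    entry [N.+1] a spare scalar. *)
Definition env_row N (e : seq R) : 'rV[R]_N := \row_i nth 0 e i.+1.

Lemma env_patch (e e' : seq R) (p : pred nat) :
  exists e1, forall k, nth 0 e1 k = if p k then nth 0 e' k else nth 0 e k.
Proof.
exists (mkseq (fun k => if p k then nth 0 e' k else nth 0 e k) (maxn (size e) (size e'))).
move=> k; have [kl|kl] := ltnP k (maxn (size e) (size e')); first by rewrite nth_mkseq.
rewrite nth_default ?size_mkseq//; move: kl; rewrite geq_max => /andP[k1 k2].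
by rewrite !nth_default// if_same.
Qed.

Lemma definable_forall_row N (P : R -> 'rV[R]_N -> R -> Prop) :
  definable (fun e => P (nth 0 e 0) (env_row N e) (nth 0 e N.+1)) ->
  definable (fun e => forall y, P (nth 0 e 0) y (nth 0 e N.+1)).
Proof.
move=> dP; apply: definable_ext (definable_forall_block (iota 1 N) dP) => e.
have l0 : 0%N \notin iota 1 N by rewrite mem_iota.
have lN : N.+1 \notin iota 1 N by rewrite mem_iota add1n ltnn andbF.
split=> h; last by move=> e' he'; rewrite !he'.
move=> y.
pose e'  : seq R := 0 :: [seq y 0 i | i <- enum 'I_N].
have e'y : env_row N e' = y.
  apply/rowP => i; rewrite mxE /=.
  by rewrite (nth_map i) ?size_enum_ord// nth_ord_enum.
have [e1 e1E] := env_patch e e' [in iota 1 N].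
have := h e1; rewrite !e1E /= (negbTE l0) (negbTE lN).
have -> : env_row N e1 = y.
  rewrite -e'y; apply/rowP => i; rewrite !mxE e1E /= mem_iota /= add1n ltnS.
  by rewrite ltn_ord.
by apply=> k /negbTE kl; rewrite e1E /= kl.
Qed.

Lemma definable_exists_row N (P : R -> 'rV[R]_N -> R -> Prop) :
  definable (fun e => P (nth 0 e 0) (env_row N e) (nth 0 e N.+1)) ->
  definable (fun e => exists y, P (nth 0 e 0) y (nth 0 e N.+1)).
Proof.
move=> dP; have := definable_not (definable_forall_row
  (P := fun t y z => ~ P t y z) (definable_not dP)).
apply: definable_ext => e; split; last by move=> [y Py] /(_ y).
by move=> /existsNP[y /contrapT Py]; exists y.
Qed.

Definition minimizers N (h : 'rV[R]_N -> R) (D : R -> 'rV[R]_N -> Prop) (t : R) x :=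
  D t x /\ forall y, D t y -> h x <= h y.

Lemma definable_minimizers N (h : 'rV[R]_N -> R) (D : R -> 'rV[R]_N -> Prop) (d : R) :
  continuous h -> poly_env (fun e => h (env_row N e)) ->
  definable (fun e => D (nth 0 e 0) (env_row N e)) ->
  (forall t : R, 0 < t < d -> compact [set x | D t x]) ->
  (forall t : R, 0 < t < d -> exists x, D t x) ->
  [/\ definable (fun e => minimizers h D (nth 0 e 0) (env_row N e)),
   (forall t : R, 0 < t < d -> compact [set x | minimizers h D t x]) &
   (forall t : R, 0 < t < d -> exists x, minimizers h D t x)].
Proof.
move=> ch ph dD cD nD.
have Dmin t : 0 < t < d -> exists x, minimizers h D t x.
  move=> td; have [x Dx] := nD t td.
  have [||c] := @compact_EVT_max _ R (fun x => - h x) [set x | D t x] _ (cD t td).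
  - by exists x.
  - by apply: continuous_subspaceT => y; exact: (cvgN (ch y)).
  rewrite inE /= => Dc hc; exists c; split=> // y Dy; rewrite -lerN2; apply: hc.
  by rewrite inE.
split=> // [|t td].
  have D1 : definable (fun e => D (nth 0 e 0) (env_row N e) -> nth 0 e N.+1 <= h (env_row N e)).
    by apply: definable_imp => //; apply: definable_le => //; exact: poly_env_var.
  have D2 := definable_ex N.+1 (definable_and (definable_eq (poly_env_var R N.+1) ph)
    (definable_forall_row (P := fun t y z => D t y -> z <= h y) D1)).
  apply: definable_ext (definable_and dD D2) => e.
  have rE z : env_row N (set_nth 0 e N.+1 z) = env_row N e.
    by apply/rowP => i; rewrite !mxE nth_set_nth /= eqSS ltn_eqF.
  split=> [[De [z]]|[De hm]].
    by rewrite rE !nth_set_nth /= eqxx => -[-> hm]; split.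
  by split=> //; exists (h (env_row N e)); rewrite rE !nth_set_nth /= eqxx.
have [c [Dc hc]] := Dmin t td.
have -> : [set x | minimizers h D t x] = [set x | D t x] `&` h @^-1` [set r | r <= h c].
  apply/seteqP; split=> x /= [Dx hx]; split=> //; first exact: hx.
  by move=> y /hc; apply: le_trans.
apply: compact_closedI; first exact: cD.
by apply: closed_comp => [x _|]; [exact: ch|exact: closed_le].
Qed.

(* Lexicographic minimisation: the first [j] coordinates are made to depend on
   the parameter only. *)
Lemma definable_lexmin N (D : R -> 'rV[R]_N -> Prop) (d : R) j :
  definable (fun e => D (nth 0 e 0) (env_row N e)) ->
  (forall t : R, 0 < t < d -> compact [set x | D t x]) ->
  (forall t : R, 0 < t < d -> exists x, D t x) -> (j <= N)%N ->
  exists D' : R -> 'rV[R]_N -> Prop,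
  [/\ definable (fun e => D' (nth 0 e 0) (env_row N e)),
   (forall t : R, 0 < t < d -> compact [set x | D' t x]),
   (forall t : R, 0 < t < d -> exists x, D' t x),
   (forall t x, D' t x -> D t x) &
   (forall t x y (i : 'I_N), D' t x -> D' t y -> (i < j)%N -> x 0 i = y 0 i)].
Proof.
move=> dD cD nD; elim: j => [_|j IH jN]; first by exists D.
have [E [dE cE nE ED Ej]] := IH (ltnW jN); pose jj := Ordinal jN.
have [||dM cM nM] := definable_minimizers (h := fun x : 'rV[R]_N => x 0 jj) _ _ dE cE nE.
- by move=> x; exact: (@coord_continuous R 1 N 0 jj x).
- by have [t ht] := poly_env_var R j.+1; exists t => e; rewrite ht mxE.
exists (minimizers (fun x : 'rV[R]_N => x 0 jj) E); split=> //.
- by move=> t x [/ED].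
- move=> t x y i [Ex hx] [Ey hy]; rewrite ltnS leq_eqVlt => /orP[/eqP ij|]; last exact: (Ej t x y i Ex Ey).
  have -> : i = jj by exact: val_inj.
  by apply/eqP; rewrite eq_le hx// hy.
Qed.

(** The lexicographic minimum of [D t] is a single point, so each of its coordinates is a definable
    function of [t], monotone near 0. The sign [s i] records the direction, so that all
    [s i * x t 0 i] are nondecreasing. *)
Lemma definable_monotone_choice N (D : R -> 'rV[R]_N -> Prop) (d : R) : 0 < d ->
  definable (fun e => D (nth 0 e 0) (env_row N e)) ->
  (forall t : R, 0 < t < d -> compact [set x | D t x]) ->
  (forall t : R, 0 < t < d -> exists x, D t x) ->
  exists (x : R -> 'rV[R]_N) (s : 'I_N -> R) d', [/\ 0 < d', d' <= d,
   (forall i, s i = 1 \/ s i = -1), (forall t : R, 0 < t < d' -> D t (x t)) &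
   forall u t i, 0 < u -> u <= t -> t < d' -> s i * x u 0 i <= s i * x t 0 i].
Proof.
move=> d0 dD cD nD.
have [E [dE _ nE ED EN]] := definable_lexmin dD cD nD (leqnn N).
have ex t : exists x, 0 < t < d -> E t x.
  have [/nE[x Ex]|] := boolP (0 < t < d); first by exists x.
  by exists 0.
have [x xE] := choice ex.
have df i : definable_fun (fun t => x t 0 i) d.
  have D1 : definable (fun e => E (nth 0 e 0) (env_row N e) /\
      nth 0 e N.+1 = (env_row N e) 0 i).
    apply: definable_and => //; apply: definable_eq; first exact: poly_env_var.
    by have [t ht] := poly_env_var R i.+1; exists t => e; rewrite ht mxE.
  have D2 := definable_ex N.+1 (definable_and
    (definable_eq (poly_env_var R N.+1) (poly_env_var R 1))
    (definable_exists_row (P := fun t y z => E t y /\ z = y 0 i) D1)).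
  eexists; first exact: D2.
  have N0 : (0 == N)%N = false by rewrite ltn_eqF// (leq_ltn_trans _ (ltn_ord i)).
  move=> e e0d /=; split.
    move=> [z []]; rewrite !nth_set_nth /= eqxx eqSS N0 => <- [y [Ey ->]].
    by apply: EN Ey (xE _ e0d) _.
  move=> h; exists (nth 0 e 1); rewrite !nth_set_nth /= eqxx eqSS N0; split=> //.
  by exists (x (nth 0 e 0)); split=> //; exact: xE.
have mono i : exists ds : R * R, [/\ 0 < ds.1, ds.1 <= d, ds.2 = 1 \/ ds.2 = -1 &
    forall u t, 0 < u -> u <= t -> t < ds.1 -> ds.2 * x u 0 i <= ds.2 * x t 0 i].
  have [d' [d'0 d'd [h|h]]] := definable_fun_monotone d0 (df i).
    exists (d', 1); split=> //=; first by left.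
    by move=> u t u0 ut td; rewrite !mul1r h.
  exists (d', -1); split=> //=; first by right.
  by move=> u t u0 ut td; rewrite !mulN1r lerN2 h.
have [ds dsP] := choice mono.
pose d' := \big[Num.min/d]_i (ds i).1.
have d'i i : d' <= (ds i).1 by exact: bigmin_le_cond.
exists x, (fun i => (ds i).2), d'; split.
- by rewrite /d'; apply: lt_bigmin => // i _; case: (dsP i).
- exact: bigmin_le_id.
- by move=> i; case: (dsP i).
- move=> t /andP[t0 td]; apply/ED/xE; rewrite t0 (lt_le_trans td)//.
  exact: bigmin_le_id.
- move=> u t i u0 ut td; have [_ _ _] := dsP i; apply=> //.
  exact: lt_le_trans (d'i i).
Qed.

End DefinableChoice.

(** * Gradient descent on polynomial functions *)

Section PolyFun.
Variables (R : realType) (N : nat).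
Implicit Types (h : 'rV[R]_N -> R) (x y v : 'rV[R]_N).

Inductive polyfun : ('rV[R]_N -> R) -> Prop :=
| polyfun_cst c : polyfun (fun=> c)
| polyfun_coord i : polyfun (fun x => x 0 i)
| polyfunD h1 h2 : polyfun h1 -> polyfun h2 -> polyfun (fun x => h1 x + h2 x)
| polyfunM h1 h2 : polyfun h1 -> polyfun h2 -> polyfun (fun x => h1 x * h2 x).

Lemma polyfun_ext h1 h2 : h1 =1 h2 -> polyfun h1 -> polyfun h2.
Proof. by move=> /funext ->. Qed.

Lemma polyfun_sum (I : Type) (r : seq I) (P : pred I) (F : I -> 'rV[R]_N -> R) :
  (forall i, P i -> polyfun (F i)) -> polyfun (fun x => \sum_(i <- r | P i) F i x).
Proof.
move=> hF; elim: r => [|i r IH].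
  by apply: polyfun_ext (polyfun_cst 0) => x; rewrite big_nil.
case hP : (P i); last by apply: polyfun_ext IH => x; rewrite big_cons hP.
by apply: polyfun_ext (polyfunD (hF i hP) IH) => x; rewrite big_cons hP.
Qed.

Lemma polyfunN h : polyfun h -> polyfun (fun x => - h x).
Proof.
move=> ph; apply: polyfun_ext (polyfunM (polyfun_cst (-1)) ph) => x.
by rewrite mulN1r.
Qed.

Lemma polyfun_sqr h : polyfun h -> polyfun (fun x => h x ^+ 2).
Proof. by move=> ph; apply: polyfun_ext (polyfunM ph ph) => x; rewrite expr2. Qed.

Lemma polyfun_continuous h : polyfun h -> continuous h.
Proof.
elim=> [c|i|h1 h2 _ c1 _ c2|h1 h2 _ c1 _ c2] x.
- exact: cst_continuous.
- exact: (@coord_continuous R 1 N 0 i x).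
- exact: (cvgD (c1 x) (c2 x)).
- exact: (cvgM (c1 x) (c2 x)).
Qed.

Lemma polyfun_env h : polyfun h -> poly_env (fun e => h (env_row N e)).
Proof.
elim=> [c|i|h1 h2 _ c1 _ c2|h1 h2 _ c1 _ c2].
- exact: poly_env_cst.
- by have [t ht] := poly_env_var R i.+1; exists t => e; rewrite ht mxE.
- exact: poly_envD.
- exact: poly_envM.
Qed.

(** The norm carried by row vectors is the maximum norm; the squared Euclidean length is used
    because it is polynomial. *)
Definition nsq v : R := \sum_i v 0 i ^+ 2.
Definition cube (M : R) : set 'rV[R]_N := [set x | forall i, `|x 0 i| <= M].

Lemma nsq_ge0 v : 0 <= nsq v.
Proof. by apply: sumr_ge0 => i _; rewrite sqr_ge0. Qed.

Lemma coord_le_nsq v i : v 0 i ^+ 2 <= nsq v.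
Proof.
by rewrite /nsq (bigD1 i)//= lerDl sumr_ge0// => j _; rewrite sqr_ge0.
Qed.

Lemma nsq_eq0 v : nsq v = 0 -> v = 0.
Proof.
move=> v0; apply/rowP => i; rewrite mxE; apply/eqP; rewrite -sqrf_eq0 eq_le sqr_ge0 andbT.
by rewrite -v0 coord_le_nsq.
Qed.

Lemma nsq_le_sqr_sum v : nsq v <= (\sum_i `|v 0 i|) ^+ 2.
Proof.
rewrite expr2 mulr_suml; apply: ler_sum => i _.
rewrite -real_normK ?num_real// expr2 ler_wpM2l// (bigD1 i)//= lerDl.
by rewrite sumr_ge0.
Qed.

(** [G] is a formal gradient built along [polyfun]. The bounds on the value and on the squared
    increment are carried in the induction because the remainder of a product involves both factors
    and the product of their increments. *)
Lemma polyfun_taylor h : polyfun h ->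
  exists2 G : 'rV[R]_N -> 'rV[R]_N, (forall i, polyfun (fun x => G x 0 i)) &
  forall M : R, exists2 K : R, 0 <= K & forall x y, cube M x -> cube M y ->
    [/\ `|h x| <= K, (h y - h x) ^+ 2 <= K * nsq (y - x) &
     `|h y - h x - \sum_i G x 0 i * (y - x) 0 i| <= K * nsq (y - x)].
Proof.
elim=> [c|i|h1 h2 p1 [G1 pG1 H1] p2 [G2 pG2 H2]|h1 h2 p1 [G1 pG1 H1] p2 [G2 pG2 H2]].
- exists (fun=> 0) => [i|M].
    by apply: polyfun_ext (polyfun_cst 0) => x; rewrite mxE.
  exists `|c| => // x y _ _; rewrite subrr expr0n /= mulr_ge0// ?nsq_ge0//; split=> //.
  by rewrite big1 ?subrr ?normr0 ?mulr_ge0 ?nsq_ge0// => i _; rewrite mxE mul0r.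
- exists (fun=> delta_mx 0 i) => [j|M].
    by apply: polyfun_ext (polyfun_cst ((delta_mx 0 i : 'rV[R]_N) 0 j)) => x.
  exists (1 + `|M|) => [|x y Mx My]; first by rewrite addr_ge0.
  split.
  - by rewrite (le_trans (Mx i))// (le_trans (ler_norm M))// lerDr.
  - apply: le_trans (ler_peMl _ _); rewrite ?nsq_ge0 ?lerDl//.
    by apply: le_trans (coord_le_nsq _ i); rewrite !mxE.
  - rewrite (bigD1 i)//= big1 => [|j ji]; last by rewrite mxE (negbTE ji) andbF mul0r.
    by rewrite !mxE !eqxx mul1r addr0 subrr normr0 mulr_ge0// ?nsq_ge0// addr_ge0.
- exists (fun x => G1 x + G2 x) => [i|M].
    by apply: polyfun_ext (polyfunD (pG1 i) (pG2 i)) => x; rewrite mxE.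
  have [K1 K10 {}H1] := H1 M; have [K2 K20 {}H2] := H2 M.
  exists (2 * K1 + 2 * K2) => [|x y Mx My]; first by lra.
  have [a1 b1 c1] := H1 x y Mx My; have [a2 b2 c2] := H2 x y Mx My.
  have n0 := nsq_ge0 (y - x).
  have k1 : 0 <= K1 * nsq (y - x) by rewrite mulr_ge0.
  have k2 : 0 <= K2 * nsq (y - x) by rewrite mulr_ge0.
  split.
  - by apply: le_trans (ler_normD _ _) _; lra.
  - rewrite [X in X ^+ 2](_ : _ = (h1 y - h1 x) + (h2 y - h2 x)); last by ring.
    set a := h1 y - h1 x in b1 *; set b := h2 y - h2 x in b2 *.
    have : 0 <= (a - b) ^+ 2 by rewrite sqr_ge0.
    by nra.
  - rewrite [X in `|X|](_ : _ =
      (h1 y - h1 x - \sum_i G1 x 0 i * (y - x) 0 i) +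
      (h2 y - h2 x - \sum_i G2 x 0 i * (y - x) 0 i)); last first.
      have -> : \sum_i (G1 x + G2 x) 0 i * (y - x) 0 i =
         \sum_i G1 x 0 i * (y - x) 0 i + \sum_i G2 x 0 i * (y - x) 0 i.
        by rewrite -big_split; apply: eq_bigr => i _; rewrite mxE mulrDl.
      by ring.
    by apply: le_trans (ler_normD _ _) _; lra.
- exists (fun x => h1 x *: G2 x + h2 x *: G1 x) => [i|M].
    apply: polyfun_ext (polyfunD (polyfunM p1 (pG2 i)) (polyfunM p2 (pG1 i))) => x.
    by rewrite !mxE.
  have [K1 K10 {}H1] := H1 M; have [K2 K20 {}H2] := H2 M.
  (* One constant dominates three: [K1 * K2] for the value, the two cubic terms for the squared
     increment, and [K1 + K2 + 2 * (K1 * K2)] for the remainder. *)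
  exists (2 * (K1 * K2) + K1 + K2 + 2 * K1 ^+ 2 * K2 + 2 * K2 ^+ 2 * K1) => [|x y Mx My].
    by rewrite !addr_ge0// ?mulr_ge0// ?sqr_ge0.
  have [a1 b1 c1] := H1 x y Mx My; have [a2 b2 c2] := H2 x y Mx My.
  have [a1' _ _] := H1 y x My Mx.
  have n0 := nsq_ge0 (y - x).
  set n := nsq _ in n0 b1 b2 c1 c2 *.
  split.
  - rewrite normrM; apply: le_trans (ler_pM _ _ a1 a2) _ => //.
    have := mulr_ge0 (sqr_ge0 K1) K20; have := mulr_ge0 (sqr_ge0 K2) K10.
    by have := mulr_ge0 K10 K20; lra.
  - have e1 : h1 y ^+ 2 <= K1 ^+ 2 by rewrite -[h1 y ^+ 2]real_normK ?num_real// lerXn2r ?nnegrE.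
    have e2 : h2 x ^+ 2 <= K2 ^+ 2 by rewrite -[h2 x ^+ 2]real_normK ?num_real// lerXn2r ?nnegrE.
    rewrite [X in X ^+ 2](_ : _ = h1 y * (h2 y - h2 x) + h2 x * (h1 y - h1 x)); last by ring.
    set a := h1 y * _; set b := h2 x * _.
    have ha : a ^+ 2 <= K1 ^+ 2 * (K2 * n) by rewrite exprMn ler_pM// sqr_ge0.
    have hb : b ^+ 2 <= K2 ^+ 2 * (K1 * n) by rewrite exprMn ler_pM// sqr_ge0.
    have hab : (a + b) ^+ 2 <= 2 * (K1 ^+ 2 * (K2 * n)) + 2 * (K2 ^+ 2 * (K1 * n)).
      by have := sqr_ge0 (a - b); lra.
    apply: le_trans hab _.
    have := mulr_ge0 (mulr_ge0 K10 K20) n0; have := mulr_ge0 K10 n0.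
    have := mulr_ge0 K20 n0; lra.
  - set g1 := \sum_i G1 x 0 i * (y - x) 0 i in c1.
    set g2 := \sum_i G2 x 0 i * (y - x) 0 i in c2.
    have -> : \sum_i (h1 x *: G2 x + h2 x *: G1 x) 0 i * (y - x) 0 i = h1 x * g2 + h2 x * g1.
      rewrite /g1 /g2 !mulr_sumr -big_split /=; apply: eq_bigr => i _.
      by rewrite !mxE; ring.
    rewrite [X in `|X|](_ : _ = (h1 y - h1 x) * (h2 y - h2 x) +
       (h1 x * (h2 y - h2 x - g2) + h2 x * (h1 y - h1 x - g1))); last by ring.
    have e0 : `|(h1 y - h1 x) * (h2 y - h2 x)| <= (K1 + K2) * n.
      set a := h1 y - _ in b1 *; set b := h2 y - _ in b2 *.
      rewrite ler_norml; apply/andP; split.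
        by have := sqr_ge0 (a + b); have := sqr_ge0 a; have := sqr_ge0 b; lra.
      by have := sqr_ge0 (a - b); have := sqr_ge0 a; have := sqr_ge0 b; lra.
    have e1 : `|h1 x * (h2 y - h2 x - g2)| <= K1 * (K2 * n) by rewrite normrM ler_pM.
    have e2 : `|h2 x * (h1 y - h1 x - g1)| <= K2 * (K1 * n) by rewrite normrM ler_pM.
    apply: le_trans (ler_normD _ _) _; apply: le_trans (lerD e0 (ler_normD _ _)) _.
    have := mulr_ge0 (mulr_ge0 (sqr_ge0 K1) K20) n0.
    have := mulr_ge0 (mulr_ge0 (sqr_ge0 K2) K10) n0; lra.
Qed.

End PolyFun.

(** * The Kurdyka-Lojasiewicz inequality *)

Section KL.
Variables (R : realType) (N : nat).
Implicit Types (x y v : 'rV[R]_N).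

Lemma cube_compact (M : R) : compact (cube (N := N) M).
Proof.
have := @rV_compact R N (fun=> `[(- M), M]%classic) (fun=> @segment_compact _ _ _).
by congr compact; apply/seteqP; split=> x /= h i; have := h i; rewrite /= in_itv /= ler_norml.
Qed.

Lemma polyfun_nsq (G : 'rV[R]_N -> 'rV[R]_N) :
  (forall i, polyfun (fun x => G x 0 i)) -> polyfun (fun x => nsq (G x)).
Proof. by move=> pG; apply: polyfun_sum => i _; exact: polyfun_sqr. Qed.

Lemma definable_cube (M : R) : definable (fun e => cube M (env_row N e)).
Proof.
have : definable (fun e => forall i : 'I_N, - M <= (env_row N e) 0 i /\ (env_row N e) 0 i <= M).
  apply: definable_forall_ord => i; apply: definable_and; apply: definable_le;
    by [exact: poly_env_cst | exact: (polyfun_env (polyfun_coord R i))].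
by apply: definable_ext => e; split=> h i; have := h i; rewrite ler_norml => /andP.
Qed.

Variables (f : 'rV[R]_N -> R) (G : 'rV[R]_N -> 'rV[R]_N).
Hypotheses (pf : polyfun f) (pG : forall i, polyfun (fun x => G x 0 i)).

(** The curve follows the valley of [f]: on each small level it passes through a point of the cube
    with shortest gradient, so a lower bound for the gradient along it holds on the whole level. The
    first alternative is the case where small positive values are not taken. *)
Lemma level_minimal_curve (M : R) : exists2 d, 0 < d &
  (forall x, cube M x -> ~ (0 < f x < d)) \/
  exists (c : R -> 'rV[R]_N) (s : 'I_N -> R),
   [/\ (forall i, s i = 1 \/ s i = -1),
     (forall t, 0 < t < d -> cube M (c t) /\ f (c t) = t),
     (forall t y, 0 < t < d -> cube M y -> f y = t -> nsq (G (c t)) <= nsq (G y)) &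
     forall u t i, 0 < u -> u <= t -> t < d -> s i * c u 0 i <= s i * c t 0 i].
Proof.
have pg := polyfun_nsq pG.
have dlev : definable (fun e => cube M (env_row N e) /\ f (env_row N e) = nth 0 e 0).
  apply: definable_and; first exact: definable_cube.
  by apply: definable_eq; [exact: polyfun_env|exact: poly_env_var].
have [d [d0 _]] := definable_eventually_const
  (q := fun t => exists y, cube M y /\ f y = t) (@ltr01 R)
  (definable_exists_row (P := fun t y _ => cube M y /\ f y = t) dlev) (fun e _ => iff_refl _).
case=> [ne|em]; last first.
  by exists d => //; left=> x Mx fx; apply: (em (f x)) => //; exists x.
pose D t y := cube M y /\ f y = t.
have cD t : compact [set y | D t y].
  have -> : [set y | D t y] = cube M `&` f @^-1` [set t] by [].
  apply: compact_closedI; first exact: cube_compact.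
  by apply: closed_comp => [x _|]; [exact: polyfun_continuous|exact: closed_eq].
have [dE cE Emin] := definable_minimizers (polyfun_continuous pg) (polyfun_env pg)
  dlev (fun t _ => cD t) ne.
have [c [s [d' [d'0 d'd sP cP mono]]]] := definable_monotone_choice d0 dE cE Emin.
exists d' => //; right; exists c, s; split=> //.
- by move=> t /cP[].
- by move=> t y /cP[_ h] My fy; apply: h.
Qed.

(** An increment over a step of length [e] is at least [sqrt (k * e)]. Cutting [[a, b]] into [n]
    equal steps makes the total increment at least [sqrt (n * k * (b - a))], which is unbounded in
    [n]. *)
Lemma bounded_variation_sqr (psi : R -> R) (k a b : R) : a < b -> 0 < k ->
  ~ (forall u t, a <= u -> u < t -> t <= b -> psi u <= psi t /\ k * (t - u) <= (psi t - psi u) ^+ 2).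
Proof.
move=> ab k0 h; set V := psi b - psi a.
have ba0 : 0 < b - a by rewrite subr_gt0.
have key n : n.+1%:R * (k * (b - a)) <= V ^+ 2.
  pose p j := a + j%:R * ((b - a) / n.+1%:R).
  have p0 : p 0%N = a by rewrite /p mul0r addr0.
  have pn : p n.+1 = b by rewrite /p mulrC divfK ?pnatr_eq0// addrC subrK.
  have st : 0 < (b - a) / n.+1%:R by rewrite divr_gt0// ltr0n.
  have pS j : p j.+1 - p j = (b - a) / n.+1%:R by rewrite /p -natr1; ring.
  have pm i j : (i <= j)%N -> p i <= p j.
    by move=> ij; rewrite /p lerD2l ler_pM2r// ler_nat.
  pose w := Num.sqrt (k * ((b - a) / n.+1%:R)).
  have w0 : 0 <= w by exact: sqrtr_ge0.
  have w2 : w ^+ 2 = k * ((b - a) / n.+1%:R) by rewrite sqr_sqrtr// mulr_ge0// ltW.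
  have inc j : (j < n.+1)%N -> w <= psi (p j.+1) - psi (p j).
    move=> jn; have [|||h1 h2] := h (p j) (p j.+1).
    - by rewrite -p0 pm.
    - by rewrite -subr_gt0 pS.
    - by rewrite -pn pm.
    by rewrite -ler_sqr ?nnegrE ?subr_ge0// w2 -(pS j).
  have sumV : n.+1%:R * w <= V.
    rewrite /V -p0 -[in psi b]pn.
    rewrite -(telescope_sumr (fun j => psi (p j)) (leq0n n.+1)).
    rewrite big_mkord mulr_natl -[X in w *+ X](card_ord n.+1) -sumr_const.
    by apply: ler_sum => j _; apply: inc.
  have : (n.+1%:R * w) ^+ 2 <= V ^+ 2.
    have nw0 : 0 <= n.+1%:R * w by rewrite mulr_ge0.
    by rewrite lerXn2r ?nnegrE// (le_trans nw0).
  rewrite exprMn w2 [X in X <= _](_ : _ = n.+1%:R * (k * (b - a)))//.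
  have : (n.+1%:R : R) != 0 by rewrite pnatr_eq0.
  by move=> ?; field.
have kb0 : 0 < k * (b - a) by rewrite mulr_gt0.
have := key (Num.Def.archi_bound (V ^+ 2 / (k * (b - a)))).
have := archi_boundP (divr_ge0 (sqr_ge0 V) (ltW kb0)).
rewrite ltr_pdivrMr// => h1; rewrite leNgt => /negP; apply.
by apply: lt_le_trans h1 _; rewrite ler_pM2r// ler_nat.
Qed.

Lemma young_sum (a : R) (g v : 'rV[R]_N) : 0 < a ->
  \sum_i g 0 i * v 0 i <= a / 4 * nsq g + a^-1 * nsq v.
Proof.
move=> a0; rewrite /nsq !mulr_sumr -big_split /=; apply: ler_sum => i _.
set x := g 0 i; set y := v 0 i.
have : 0 <= a^-1 * (a / 2 * x - y) ^+ 2.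
  by rewrite mulr_ge0 ?sqr_ge0// invr_ge0 ltW.
rewrite [X in _ <= X -> _](_ : _ = a / 4 * x ^+ 2 + a^-1 * y ^+ 2 - x * y).
  by rewrite subr_ge0.
by have : a != 0 by [rewrite gt_eqF]; move=> ?; field.
Qed.

(* A Kurdyka-Lojasiewicz inequality, with the total variation of a curve of
   points of minimal gradient as desingularising function [psi]. *)
Lemma desingularization (M L : R) : 0 <= L ->
  (forall x y, cube M x -> cube M y ->
     `|f y - f x - \sum_i G x 0 i * (y - x) 0 i| <= L * nsq (y - x)) ->
  exists (d : R) (psi : R -> R), [/\ 0 < d,
   (forall u t, 0 <= u -> u <= t -> t < d -> psi u <= psi t),
   (forall e, 0 < e -> exists2 r, 0 < r < d & forall t, 0 <= t -> t <= r -> 0 <= psi t < e),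
   (forall y, cube M y -> 0 < f y -> f y < d -> 0 < nsq (G y)) &
   forall a, 0 < a -> exists2 k, 0 <= k & forall y u, cube M y -> 0 <= u ->
     u + a * nsq (G y) <= f y -> f y < d -> 0 < nsq (G y) ->
     nsq (G y) <= k * (psi (f y) - psi u) ^+ 2].
Proof.
move=> L0 HT.
have [d d0 [em|[c [s [sP cP cmin mono]]]]] := level_minimal_curve M.
  exists d, (fun=> 0); split=> //.
  - by move=> e e0; exists (d / 2) => [|t _ _]; [lra|rewrite lexx].
  - by move=> y My fy fd; case: (em y My); rewrite fy.
  - move=> a a0; exists 0 => // y u My u0 uy fd Gy.
    case: (em y My); rewrite fd andbT; apply: lt_le_trans uy.
    by apply: lt_le_trans (mulr_gt0 a0 Gy) _; rewrite lerDr.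
(* All summands are nondecreasing, so increments of [psi] are the sums of the absolute coordinate
   increments of [c]. *)
pose psi t := \sum_i s i * c t 0 i.
have normE i z : 0 <= s i * z -> s i * z = `|z|.
  by case: (sP i) => ->; rewrite ?mul1r ?mulN1r => h; [rewrite ger0_norm|rewrite ler0_norm// -oppr_ge0].
have psiB u t : 0 < u -> u <= t -> t < d -> psi t - psi u = \sum_i `|(c t - c u) 0 i|.
  move=> u0 ut td; rewrite /psi -sumrB; apply: eq_bigr => i _.
  by rewrite -mulrBr !mxE normE// mulrBr subr_ge0 mono.
have psim u t : 0 < u -> u <= t -> t < d -> psi u <= psi t.
  by move=> u0 ut td; rewrite -subr_ge0 psiB// sumr_ge0.
have npsi u t : 0 < u -> u <= t -> t < d -> nsq (c t - c u) <= (psi t - psi u) ^+ 2.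
  by move=> u0 ut td; rewrite psiB// nsq_le_sqr_sum.
(* As [f (c t) = t], Taylor's estimate from [c t] to [c u] bounds the difference of levels by the
   gradient at [c t] and the variation of the curve. *)
have drop u t : 0 < u -> u < t -> t < d ->
    t - u <= \sum_i G (c t) 0 i * (c t - c u) 0 i + L * (psi t - psi u) ^+ 2.
  move=> u0 ut td; have t0 := lt_trans u0 ut.
  have [Mt ft] : cube M (c t) /\ f (c t) = t by apply: cP; rewrite t0 td.
  have [Mu fu] : cube M (c u) /\ f (c u) = u by apply: cP; rewrite u0 (lt_trans ut).
  have := HT _ _ Mt Mu; rewrite ler_norml ft fu => /andP[+ _].
  have -> : \sum_i G (c t) 0 i * (c u - c t) 0 i = - \sum_i G (c t) 0 i * (c t - c u) 0 i.
    by rewrite -sumrN; apply: eq_bigr => i _; rewrite !mxE; ring.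
  have -> : nsq (c u - c t) = nsq (c t - c u).
    by apply: eq_bigr => i _; rewrite !mxE; ring.
  have := ler_wpM2l L0 (npsi _ _ u0 (ltW ut) td); lra.
(* A Sard-type statement. Otherwise every small level has a critical point, the gradient vanishes
   along [c] by minimality, and [drop] reduces to [t - u <= L * (psi t - psi u)^2], which
   [bounded_variation_sqr] excludes. *)
have [d1 [d10 d1d crit]] : exists d1, [/\ 0 < d1, d1 <= d &
    forall y, cube M y -> 0 < f y -> f y < d1 -> 0 < nsq (G y)].
  have dcr : definable (fun e => (cube M (env_row N e) /\ f (env_row N e) = nth 0 e 0)
      /\ nsq (G (env_row N e)) <= 0).
    apply: definable_and; last first.
      by apply: definable_le; [exact: (polyfun_env (polyfun_nsq pG))|exact: poly_env_cst].
    apply: definable_and; first exact: definable_cube.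
    by apply: definable_eq; [exact: polyfun_env|exact: poly_env_var].
  have [d1 [d10 d1d]] := definable_eventually_const
    (q := fun t => exists y, (cube M y /\ f y = t) /\ nsq (G y) <= 0) d0
    (definable_exists_row (P := fun t y _ => (cube M y /\ f y = t) /\ nsq (G y) <= 0) dcr)
    (fun e _ => iff_refl _).
  case=> h; last first.
    exists d1; split=> // y My fy0 fyd; rewrite ltNge; apply/negP => Gy.
    by apply: (h (f y)); [rewrite fy0|exists y].
  exfalso; apply: (@bounded_variation_sqr psi (L + 1)^-1 (d1 / 3) (d1 / 2)).
  - by lra.
  - by rewrite invr_gt0; lra.
  move=> u t ua ut tb.
  have u0 : 0 < u by lra.
  have td1 : t < d1 by lra.
  have td := lt_le_trans td1 d1d.
  split; first by apply: psim => //; exact: ltW.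
  have [y [[My fy] Gy]] : exists y, (cube M y /\ f y = t) /\ nsq (G y) <= 0.
    by apply: h; lra.
  have Gct : G (c t) = 0.
    apply: nsq_eq0; apply/eqP; rewrite eq_le nsq_ge0 andbT; apply: le_trans Gy.
    by apply: cmin => //; rewrite td andbT; lra.
  have := drop _ _ u0 ut td; rewrite Gct big1 => [|i _]; last by rewrite mxE mul0r.
  rewrite add0r => h1; rewrite mulrC ler_pdivrMr; last by lra.
  by have := sqr_ge0 (psi t - psi u); lra.
(* The infimum of [psi] is its limit at 0, finite because the curve stays in the cube. Subtracting
   it makes [Psi] tend to 0, which matches the value 0 given to [Psi] at level 0. *)
pose A := [set psi t | t in [set t | 0 < t < d1]].
have hA : has_inf A.
  split; first by exists (psi (d1 / 2)); exists (d1 / 2) => //=; lra.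
  exists (- \sum_(i < N) `|M|) => _ [t /= /andP[t0 td] <-].
  rewrite -sumrN; apply: ler_sum => i _.
  have [|+ _] := cP t; first by rewrite t0 (lt_le_trans td).
  move=> /(_ i) h; suff : `|s i * c t 0 i| <= `|M| by rewrite ler_norml => /andP[].
  rewrite normrM; have -> : `|s i| = 1 by case: (sP i) => ->; rewrite ?normrN normr1.
  by rewrite mul1r (le_trans h)// ler_norm.
pose Psi t := if 0 < t then psi t - inf A else 0.
have infA t : 0 < t -> t < d1 -> 0 <= psi t - inf A.
  by move=> t0 td; rewrite subr_ge0; apply: ge_inf; [case: hA|exists t => //=; rewrite t0].
exists d1, Psi; split=> //.
- move=> u t u0 ut td; rewrite /Psi; case: ifPn => [u0'|u0'].
    by rewrite (lt_le_trans u0' ut) lerD2r psim// (lt_le_trans td).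
  by case: ifPn => // t0; exact: infA.
- move=> e e0; have [_ [r /= /andP[r0 rd] <-] hr] := inf_adherent e0 hA.
  exists r => [|t t0 tr]; first by rewrite r0.
  rewrite /Psi; case: ifPn => [t0'|]; last by rewrite lexx.
  have td := le_lt_trans tr rd.
  rewrite infA//= ltrBlDl (le_lt_trans _ hr)// psim//.
  exact: lt_le_trans d1d.
- move=> a a0; exists (4 / a * (a^-1 + L)).
    by rewrite mulr_ge0 ?divr_ge0 ?addr_ge0 ?invr_ge0// ltW.
  move=> y u My u0 ua fyd1 Gy; set g := nsq (G y) in ua Gy *.
  set t := f y in ua fyd1 *; have fyd := lt_le_trans fyd1 d1d.
  have ag0 : 0 < a * g by rewrite mulr_gt0.
  (* Half of the guaranteed drop [a * g]: this keeps [s'] above [u], hence positive even for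
     [u = 0], where the curve is undefined. Young's inequality absorbs [a / 4 * g] of [t - s'] and
     leaves as much. *)
  pose s' := t - a / 2 * g.
  have s't : s' < t by rewrite /s'; lra.
  have us' : u < s' by rewrite /s'; lra.
  have s'0 : 0 < s' by lra.
  have t0 : 0 < t by lra.
  have gmin : nsq (G (c t)) <= g by apply: cmin => //; rewrite t0.
  have := drop _ _ s'0 s't fyd.
  have := young_sum (G (c t)) (c t - c s') a0.
  have := npsi _ _ s'0 (ltW s't) fyd.
  set D := psi t - psi s'; set v := c t - c s'.
  move=> h1 h2 h3.
  have D0 : 0 <= D by rewrite subr_ge0 psim// ltW.
  have h4 : a / 4 * nsq (G (c t)) <= a / 4 * g.
    by rewrite ler_wpM2l// divr_ge0// ltW.
  have h5 : a^-1 * nsq v <= a^-1 * D ^+ 2 by rewrite ler_wpM2l// invr_ge0 ltW.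
  have h6 : t - s' = a / 2 * g by rewrite /s'; ring.
  have h7 : a / 4 * g <= (a^-1 + L) * D ^+ 2 by rewrite h6 in h3; lra.
  have h8 : g <= 4 / a * (a^-1 + L) * D ^+ 2.
    have -> : 4 / a * (a^-1 + L) * D ^+ 2 = (a / 4)^-1 * ((a^-1 + L) * D ^+ 2).
      by rewrite invf_div mulrA.
    by rewrite ler_pdivlMl// divr_gt0.
  apply: le_trans h8 _; apply: ler_wpM2l.
    by rewrite mulr_ge0 ?divr_ge0 ?addr_ge0 ?invr_ge0// ltW.
  have DPsi : D <= Psi t - Psi u.
    rewrite /Psi t0; case: ifPn => [u0'|_].
      have := psim u s' u0' (ltW us') (lt_trans s't fyd); rewrite /D; lra.
    have := infA s' s'0 (lt_trans s't fyd1); rewrite /D; lra.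
  by rewrite lerXn2r ?nnegrE// (le_trans D0).
Qed.

End KL.

(** * Limits of discrete gradient descent as a neighbourhood retraction *)

Section Descent.
Variables (R : realType) (N : nat).
Implicit Types (x y z : 'rV[R]_N).

Lemma row_nbhsP x (A : set 'rV[R]_N) :
  nbhs x A <-> exists2 e, 0 < e & forall y, (forall i, `|x 0 i - y 0 i| < e) -> A y.
Proof.
split=> [/nbhs_ballP[e /= e0 h]|[e e0 h]].
  by exists e => // y hy; apply: h; split=> // i j; rewrite (ord1 i); exact: hy.
by apply/nbhs_ballP; exists e => //= y [_ hy]; apply: h => i; exact: hy.
Qed.

Lemma row_continuous (S : topologicalType) (g : S -> 'rV[R]_N) (s : S) :
  (forall i, {for s, continuous (fun u : S => g u 0 i)}) -> {for s, continuous g}.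
Proof.
move=> cg B /row_nbhsP[b b0 hb].
have : \forall z \near s, forall i, `|g s 0 i - g z 0 i| < b.
  by apply: filter_forall => i; exact: (cvgr_dist_lt _ _ (cg i)).
by apply: filterS => z hz; exact: hb.
Qed.

Lemma cubeS (M M' : R) x : M <= M' -> cube M x -> cube M' x.
Proof. by move=> MM h i; apply: le_trans (h i) MM. Qed.

(** The retraction sends [y] to the limit of its descent orbit. Telescoping the step bound, the
    orbit moves after step [n] by at most [C * psi (f (iter n T y))]; this gives the limit and,
    since the bound is small near [y] for a fixed [n], its continuity. *)
Lemma polyfun_zeros_nbhd_retract (f : 'rV[R]_N -> R) : polyfun f ->
  (forall x, 0 <= f x) -> (exists M, forall x, f x = 0 -> cube M x) ->
  exists (U : set 'rV[R]_N) (rho : 'rV[R]_N -> 'rV[R]_N),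
  [/\ open U, forall x, f x = 0 -> U x, forall x, U x -> f (rho x) = 0,
      forall x, f x = 0 -> rho x = x & forall x, U x -> {for x, continuous rho}].
Proof.
move=> pf f0 [M1 Z0]; pose M0 := Num.max M1 0.
have M00 : 0 <= M0 by rewrite le_max lexx orbT.
have {Z0}Z0 x : f x = 0 -> cube M0 x.
  by move=> /Z0; apply: cubeS; rewrite le_max lexx.
have [G pG /(_ (M0 + 3))[K K0 HT]] := polyfun_taylor pf.
have pg := polyfun_nsq pG.
have [G2 _ /(_ (M0 + 3))[K' K'0 HG]] := polyfun_taylor pg.
(* The first bound makes the quadratic remainder at most half of the first-order gain. The second
   keeps every coordinate of a step below 1, so that a step from the cube of size [M0 + 2] ends in
   that of size [M0 + 3], where the Taylor estimates hold. *)
pose eta := Num.min (2 * (K + 1))^-1 (K' + 1)^-1.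
have eta0 : 0 < eta by rewrite lt_min !invr_gt0; lra.
have etaK : eta * K <= 1 / 2.
  have : eta * (K + 1) <= 1 / 2.
    have : eta <= (2 * (K + 1))^-1 by rewrite ge_min lexx.
    rewrite invfM => h; apply: le_trans (ler_wpM2r _ h) _; first lra.
    by rewrite -mulrA mulVf ?mulr1; lra.
  by nra.
have etaK' : eta * (K' + 1) <= 1.
  have h : eta <= (K' + 1)^-1 by rewrite ge_min lexx orbT.
  apply: le_trans (ler_wpM2r _ h) _; first lra.
  by rewrite mulVf//; lra.
pose M := M0 + 2.
have cubeM x : cube M x -> cube (M0 + 3) x by apply: cubeS; rewrite /M; lra.
have [d [psi [d0 psim psi0 crit KL]]] := desingularization pf pG K0
  (fun x y Mx My => let: And3 _ _ h := HT x y (cubeM x Mx) (cubeM y My) in h).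
pose T y := y - eta *: G y.
have TE y i : (T y - y) 0 i = - (eta * G y 0 i) by rewrite !mxE; ring.
have nT y : nsq (T y - y) = eta ^+ 2 * nsq (G y).
  by rewrite /nsq mulr_sumr; apply: eq_bigr => i _; rewrite TE; ring.
have GK y i : cube M y -> `|eta * G y 0 i| <= 1.
  move=> /cubeM My; have [h _ _] := HG y y My My.
  rewrite normrM (gtr0_norm eta0); apply: le_trans _ etaK'.
  rewrite ler_pM2l// -ler_sqr ?nnegrE//; last lra.
  rewrite real_normK ?num_real//.
  apply: le_trans (coord_le_nsq (G y) i) _.
  by have := ler_norm (nsq (G y)); nra.
have desc y : cube M y -> f (T y) + eta / 2 * nsq (G y) <= f y.
  move=> My; have MT : cube (M0 + 3) (T y).
    move=> i; have -> : T y 0 i = y 0 i + (T y - y) 0 i by rewrite !mxE; ring.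
    apply: le_trans (ler_normD _ _) _; rewrite TE normrN.
    by have := My i; have := GK y i My; rewrite /M; lra.
  have [_ _] := HT y (T y) (cubeM y My) MT.
  have -> : \sum_i G y 0 i * (T y - y) 0 i = - (eta * nsq (G y)).
    by rewrite /nsq mulr_sumr -sumrN; apply: eq_bigr => i _; rewrite TE; ring.
  rewrite nT ler_norml => /andP[_].
  have : eta * K * (eta * nsq (G y)) <= 1 / 2 * (eta * nsq (G y)).
    by rewrite ler_wpM2r// mulr_ge0// ?nsq_ge0// ltW.
  by lra.
(* [eta / 2] is the decrease rate in [desc], so [u = f (T y)] is admissible in the inequality and
   the step is bounded by the drop of [psi] along it. *)
have [k k0 KL'] := KL (eta / 2) (divr_gt0 eta0 (ltr0Sn _ _)).
pose C := eta * Num.sqrt k.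
have C0 : 0 <= C by rewrite mulr_ge0 ?sqrtr_ge0// ltW.
have fT y : cube M y -> f (T y) <= f y.
  move=> My; apply: le_trans (desc y My); rewrite lerDl mulr_ge0 ?nsq_ge0//.
  by rewrite divr_ge0// ltW.
have step y i : cube M y -> f y < d ->
    `|T y 0 i - y 0 i| <= C * (psi (f y) - psi (f (T y))).
  move=> My fd.
  have D0 : 0 <= psi (f y) - psi (f (T y)) by rewrite subr_ge0 psim// fT.
  have -> : T y 0 i - y 0 i = (T y - y) 0 i by rewrite !mxE.
  rewrite TE normrN.
  have [G0|G0] := eqVneq (nsq (G y)) 0.
    by rewrite (nsq_eq0 G0) mxE mulr0 normr0 mulr_ge0.
  have {}G0 : 0 < nsq (G y) by rewrite lt_neqAle eq_sym G0 nsq_ge0.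
  have h := KL' y _ My (f0 (T y)) (desc y My) fd G0.
  rewrite normrM (gtr0_norm eta0) /C -mulrA ler_pM2l//.
  rewrite -ler_sqr ?nnegrE ?mulr_ge0 ?sqrtr_ge0// exprMn sqr_sqrtr//.
  by rewrite real_normK ?num_real// (le_trans (coord_le_nsq _ i)).
have Tfix y : f y = 0 -> T y = y.
  move=> fy; have My : cube M y by apply: cubeS (Z0 y fy); rewrite /M; lra.
  have : nsq (G y) = 0.
    apply/eqP; rewrite eq_le nsq_ge0 andbT.
    have := desc y My; have := f0 (T y); rewrite fy => h1 h2.
    have : eta / 2 * nsq (G y) <= 0 by lra.
    by rewrite pmulr_rle0// divr_gt0.
  by move=> /nsq_eq0 G0; rewrite /T G0 scaler0 subr0.
have small (e : R) : 0 < e ->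
    exists2 r, 0 < r < d & forall t, 0 <= t -> t <= r -> C * psi t < e.
  move=> e0; have eC : 0 < e / (C + 1) by rewrite divr_gt0//; lra.
  have [r rd hr] := psi0 _ eC; exists r => // t t0 tr.
  have /andP[p0 p1] := hr t t0 tr.
  apply: le_lt_trans (ler_wpM2r p0 (_ : C <= C + 1)) _; first lra.
  by rewrite mulrC -ltr_pdivlMr//; lra.
(* Starting in the cube of size [M0 + 1] with [f < r], each coordinate moves by less than 1 in
   total, so the orbit never leaves the cube of size [M0 + 2]. *)
have [r /andP[r0 rd] hr] := small 1 ltr01.
pose U := [set y : 'rV[R]_N | (forall i, `|y 0 i| < M0 + 1) /\ f y < r].
have psige t : 0 <= t -> t < d -> 0 <= psi t.
  move=> t0 td; have [r' /andP[r'0 r'd] h'] := psi0 _ ltr01.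
  have /andP[p0 _] := h' 0 (lexx _) (ltW r'0).
  exact: le_trans (psim _ _ (lexx 0) t0 td).
have orbit y n : U y -> [/\ cube M (iter n T y), f (iter n T y) <= f y &
    forall i, `|iter n T y 0 i - y 0 i| <= C * (psi (f y) - psi (f (iter n T y)))].
  move=> [yM fyr]; elim: n => [|n [IH1 IH2 IH3]] /=.
    split=> // [i|i]; last by rewrite !subrr normr0 mulr0.
    by apply: le_trans (ltW (yM i)) _; rewrite /M; lra.
  have fnd : f (iter n T y) < d by apply: le_lt_trans IH2 (lt_trans fyr rd).
  have f1 : f (T (iter n T y)) <= f y by apply: le_trans (fT _ IH1) IH2.
  have h i : `|T (iter n T y) 0 i - y 0 i| <=
      C * (psi (f y) - psi (f (T (iter n T y)))).
    have -> : T (iter n T y) 0 i - y 0 i =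
      (T (iter n T y) 0 i - iter n T y 0 i) + (iter n T y 0 i - y 0 i) by ring.
    apply: le_trans (ler_normD _ _) _.
    apply: le_trans (lerD (step _ i IH1 fnd) (IH3 i)) _.
    by rewrite -mulrDr; apply: ler_wpM2l => //; lra.
  split=> // i.
  have := h i; have := hr _ (f0 y) (ltW fyr).
  have := psige _ (f0 (T (iter n T y))) (le_lt_trans f1 (lt_trans fyr rd)).
  move=> /(mulr_ge0 C0); rewrite mulrBr => p1 p2 p3.
  have -> : T (iter n T y) 0 i = (T (iter n T y) 0 i - y 0 i) + y 0 i by ring.
  by apply: le_trans (ler_normD _ _) _; have := yM i; rewrite /M; lra.
have tail y n m i : U y -> `|iter (m + n) T y 0 i - iter n T y 0 i| <=
    C * (psi (f (iter n T y)) - psi (f (iter (m + n) T y))).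
  move=> Uy; elim: m => [|m IH]; first by rewrite !subrr normr0 mulr0.
  have [Q1 Q2 _] := orbit y (m + n)%N Uy.
  have fnd : f (iter (m + n) T y) < d by apply: le_lt_trans Q2 (lt_trans Uy.2 rd).
  rewrite addSn /=.
  have -> : T (iter (m + n) T y) 0 i - iter n T y 0 i =
      (T (iter (m + n) T y) 0 i - iter (m + n) T y 0 i) +
      (iter (m + n) T y 0 i - iter n T y 0 i) by ring.
  apply: le_trans (ler_normD _ _) _.
  apply: le_trans (lerD (step _ i Q1 fnd) IH) _.
  by rewrite -mulrDr; apply: ler_wpM2l => //; lra.
(* If [f] stayed above [e], the orbit would lie in a compact set without critical points; the
   gradient would be bounded below and each step would lower [f] by a fixed amount. *)
have vanish y (e : R) : U y -> 0 < e -> exists n, f (iter n T y) < e.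
  move=> Uy e0; apply: contrapT => /forallNP nf.
  have {}nf n : e <= f (iter n T y) by rewrite leNgt; apply/negP.
  pose S := cube M `&` f @^-1` [set t | e <= t <= f y].
  have cS : compact S.
    apply: compact_closedI; first exact: cube_compact.
    apply: closed_comp => [x _|]; first exact: polyfun_continuous.
    have -> : [set t | e <= t <= f y] = [set t | e <= t] `&` [set t | t <= f y].
      by apply/seteqP; split=> t /= /andP.
    by apply: closedI; [exact: closed_ge|exact: closed_le].
  have Sn n : S (iter n T y).
    by have [Q1 Q2 _] := orbit y n Uy; split=> //=; rewrite nf Q2.
  have [||c] := @compact_EVT_max _ R (fun x => - nsq (G x)) S _ cS.
  - by exists y; exact: (Sn 0%N).
  - by apply: continuous_subspaceT => x; exact: (cvgN (polyfun_continuous pg (x:=x))).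
  rewrite inE => -[Mc /= /andP[fc1 fc2]] hc.
  have gc : 0 < nsq (G c).
    apply: crit => //; first exact: lt_le_trans fc1.
    exact: le_lt_trans fc2 (lt_trans Uy.2 rd).
  have ec0 : 0 < eta / 2 * nsq (G c) by rewrite mulr_gt0// divr_gt0.
  have down n : f (iter n T y) + n%:R * (eta / 2 * nsq (G c)) <= f y.
    elim: n => [|n IH]; first by rewrite mul0r addr0.
    have [Q1 _ _] := orbit y n Uy; have := desc _ Q1.
    have : - nsq (G (iter n T y)) <= - nsq (G c) by apply: hc; rewrite inE.
    rewrite lerN2 => /(ler_wpM2l (ltW (divr_gt0 eta0 (ltr0Sn _ 1)))) h1 h2.
    by rewrite -natr1 mulrDl mul1r /=; lra.
  have := down (Num.Def.archi_bound (f y / (eta / 2 * nsq (G c)))).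
  have := archi_boundP (divr_ge0 (f0 y) (ltW ec0)).
  rewrite ltr_pdivrMr// => h1.
  by have := nf (Num.Def.archi_bound (f y / (eta / 2 * nsq (G c)))); lra.
have psiv y (e : R) : U y -> 0 < e -> exists n, C * psi (f (iter n T y)) < e.
  move=> Uy e0; have [r' /andP[r'0 _] h'] := small _ e0.
  have [n fn] := vanish y r' Uy r'0; exists n; exact: h' (f0 _) (ltW fn).
have lim y : exists z, U y -> forall n i,
    `|z 0 i - iter n T y 0 i| <= C * psi (f (iter n T y)).
  have [Uy|nU] := pselect (U y); last by exists 0.
  have cross n m i : iter n T y 0 i - C * psi (f (iter n T y)) <=
      iter m T y 0 i + C * psi (f (iter m T y)).
    have pn j : 0 <= C * psi (f (iter j T y)).
      rewrite mulr_ge0// psige//; have [_ Q2 _] := orbit y j Uy.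
      by apply: le_lt_trans Q2 (lt_trans Uy.2 rd).
    have [nm|/ltnW mn] := leqP n m.
      have := tail y n (m - n)%N i Uy; rewrite subnK// mulrBr ler_norml => /andP[].
      by have := pn m; lra.
    have := tail y m (n - m)%N i Uy; rewrite subnK// mulrBr ler_norml => /andP[].
    by have := pn m; have := pn n; lra.
  (* The intervals of radius [C * psi (f (iter n T y))] around the iterates meet pairwise by
     [cross]; the supremum of their lower ends lies in all of them. *)
  pose A i := range (fun n => iter n T y 0 i - C * psi (f (iter n T y))).
  exists (\row_i sup (A i)) => _ n i; rewrite mxE ler_norml; apply/andP; split.
    rewrite lerBrDr addrC; apply: ub_le_sup; last by exists n.
    by exists (iter 0 T y 0 i + C * psi (f (iter 0 T y))) => _ [m _ <-]; exact: cross.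
  rewrite lerBlDl; apply: ge_sup; first by exists (iter 0 T y 0 i - C * psi (f (iter 0 T y))); exists 0%N.
  by move=> _ [m _ <-]; exact: cross.
have [rho rhoP] := choice lim.
have Uo : open U.
  have -> : U = [set y : 'rV[R]_N | forall i, `|y 0 i| < M0 + 1] `&` f @^-1` [set t | t < r] by [].
  apply: openI; last first.
    by apply: open_comp => [x _|]; [exact: polyfun_continuous|exact: open_lt].
  rewrite openE => y /= yM; apply/row_nbhsP.
  exists (\big[Num.min/1]_i (M0 + 1 - `|y 0 i|)).
    by apply: lt_bigmin => // i _; rewrite subr_gt0.
  move=> z hz i.
  have mi : \big[Num.min/1]_i (M0 + 1 - `|y 0 i|) <= M0 + 1 - `|y 0 i|.
    exact: bigmin_le_cond.
  have := lt_le_trans (hz i) mi; rewrite distrC => h; have -> : z 0 i = (z 0 i - y 0 i) + y 0 i by ring.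
  by apply: le_lt_trans (ler_normD _ _) _; lra.
have UZ x : f x = 0 -> U x.
  by move=> fx; split=> [i|]; [have := Z0 x fx i; lra|rewrite fx].
have close y (e : R) : U y -> 0 < e -> exists2 n, f (iter n T y) < e &
    forall i, `|rho y 0 i - iter n T y 0 i| < e.
  move=> Uy e0; have [n1 h1] := vanish y e Uy e0; have [n2 h2] := psiv y e Uy e0.
  have [n12|/ltnW n21] := leqP n1 n2.
    exists n2 => [|i]; last exact: le_lt_trans (rhoP y Uy n2 i) h2.
    apply: le_lt_trans _ h1; rewrite -(subnK n12); elim: (n2 - n1)%N => //= m IH.
    by apply: le_trans IH; apply: fT; have [] := orbit y (m + n1)%N Uy.
  exists n1 => // i; apply: le_lt_trans (rhoP y Uy n1 i) _; apply: le_lt_trans _ h2.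
  have := tail y n2 (n1 - n2)%N i Uy; rewrite subnK// => /(le_trans (normr_ge0 _)).
  by rewrite mulrBr subr_ge0.
exists U, rho; split=> //.
- move=> y Uy; apply/eqP/negPn/negP => fr0.
  have {}fr0 : 0 < f (rho y) by rewrite lt_neqAle eq_sym fr0 f0.
  have : nbhs (rho y) [set x | f (rho y) / 2 < f x].
    by apply: (cvgr_gt (f (rho y)) (polyfun_continuous pf (x := rho y))); lra.
  move=> /row_nbhsP[e e0 he].
  have [|n n1 n2] := close y (Num.min e (f (rho y) / 2)) Uy.
    by rewrite lt_min e0 divr_gt0.
  have : f (rho y) / 2 < f (iter n T y).
    by apply: he => i; apply: lt_le_trans (n2 i) _; rewrite ge_min lexx.
  by apply/negP; rewrite -leNgt; apply: ltW; apply: lt_le_trans n1 _; rewrite ge_min lexx orbT.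
- move=> x fx; have Tx n : iter n T x = x by elim: n => //= n ->; exact: Tfix.
  apply/rowP => i; apply/eqP; rewrite -subr_eq0 -normr_eq0 eq_le normr_ge0 andbT.
  rewrite leNgt; apply/negP => h.
  by have [n _ /(_ i)] := close x _ (UZ x fx) h; rewrite Tx ltxx.
- move=> y Uy A /row_nbhsP[e e0 he].
  (* [n] is fixed so that the tail at [y] is below [e / 3]. The condition [f (iter n T z) < r'] is
     open in [z], so the same [n] serves for all [z] near [y]. *)
  have e3 : 0 < e / 3 by rewrite divr_gt0.
  have [r' /andP[r'0 _] h'] := small _ e3.
  have [n fn] := vanish y r' Uy r'0.
  have cT m : continuous (fun x => iter m T x).
    elim: m => [|m IH] x; first by [].
    apply: (continuous_comp (IH x)); move: (iter m T x) => {}x.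
    apply: row_continuous => i; apply: polyfun_continuous.
    apply: polyfun_ext (polyfunD (polyfun_coord R i) (polyfunM (polyfun_cst _ (- eta)) (pG i))) => z.
    by rewrite !mxE mulNr.
  have nearU : \forall z \near y, U z by move: Uo; rewrite openE; exact.
  have nearf : \forall z \near y, f (iter n T z) < r'.
    have cf : {for y, continuous (f \o (fun x => iter n T x))}.
      by apply: continuous_comp; [exact: cT|exact: polyfun_continuous].
    exact: (cvgr_lt _ cf).
  have nearT : \forall z \near y, forall i, `|iter n T y 0 i - iter n T z 0 i| < e / 3.
    by have := cT n y [set z : 'rV[R]_N | forall i, `|iter n T y 0 i - z 0 i| < e / 3]; apply; apply/row_nbhsP; exists (e / 3).
  suff : \forall z \near y, A (rho z) by [].
  near=> z; apply: he => i.
  have Uz : U z by near: z.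
  have fz : f (iter n T z) < r' by near: z.
  have Tz : forall i, `|iter n T y 0 i - iter n T z 0 i| < e / 3 by near: z.
  have h1 := le_lt_trans (rhoP y Uy n i) (h' _ (f0 _) (ltW fn)).
  have h2 := le_lt_trans (rhoP z Uz n i) (h' _ (f0 _) (ltW fz)).
  have h3 := Tz i.
  have -> : rho y 0 i - rho z 0 i = (rho y 0 i - iter n T y 0 i) +
     (iter n T y 0 i - iter n T z 0 i) - (rho z 0 i - iter n T z 0 i) by ring.
  apply: le_lt_trans (ler_normB _ _) _.
  have := ler_normD (rho y 0 i - iter n T y 0 i) (iter n T y 0 i - iter n T z 0 i).
  by lra.
Unshelve. all: by end_near. Qed.

End Descent.

(** * Absolute extensors *)

Lemma compact_inverse_continuous (A B : topologicalType) (K : set A)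
    (phi : A -> B) (psi : B -> A) : hausdorff_space B -> compact K ->
  {within K, continuous phi} -> (forall x, K x -> psi (phi x) = x) ->
  {within phi @` K, continuous psi}.
Proof.
move=> hB cK cphi pK; apply/continuous_closedP => W cW.
apply/closed_subspaceP; exists (phi @` (K `&` W)).
  apply: compact_closed => //; apply: continuous_compact.
    exact: continuous_subspaceW cphi.
  exact: compact_closedI.
apply/seteqP; split=> y /=.
  move=> [[x [Kx Wx] <-] _]; split; last by exists x.
  by have : W (psi (phi x)) by rewrite pK.
move=> [Wy [x Kx xy]]; split; last by exists x.
by exists x => //; split=> //; rewrite -(pK x Kx) xy.
Qed.

Lemma within_comp_continuous (A B C : topologicalType) (D : set A) (E : set B)
    (f : A -> B) (g : B -> C) : {within D, continuous f} ->
  {within E, continuous g} -> (forall x, D x -> E (f x)) ->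
  {within D, continuous (g \o f)}.
Proof.
move=> /subspace_continuousP cf /subspace_continuousP cg DE.
apply/subspace_continuousP => x Dx W /(cg _ (DE x Dx)) /= wW.
have := cf x Dx _ wW; rewrite /= /within /= !nbhs_simpl /=.
by apply: filterS => y h Dy; apply: h => //; exact: DE.
Qed.

Section AbsoluteExtensor.
Variable R : realType.

(** Pseudometric test spaces are normal, so Urysohn and Tietze apply to them; the gluing argument
    takes the space to be [V * R]. *)
Definition absolute_extensor (V : normedModType R) (X : set V) :=
  forall (S : pseudoMetricType R) (C : set S) (g : S -> V), closed C ->
  {within C, continuous g} -> (forall s, C s -> X (g s)) ->
  exists h : S -> V, [/\ continuous h, forall s, X (h s) & forall s, C s -> h s = g s].

Lemma tietze_row N (S : pseudoMetricType R) (C : set S) (g : S -> 'rV[R]_N) (M : R) :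
  closed C -> {within C, continuous g} -> (forall s, C s -> cube M (g s)) ->
  exists2 h : S -> 'rV[R]_N, continuous h & forall s, C s -> h s = g s.
Proof.
move=> cC cg gM.
have ext i : exists h : S -> R, continuous h /\ forall s, C s -> h s = g s 0 i.
  have [|||h [h1 h2 h3]] := @continuous_bounded_extension S R pseudometric_normal
    C cC (fun s => g s 0 i) (Num.max M 0 + 1).
  - by rewrite ltr_pwDr// le_max lexx orbT.
  - exact: (within_comp_continuous cg (E := setT)
      (continuous_subspaceT (@coord_continuous R 1 N 0 i)) (fun _ _ => I)).
  - move=> s Cs; have h : M <= Num.max M 0 + 1.
      by rewrite (@le_trans _ _ (Num.max M 0))// ?le_max ?lexx// lerDl.
    exact: le_trans (gM s Cs i) h.
  by exists h; split=> // s Cs; rewrite h1// inE.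
have [h hP] := choice ext.
exists (fun s => \row_i h i s) => [s|s Cs]; last first.
  by apply/rowP => i; rewrite mxE; have [_ ->] := hP i.
apply: row_continuous => i.
have -> : (fun u => (\row_i h i u) 0 i) = h i by apply/funext => u; rewrite mxE.
by have [+ _] := hP i; apply.
Qed.

(* [X] is a retract of the zero set of [f], which is a retract of a
   neighbourhood; the extension to a neighbourhood is contracted to [x0]. *)
Lemma star_shaped_absolute_extensor (V : normedModType R) (X : set V) (x0 : V) N
    (f : 'rV[R]_N -> R) (p : 'rV[R]_N -> V) (sigma : V -> 'rV[R]_N) :
  X x0 -> bounded_set X ->
  (forall x t, X x -> 0 <= t <= 1 -> X (t *: x + (1 - t) *: x0)) ->
  polyfun f -> (forall z, 0 <= f z) -> (exists M, forall z, f z = 0 -> cube M z) ->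
  continuous p -> {within X, continuous sigma} ->
  (forall x, X x -> f (sigma x) = 0 /\ p (sigma x) = x) ->
  (forall z, f z = 0 -> X (p z)) -> absolute_extensor X.
Proof.
move=> Xx0 bX star pf f0 [M Mf] cp cs sP pX S C g cC cg gX.
have [U [rho [Uo UZ rZ rid crho]]] :=
  polyfun_zeros_nbhd_retract pf f0 (ex_intro _ M Mf).
have [G cG Gg] : exists2 h : S -> 'rV[R]_N, continuous h &
    forall s, C s -> h s = sigma (g s).
  apply: (@tietze_row N S C (sigma \o g) M) => //; last first.
    by move=> s Cs; apply: Mf; have [] := sP (g s) (gX s Cs).
  exact: within_comp_continuous cg cs gX.
pose W := G @^-1` U.
have oW : open W by apply: open_comp => // s _; exact: cG.
have CW : C `<=` W.
  by move=> s Cs; apply: UZ; rewrite Gg//; have [] := sP (g s) (gX s Cs).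
(* [u] fades the partial extension [k], continuous on the open set [W], into the centre [x0]: it is
   1 on [C] and 0 off [W]. *)
have [u [cu u0 u1 u01]] : exists u : S -> R, [/\ continuous u,
    u @` (~` W) `<=` [set 0], u @` C `<=` [set 1] & range u `<=` `[0, 1]].
  apply: urysohn_ext_itv => //; first exact: pseudometric_normal.
    exact: open_closedC.
  by apply/seteqP; split=> s // -[nW /CW].
have u01' s : 0 <= u s <= 1.
  by have := u01 (u s) (imageT u s); rewrite /= in_itv.
pose k s := p (rho (G s)).
have kX s : W s -> X (k s) by move=> Ws; apply: pX; exact: rZ.
pose h s := if pselect (W s) then u s *: k s + (1 - u s) *: x0 else x0.
exists h; split.
- move=> s; have [Ws|nWs] := pselect (W s).
    have ck : {for s, continuous k}.
      apply: continuous_comp; last exact: cp.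
      by apply: continuous_comp; [exact: cG|exact: crho].
    have hE : \forall s' \near s, u s' *: k s' + (1 - u s') *: x0 = h s'.
      have : nbhs s W by exact: open_nbhs_nbhs.
      by apply: filterS => s' Ws'; rewrite /h; case: pselect.
    have hs : h s = u s *: k s + (1 - u s) *: x0 by rewrite /h; case: pselect.
    rewrite /continuous_at hs; apply: (cvg_trans _ (_ : (fun s' => u s' *: k s' + (1 - u s') *: x0) @ s --> _)).
      exact: near_eq_cvg.
    apply: cvgD; first by apply: cvgZ; [exact: cu|exact: ck].
    apply: cvgZl; apply: cvgB; first exact: cvg_cst.
    exact: cu.
  have hs : h s = x0 by rewrite /h; case: pselect.
  have us : u s = 0 by apply: u0; exists s.
  (* At a point outside [W] there is no control on [k], but [u] tends to 0 and [X] is bounded, so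
     [u * (k - x0)] still tends to 0. *)
  have [B B0 hB] : exists2 B, 0 < B & forall x, X x -> `|x - x0| <= B.
    have [B [_ hB]] := bX.
    exists (`|B| + 1 + (`|B| + 1)).
      by have := normr_ge0 B; lra.
    move=> x Xx; apply: le_trans (ler_normB _ _) (lerD _ _);
      by apply: hB => //; rewrite (le_lt_trans (ler_norm B))// ltrDl.
  apply/cvgrPdist_lt => e e0; rewrite hs.
  have : \forall s' \near s, `|u s - u s'| < e / B.
    by apply: (cvgr_dist_lt _ _ (cu s)); rewrite divr_gt0.
  apply: filterS => s'; rewrite us sub0r normrN /h; case: pselect => [Ws'|nW h1] /=; last first.
    by rewrite subrr normr0.
  have /andP[us'0 _] := u01' s'.
  rewrite (ger0_norm us'0) ltr_pdivlMr// => h1.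
  have -> : x0 - (u s' *: k s' + (1 - u s') *: x0) = - (u s' *: (k s' - x0)).
    rewrite scalerBl scale1r scalerBr opprD !opprB addrCA.
    by rewrite [_ *: x0 - x0]addrC addNKr addrC.
  rewrite normrN normrZ ger0_norm//; apply: le_lt_trans h1.
  by rewrite ler_wpM2l// hB//; exact: kX.
- move=> s; rewrite /h; case: pselect => // Ws; apply: star => //; exact: kX.
- move=> s Cs; rewrite /h; case: pselect => [Ws|/(_ (CW s Cs))//].
  have -> : u s = 1 by apply: u1; exists s.
  rewrite scale1r subrr scale0r addr0 /k Gg//.
  by have [fz pz] := sP (g s) (gX s Cs); rewrite rid.
Qed.

End AbsoluteExtensor.

(** * Symmetric operators *)

Lemma mulmx_ext (R : realType) m n (A B : 'M[R]_(m, n)) :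
  (forall x : 'rV[R]_m, x *m A = x *m B) -> A = B.
Proof. by move=> h; apply/row_matrixP => i; rewrite !rowE h. Qed.

Section InnerProduct.
Variables (R : realType) (n : nat) (Q : 'M[R]_n).
Implicit Types (x y z : 'rV[R]_n).

Lemma ipDl x y z : ip Q (x + y) z = ip Q x z + ip Q y z.
Proof. by rewrite /ip !mulmxDl mxE. Qed.
Lemma ipZl a x z : ip Q (a *: x) z = a * ip Q x z.
Proof. by rewrite /ip -!scalemxAl mxE. Qed.
Lemma ip0l z : ip Q 0 z = 0.
Proof. by rewrite /ip !mul0mx mxE. Qed.
Lemma ipNl x z : ip Q (- x) z = - ip Q x z.
Proof. by rewrite -scaleN1r ipZl mulN1r. Qed.
Lemma ipBl x y z : ip Q (x - y) z = ip Q x z - ip Q y z.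
Proof. by rewrite ipDl ipNl. Qed.
Lemma ip_suml (I : Type) (r : seq I) (P : pred I) (F : I -> 'rV[R]_n) z :
  ip Q (\sum_(i <- r | P i) F i) z = \sum_(i <- r | P i) ip Q (F i) z.
Proof.
by elim/big_rec2: _ => [|i a b _ <-]; rewrite ?ip0l ?ipDl.
Qed.

Lemma ip_rows m (A B : 'M[R]_(m, n)) i j : ip Q (row i A) (row j B) = (A *m Q *m B^T) i j.
Proof. by rewrite /ip -row_mul !mxE; apply: eq_bigr => k _; rewrite !mxE. Qed.

Hypothesis hQ : inner_product Q.

Lemma ipC x y : ip Q x y = ip Q y x.
Proof.
rewrite /ip.
have -> : x *m Q *m y^T = (y *m Q *m x^T)^T by rewrite !trmx_mul trmxK hQ.1 mulmxA.
by rewrite mxE.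
Qed.

Lemma ipDr x y z : ip Q z (x + y) = ip Q z x + ip Q z y.
Proof. by rewrite !(ipC z) ipDl. Qed.
Lemma ipZr a x z : ip Q z (a *: x) = a * ip Q z x.
Proof. by rewrite !(ipC z) ipZl. Qed.
Lemma ip0r z : ip Q z 0 = 0.
Proof. by rewrite ipC ip0l. Qed.
Lemma ipNr x z : ip Q z (- x) = - ip Q z x.
Proof. by rewrite !(ipC z) ipNl. Qed.
Lemma ipBr x y z : ip Q z (x - y) = ip Q z x - ip Q z y.
Proof. by rewrite ipDr ipNr. Qed.
Lemma ip_sumr (I : Type) (r : seq I) (P : pred I) (F : I -> 'rV[R]_n) z :
  ip Q z (\sum_(i <- r | P i) F i) = \sum_(i <- r | P i) ip Q z (F i).
Proof. by rewrite ipC ip_suml; apply: eq_bigr => i _; rewrite ipC. Qed.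

Lemma ip_ge0 x : 0 <= ip Q x x.
Proof. by have [->|/hQ.2/ltW//] := eqVneq x 0; rewrite ip0l. Qed.

Lemma ip_eq0 x : ip Q x x = 0 -> x = 0.
Proof. by move=> h; apply/eqP/negPn/negP => /hQ.2; rewrite h ltxx. Qed.

Lemma orthonormal_basis : exists G : 'M[R]_n, G *m Q *m G^T = 1%:M.
Proof.
suff [e he] : exists e : nat -> 'rV[R]_n, forall i j, (i < n)%N -> (j < n)%N ->
    ip Q (e i) (e j) = (i == j)%:R.
  exists (\matrix_(i < n) e i); apply/matrixP => i j.
  by rewrite -ip_rows !rowK he// mxE.
suff H m : (m <= n)%N -> exists e : nat -> 'rV[R]_n,
    forall i j, (i < m)%N -> (j < m)%N -> ip Q (e i) (e j) = (i == j)%:R by exact: H.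
elim: m => [_|m IH mn]; first by exists (fun=> 0).
have [e he] := IH (ltnW mn).
pose E : 'M[R]_(m, n) := \matrix_(i < m) e i.
have /rowV0Pn[x /sub_kermxP xE x0] : kermx (Q *m E^T) != 0.
  rewrite kermx_eq0 /row_free; apply/negP => /eqP rk.
  by have := rank_leq_col (Q *m E^T); rewrite rk leqNgt mn.
have xe i : (i < m)%N -> ip Q x (e i) = 0.
  move=> im; have := congr1 (fun M : 'M[R]_(1, m) => M 0 (Ordinal im)) xE.
  rewrite mulmxA mxE [RHS]mxE => <-; rewrite /ip mxE; apply: eq_bigr => k _.
  by rewrite !mxE.
have xx := hQ.2 x x0.
pose y := (Num.sqrt (ip Q x x))^-1 *: x.
have yy : ip Q y y = 1.
  by rewrite ipZl ipZr mulrA -expr2 exprVn sqr_sqrtr ?ltW// mulVf// gt_eqF.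
have ye i : (i < m)%N -> ip Q y (e i) = 0 by move=> im; rewrite ipZl xe// mulr0.
exists (fun i => if i == m then y else e i) => i j; rewrite !ltnS.
rewrite leq_eqVlt [(j <= m)%N]leq_eqVlt => /predU1P[->|im] /predU1P[->|jm];
  rewrite ?eqxx ?(ltn_eqF im) ?(ltn_eqF jm).
- exact: yy.
- by rewrite ye// gtn_eqF.
- by rewrite ipC ye.
- exact: he.
Qed.

End InnerProduct.

Section RealSpectral.
Variables (R : realType) (n : nat).

Lemma inner_product1 : inner_product (1%:M : 'M[R]_n).
Proof.
split=> [|x x0]; first by rewrite trmx1.
have E : ip 1%:M x x = \sum_i x 0 i ^+ 2.
  by rewrite /ip mulmx1 mxE; apply: eq_bigr => i _; rewrite !mxE expr2.
rewrite E lt_neqAle sumr_ge0 => [|i _]; last by rewrite sqr_ge0.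
rewrite andbT eq_sym psumr_eq0 => [|i _]; last by rewrite sqr_ge0.
apply: contraNN x0 => /allP h; apply/eqP/rowP => i; rewrite mxE.
by have := h i (mem_index_enum _); rewrite /= sqrf_eq0 => /eqP.
Qed.

Let I1 := inner_product1.

(** Eigenvectors are added one at a time: the next one maximises the Rayleigh quotient on the unit
    sphere of the orthogonal complement of those already found. *)
Lemma real_spectral (B : 'M[R]_n) : B^T = B ->
  exists (V : 'M[R]_n) (d : 'rV[R]_n), V *m V^T = 1%:M /\ V *m B = diag_mx d *m V.
Proof.
move=> BT; pose q := ip (1%:M : 'M[R]_n).
have qB x y : q (x *m B) y = q x (y *m B).
  by rewrite /q /ip !mulmx1 trmx_mul BT mulmxA.
have qE x : q x x = \sum_i x 0 i ^+ 2.
  by rewrite /q /ip mulmx1 mxE; apply: eq_bigr => i _; rewrite !mxE expr2.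
suff [e [d [he hd]]] : exists (e : nat -> 'rV[R]_n) (d : nat -> R),
    (forall i j, (i < n)%N -> (j < n)%N -> q (e i) (e j) = (i == j)%:R) /\
    (forall i, (i < n)%N -> e i *m B = d i *: e i).
  exists (\matrix_(i < n) e i), (\row_i d i); split.
    apply/matrixP => i j; rewrite -[X in X *m _]mulmx1.
    by rewrite -ip_rows !rowK -/q he// mxE.
  apply/row_matrixP => i; rewrite row_mul rowK hd//.
  by rewrite mul_diag_mx; apply/rowP => j; rewrite !mxE.
suff H m : (m <= n)%N -> exists (e : nat -> 'rV[R]_n) (d : nat -> R),
    (forall i j, (i < m)%N -> (j < m)%N -> q (e i) (e j) = (i == j)%:R) /\
    (forall i, (i < m)%N -> e i *m B = d i *: e i) by exact: H.
elim: m => [_|m IH mn]; first by exists (fun=> 0), (fun=> 0).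
have [e [d [he hd]]] := IH (ltnW mn).
pose E : 'M[R]_(m, n) := \matrix_(i < m) e i.
have [x xE x0] : exists2 x : 'rV[R]_n, x *m E^T = 0 & x != 0.
  have /rowV0Pn[x /sub_kermxP xE x0] : kermx (E^T) != 0; last by exists x.
  rewrite kermx_eq0 /row_free; apply/negP => /eqP rk.
  by have := rank_leq_col E^T; rewrite rk leqNgt mn.
have Eq y i : y *m E^T = 0 -> (i < m)%N -> q y (e i) = 0.
  move=> yE im; have := congr1 (fun M : 'M[R]_(1, m) => M 0 (Ordinal im)) yE.
  rewrite mxE [RHS]mxE => <-; rewrite /q /ip mulmx1 mxE; apply: eq_bigr => k _.
  by rewrite !mxE.
pose S := [set y : 'rV[R]_n | y *m E^T = 0 /\ q y y = 1].
have qcont (F1 F2 : 'M[R]_n) : continuous (fun y : 'rV[R]_n => q (y *m F1) (y *m F2)).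
  apply: polyfun_continuous.
  have pl (F : 'M[R]_n) i : polyfun (fun y : 'rV[R]_n => (y *m F) 0 i).
    have : polyfun (fun y : 'rV[R]_n => \sum_j y 0 j * F j i).
      by apply: polyfun_sum => j _; apply: polyfunM; [exact: polyfun_coord|exact: polyfun_cst].
    by apply: polyfun_ext => y; rewrite mxE.
  have : polyfun (fun y : 'rV[R]_n => \sum_i (y *m F1) 0 i * (y *m F2) 0 i).
    by apply: polyfun_sum => j _; exact: polyfunM.
  apply: polyfun_ext => y; rewrite /q /ip mulmx1 [RHS]mxE; apply: eq_bigr => i _.
  by congr (_ * _); rewrite [RHS]mxE.
have cS : compact S.
  have -> : S = cube 1 `&` (fun y : 'rV[R]_n => q (y *m 1%:M) (y *m 1%:M)) @^-1` [set 1] `&`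
      \bigcap_(i in [set: 'I_m]) (fun y : 'rV[R]_n => q y (e i)) @^-1` [set 0].
    apply/seteqP; split=> y /=.
      move=> [yE yy]; split=> [|i _ /=]; last exact: Eq.
      split=> [i|]; last by rewrite !mulmx1.
      rewrite -(@ler_pXn2r _ 2)// ?nnegrE// expr1n real_normK ?num_real//.
      by rewrite -yy qE (bigD1 i)//= lerDl sumr_ge0// => j _; rewrite sqr_ge0.
    move=> [[_]]; rewrite !mulmx1 => yy h; split=> //.
    apply/rowP => i; rewrite mxE [RHS]mxE -[RHS](h i I) /q /ip mulmx1 mxE.
    by apply: eq_bigr => k _; rewrite !mxE.
  apply: compact_closedI; first apply: compact_closedI; first exact: cube_compact.
    by apply: closed_comp => [y _|]; [exact: qcont|exact: closed_eq].
  apply: closed_bigI => i _; apply: closed_comp => [y _|]; last exact: closed_eq.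
  have -> : (fun y : 'rV[R]_n => q y (e i)) = (fun y : 'rV[R]_n => \sum_j e i 0 j * y 0 j).
    by apply/funext => z; rewrite /q /ip mulmx1 mxE; apply: eq_bigr => j _; rewrite !mxE mulrC.
  apply: polyfun_continuous; apply: polyfun_sum => j _; apply: polyfunM.
    exact: polyfun_cst.
  exact: polyfun_coord.
have xx : 0 < q x x by exact: I1.2.
have unit_in y : y *m E^T = 0 -> y != 0 -> S ((Num.sqrt (q y y))^-1 *: y).
  move=> yE y0; split; first by rewrite -scalemxAl yE scaler0.
  have yy : 0 < q y y by exact: I1.2.
  by rewrite /q ipZl ipZr// mulrA -expr2 exprVn sqr_sqrtr ?ltW// mulVf// gt_eqF.
have [||v] := @compact_EVT_max _ R (fun y : 'rV[R]_n => q (y *m B) (y *m 1%:M)) S _ cS.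
- by eexists; exact: (unit_in x).
- exact: continuous_subspaceT.
rewrite inE => -[vE vv] vmax.
pose a := q (v *m B) v.
have ray y : y *m E^T = 0 -> q (y *m B) y <= a * q y y.
  move=> yE; have [->|y0] := eqVneq y 0; first by rewrite mul0mx /q !ip0l mulr0.
  have yy : 0 < q y y by exact: I1.2.
  have := vmax _ (mem_set (unit_in y yE y0)); rewrite !mulmx1 -/a.
  rewrite -scalemxAl /q ipZl ipZr// mulrA -expr2 exprVn sqr_sqrtr; last exact: ltW.
  by rewrite ler_pdivrMl// mulrC.
have [w wdef] : exists w, w = v *m B - a *: v by eexists.
have vBw : v *m B = w + a *: v by rewrite wdef subrK.
have wE : w *m E^T = 0.
  apply/rowP => i; rewrite mxE [RHS]mxE.
  have -> : \sum_j w 0 j * E^T j i = q w (e i).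
    by rewrite /q /ip mulmx1 mxE; apply: eq_bigr => k _; rewrite !mxE.
  by rewrite wdef /q ipBl ipZl -/q qB hd// /q ipZr// -/q (Eq v i vE)// !mulr0 subrr.
have w0 : w = 0.
  apply: (ip_eq0 I1); rewrite -/q.
  pose b := a * q w w - q (w *m B) w.
  have b0 : 0 <= b by rewrite subr_ge0 ray.
  (* First-order condition at the maximiser, tested in the direction of the residual
     [w = v B - a v]. For small positive [s] the linear term would win unless [w = 0]. *)
  have key (s : R) : 2 * s * q w w <= s ^+ 2 * b.
    have := ray (v + s *: w); rewrite !mulmxDl -!scalemxAl vE wE scaler0 addr0 => /(_ erefl).
    rewrite /q !(ipDl, ipZl, ipDr I1, ipZr I1) -/q vv -/a.
    have -> : q (w *m B) v = q w w + a * q w v by rewrite qB vBw /q ipDr// ipZr.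
    have -> : q (v *m B) w = q w w + a * q w v.
      by rewrite vBw /q ipDl ipZl (ipC I1 v w).
    have -> : q v w = q w v by rewrite /q (ipC I1).
    rewrite /b; set ww := q w w; set wB := q (w *m B) w; set wv := q w v.
    by move=> h; lra.
  apply/eqP; rewrite eq_le (ip_ge0 I1) andbT leNgt; apply/negP => ww.
  have [bz|bz] := eqVneq b 0; first by have := key 1; rewrite bz; lra.
  have {}bz : 0 < b by rewrite lt_neqAle eq_sym bz b0.
  have := key (q w w / b).
  have -> : (q w w / b) ^+ 2 * b = q w w / b * q w w.
    by have := lt0r_neq0 bz; move=> ?; field.
  by have : 0 < q w w / b * q w w by [rewrite mulr_gt0// divr_gt0]; lra.
have vB : v *m B = a *: v by rewrite vBw w0 add0r.
exists (fun i => if i == m then v else e i), (fun i => if i == m then a else d i).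
split=> [i j|i]; rewrite !ltnS; last first.
  by rewrite leq_eqVlt => /predU1P[->|im]; rewrite ?eqxx ?(ltn_eqF im)//; exact: hd.
rewrite leq_eqVlt [(j <= m)%N]leq_eqVlt => /predU1P[->|im] /predU1P[->|jm];
  rewrite ?eqxx ?(ltn_eqF im) ?(ltn_eqF jm).
- exact: vv.
- by rewrite Eq// gtn_eqF.
- by rewrite /q (ipC I1) -/q Eq.
- exact: he.
Qed.

End RealSpectral.

Section Operators.
Variables (R : realType) (n : nat) (Q : 'M[R]_n).
Hypothesis hQ : inner_product Q.
Implicit Types (x y z : 'rV[R]_n) (A U : 'M[R]_n) (k : {vspace 'rV[R]_n}).

Lemma symmetric_opP A : symmetric_op Q A <-> A *m Q = Q *m A^T.
Proof.
split=> [sA|AQ x y]; last by rewrite /ip trmx_mul !mulmxA -(mulmxA x) AQ mulmxA.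
apply/matrixP => i j.
have := sA (delta_mx 0 i) (delta_mx 0 j).
rewrite /ip trmx_mul -!mulmxA !trmx_delta !mulmxA.
have E (M : 'M[R]_n) : ((delta_mx 0 i : 'rV_n) *m M *m (delta_mx j 0 : 'cV_n)) 0 0 = M i j.
  by rewrite -rowE -colE !mxE.
by rewrite -(mulmxA (delta_mx 0 i) A) E -(mulmxA (delta_mx 0 i) Q) E.
Qed.

Lemma orthonormalK U : U *m Q *m U^T = 1%:M -> Q *m U^T *m U = 1%:M.
Proof. by rewrite -mulmxA => /mulmx1C. Qed.

Lemma orthonormal_expand U x : U *m Q *m U^T = 1%:M ->
  x = \sum_i ip Q x (row i U) *: row i U.
Proof.
move=> hU; rewrite -[LHS]mulmx1 -(orthonormalK hU) !mulmxA mulmx_sum_row.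
by apply: eq_bigr => i _; congr (_ *: _); rewrite /ip !mxE; apply: eq_bigr => k _; rewrite !mxE.
Qed.

Lemma spectral_op A : symmetric_op Q A -> exists U (d : 'I_n -> R),
  U *m Q *m U^T = 1%:M /\ forall i, row i U *m A = d i *: row i U.
Proof.
move=> /symmetric_opP sA; have [G hG] := orthonormal_basis hQ.
pose B := G *m A *m Q *m G^T.
have BT : B^T = B by rewrite /B !trmx_mul trmxK hQ.1 -!mulmxA (mulmxA A) sA -mulmxA.
have [V [d [hV VB]]] := real_spectral BT.
have BG : B *m G = G *m A.
  by rewrite /B -!mulmxA (mulmxA Q) (orthonormalK hG) mulmx1.
exists (V *m G), (fun i => d 0 i); split.
  by rewrite trmx_mul !mulmxA -(mulmxA V) -(mulmxA V) hG mulmx1.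
move=> i; rewrite -row_mul -mulmxA -BG mulmxA VB.
by rewrite -mulmxA mul_diag_mx; apply/rowP => j; rewrite !mxE.
Qed.

Lemma ip_row_basis U i j : U *m Q *m U^T = 1%:M -> ip Q (row i U) (row j U) = (i == j)%:R.
Proof. by move=> hU; rewrite ip_rows hU mxE. Qed.

Lemma eigen_orth A a b x y : symmetric_op Q A -> x *m A = a *: x -> y *m A = b *: y ->
  a != b -> ip Q x y = 0.
Proof.
move=> sA xa yb ab; have := sA x y; rewrite xa yb ipZl ipZr// => /eqP.
by rewrite -subr_eq0 -mulrBl mulf_eq0 subr_eq0 (negbTE ab) => /eqP.
Qed.

Lemma inF_orth A a c x z : symmetric_op Q A -> inF A a x -> z *m A = c *: z ->
  a < c -> ip Q x z = 0.
Proof.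
move=> sA [s [hs ->]] zc ac; rewrite ip_suml big_seq big1// => p ps.
have [pa [_ pe]] := hs p ps; rewrite ipZl (eigen_orth sA pe zc) ?mulr0//.
by rewrite lt_eqF// (le_lt_trans pa).
Qed.

(** With [inF_orth] this describes [F_a] as the orthogonal complement of the eigenvectors with
    eigenvalue above [a], so that membership becomes a family of equations. *)
Lemma inF_intro A a x : symmetric_op Q A ->
  (forall z c, z *m A = c *: z -> a < c -> ip Q x z = 0) -> inF A a x.
Proof.
move=> sA h; have [U [d [hU ed]]] := spectral_op sA.
exists [seq (ip Q x (row i U), d i, row i U) | i <- enum 'I_n & d i <= a]; split.
  move=> p /mapP[i]; rewrite mem_filter => /andP[ia _] -> /=; split=> //; split=> //.
  apply/eqP => u0; have := ip_row_basis i i hU; rewrite u0 ip0l eqxx => /eqP.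
  by rewrite eq_sym oner_eq0.
rewrite big_map big_filter /= big_enum_cond /= {1}(orthonormal_expand x hU).
rewrite (bigID (fun i => d i <= a)) /= [X in _ + X]big1 ?addr0// => i.
by rewrite -ltNge => ia; rewrite (h _ (d i))// scale0r.
Qed.

Lemma inF_eigen A a x : symmetric_op Q A -> x *m A = a *: x -> inF A a x.
Proof.
move=> sA xa; apply: inF_intro => // z c zc ac; apply: (eigen_orth sA xa zc).
by rewrite lt_eqF.
Qed.

Lemma nonneg_spectrumP A : symmetric_op Q A ->
  (nonneg_spectrum A <-> forall x, 0 <= ip Q (x *m A) x).
Proof.
move=> sA; split=> [h x|h lam x [x0 xl]]; last first.
  by have := h x; rewrite xl ipZl pmulr_lge0// hQ.2.
have [U [d [hU ed]]] := spectral_op sA.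
rewrite (orthonormal_expand x hU) mulmx_suml ip_suml; apply: sumr_ge0 => i _.
rewrite -scalemxAl ed ip_sumr// (bigD1 i)//= big1 => [|j ji]; last first.
  by rewrite !(ipZl, ipZr hQ) ip_row_basis// eq_sym (negbTE ji) !mulr0.
rewrite !(ipZl, ipZr hQ) ip_row_basis// eqxx mulr1 addr0 mulrCA.
rewrite mulr_ge0// -?expr2 ?sqr_ge0//; apply: (h _ (row i U)); split=> //.
apply/eqP => u0; have := ip_row_basis i i hU; rewrite u0 ip0l eqxx => /eqP.
by rewrite eq_sym oner_eq0.
Qed.

Lemma psd_kernel A x : symmetric_op Q A -> (forall x, 0 <= ip Q (x *m A) x) ->
  ip Q (x *m A) x = 0 -> x *m A = 0.
Proof.
move=> sA pA x0; set y := x *m A; apply: (ip_eq0 hQ).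
have key (s : R) : 0 <= 2 * s * ip Q y y + s ^+ 2 * ip Q (y *m A) y.
  have := pA (x + s *: y); rewrite mulmxDl -scalemxAl -/y.
  rewrite !(ipDl, ipZl, ipDr hQ, ipZr hQ) x0.
  have -> : ip Q (y *m A) x = ip Q y y by rewrite sA.
  by set a := ip Q y y; set b := ip Q (y *m A) y; lra.
set a := ip Q y y in key *; set b := ip Q (y *m A) y in key *.
have b0 : 0 <= b by exact: pA.
apply/eqP; rewrite eq_le ip_ge0// andbT leNgt -/a; apply/negP => a0.
(* The quadratic in [s] is smallest at [- a / b]; the added 1 avoids dividing by zero and still
   makes it negative. *)
have := key (- (a / (b + 1))).
have -> : 2 * - (a / (b + 1)) * a + (- (a / (b + 1))) ^+ 2 * b =
    - (a ^+ 2 * ((b + 1)^-1 ^+ 2 * (b + 2))).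
  by have : b + 1 != 0 by [lra]; move=> ?; field.
rewrite oppr_ge0 leNgt => /negP; apply.
rewrite !mulr_gt0 ?exprn_gt0 ?invr_gt0//; lra.
Qed.

Definition proj_onto (k : {vspace 'rV[R]_n}) (P : 'M[R]_n) :=
  forall x, x *m P \in k /\ forall y, y \in k -> ip Q (x - x *m P) y = 0.

Lemma proj_onto_uniq k P P' : proj_onto k P -> proj_onto k P' -> P = P'.
Proof.
move=> hP hP'; apply: mulmx_ext => x; apply/eqP; rewrite -subr_eq0; apply/eqP.
apply: (ip_eq0 hQ).
have kd : x *m P - x *m P' \in k by rewrite rpredB//; [case: (hP x)|case: (hP' x)].
have [_ /(_ _ kd) h1] := hP x; have [_ /(_ _ kd) h2] := hP' x.
have E : x *m P - x *m P' = (x - x *m P') - (x - x *m P).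
  by rewrite opprB [RHS]addrC addrA subrK.
by rewrite {1}E ipBl h1 h2 subrr.
Qed.

Lemma proj_onto_ex k : exists2 P, proj_onto k P & \tr P = (\dim k)%:R.
Proof.
pose E : 'M[R]_(\dim k, n) := \matrix_i (vbasis k)`_i.
have kE y : y \in k -> exists c : 'rV_(\dim k), y = c *m E.
  move=> /coord_vbasis ->; exists (\row_i coord (vbasis k) i y).
  by rewrite mulmx_sum_row; apply: eq_bigr => i _; rewrite rowK mxE.
have Ek (c : 'rV_(\dim k)) : c *m E \in k.
  rewrite mulmx_sum_row; apply: rpred_sum => i _; apply: rpredZ; rewrite rowK.
  by apply: vbasis_mem; rewrite mem_nth// size_tuple.
have Efree (c : 'rV_(\dim k)) : c *m E = 0 -> c = 0.
  rewrite mulmx_sum_row => h; apply/rowP => i; rewrite mxE.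
  have /freeP := basis_free (vbasisP k); apply.
  by rewrite -[RHS]h; apply: eq_bigr => j _; rewrite rowK.
pose W := E *m Q *m E^T.
have Wu : W \in unitmx.
  rewrite -row_free_unit -kermx_eq0; apply/rowV0P => c /sub_kermxP cW.
  apply: Efree; apply: (ip_eq0 hQ).
  by rewrite /ip trmx_mul !mulmxA -(mulmxA c) -(mulmxA c) -/W cW mul0mx mxE.
exists (Q *m E^T *m invmx W *m E).
  move=> x; split; first by rewrite !mulmxA; exact: Ek.
  move=> y /kE[c ->]; rewrite /ip trmx_mul.
  set v := x - _; have v0 : v *m Q *m E^T = 0.
    rewrite /v !mulmxBl -!mulmxA (mulmxA E Q) -/W mulVmx// mulmx1.
    by rewrite subrr.
  by rewrite mulmxA v0 mul0mx mxE.
by rewrite mxtrace_mulC mulmxA -/W mulmxA mulmxV// mxtrace1.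
Qed.

Lemma oprojP k : proj_onto k (oproj Q k).
Proof.
by have [P hP _] := proj_onto_ex k; apply: (@xgetPex _ 0 (proj_onto k)); exists P.
Qed.

Lemma oproj_trace k : \tr (oproj Q k) = (\dim k)%:R.
Proof.
by have [P hP <-] := proj_onto_ex k; rewrite (proj_onto_uniq hP (oprojP k)).
Qed.

Lemma oproj_mem k x : x *m oproj Q k \in k.
Proof. by case: (oprojP k x). Qed.

Lemma oproj_orth k x y : y \in k -> ip Q (x - x *m oproj Q k) y = 0.
Proof. by case: (oprojP k x) => _; apply. Qed.

Lemma oproj_id k x : x \in k -> x *m oproj Q k = x.
Proof.
move=> xk; apply/eqP; rewrite eq_sym -subr_eq0; apply/eqP; apply: (ip_eq0 hQ).
by apply: oproj_orth; rewrite rpredB// oproj_mem.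
Qed.

Lemma oproj_perp k x : (forall y, y \in k -> ip Q x y = 0) -> x *m oproj Q k = 0.
Proof.
move=> h; apply: (ip_eq0 hQ); have xk := oproj_mem k x.
have := oproj_orth x xk; rewrite ipBl (h _ xk) sub0r => /eqP.
by rewrite oppr_eq0 => /eqP.
Qed.

Lemma oproj_sym k : symmetric_op Q (oproj Q k).
Proof.
move=> x y; set P := oproj Q k.
have h1 := oproj_orth x (oproj_mem k y); have h2 := oproj_orth y (oproj_mem k x).
rewrite -/P ipBl in h1; rewrite -/P ipBl in h2.
move/eqP: h1; rewrite subr_eq0 => /eqP ->.
by move/eqP: h2; rewrite subr_eq0 ipC// => /eqP ->; rewrite ipC.
Qed.

Lemma oproj_commute k (B : 'M[R]_n) : (forall x, x \in k -> x *m B \in k) ->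
  (forall x, (forall y, y \in k -> ip Q x y = 0) ->
     forall y, y \in k -> ip Q (x *m B) y = 0) ->
  B *m oproj Q k = oproj Q k *m B.
Proof.
move=> h1 h2; apply: mulmx_ext => x; set P := oproj Q k.
rewrite !mulmxA -{1}[x](subrK (x *m P)) mulmxDl mulmxDl.
rewrite [X in X + _]oproj_perp ?add0r; last first.
  by apply: h2 => y yk; exact: oproj_orth.
by rewrite oproj_id// h1// oproj_mem.
Qed.

Definition coproj (k : {vspace 'rV[R]_n}) : 'M[R]_n := 1%:M - oproj Q k.

Lemma mul_coproj k x : x *m coproj k = x - x *m oproj Q k.
Proof. by rewrite mulmxBr mulmx1. Qed.

Lemma coproj_sym k : symmetric_op Q (coproj k).
Proof.
by move=> x y; rewrite !mul_coproj ipBl ipBr// oproj_sym.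
Qed.

Lemma coproj_psd k x : 0 <= ip Q (x *m coproj k) x.
Proof.
rewrite mul_coproj; set P := oproj Q k.
have -> : ip Q (x - x *m P) x = ip Q (x - x *m P) (x - x *m P).
  by rewrite [RHS]ipBr// (oproj_orth x (oproj_mem k x)) subr0.
exact: ip_ge0.
Qed.

Lemma coproj_kill k x : x \in k -> x *m coproj k = 0.
Proof. by move=> xk; rewrite mul_coproj oproj_id// subrr. Qed.

Lemma coproj_trace k : \tr (coproj k) = (n - \dim k)%:R.
Proof.
rewrite linearB /= mxtrace1 oproj_trace natrB//.
by have := dimvS (subvf k); rewrite dimvf /dim /= mul1n.
Qed.

Lemma chibarE k : chibar Q k = (n - \dim k)%:R^-1 *: coproj k.
Proof. by []. Qed.

Lemma codim_gt0 (k : {vspace 'rV[R]_n}) : k != fullv -> (0 < n - \dim k)%N.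
Proof.
move=> kf; rewrite subn_gt0.
have dE : \dim {: 'rV[R]_n} = n by rewrite dimvf /dim /= mul1n.
rewrite -[X in (_ < X)%N]dE ltn_neqAle dimvS ?subvf// andbT.
by apply: contraNN kf => /eqP h; rewrite eqEdim subvf h leqnn.
Qed.

End Operators.

(** * Filtering operators *)

Section FilteringOperators.
Variables (R : realType) (n : nat).
Variables (br : 'rV[R]_n -> 'rV[R]_n -> 'rV[R]_n) (Q : 'M[R]_n).
Hypothesis hL : compact_lie_algebra br Q.
Implicit Types (x y z : 'rV[R]_n) (A U : 'M[R]_n) (k l : {vspace 'rV[R]_n}).

Let hQ : inner_product Q := hL.1.

Lemma brDl x y z : br (x + y) z = br x z + br y z.
Proof. by have := hL.2.1 1 x y z; rewrite !scale1r. Qed.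
Lemma br0l z : br 0 z = 0.
Proof. by have := hL.2.1 (-1) 0 0 z; rewrite scaler0 addr0 scaleN1r addNr. Qed.
Lemma brZl a x z : br (a *: x) z = a *: br x z.
Proof. by have := hL.2.1 a x 0 z; rewrite addr0 br0l addr0. Qed.
Lemma br_anti x y : br x y = - br y x.
Proof. exact: hL.2.2.1. Qed.
Lemma brDr x y z : br z (x + y) = br z x + br z y.
Proof. by rewrite br_anti brDl opprD -!br_anti. Qed.
Lemma brZr a x z : br z (a *: x) = a *: br z x.
Proof. by rewrite br_anti brZl -scalerN -br_anti. Qed.
Lemma br0r z : br z 0 = 0.
Proof. by rewrite br_anti br0l oppr0. Qed.
Lemma br_suml (I : Type) (r : seq I) (P : pred I) (F : I -> 'rV[R]_n) z :
  br (\sum_(i <- r | P i) F i) z = \sum_(i <- r | P i) br (F i) z.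
Proof. by elim/big_rec2: _ => [|i a b _ <-]; rewrite ?br0l ?brDl. Qed.
Lemma br_sumr (I : Type) (r : seq I) (P : pred I) (F : I -> 'rV[R]_n) z :
  br z (\sum_(i <- r | P i) F i) = \sum_(i <- r | P i) br z (F i).
Proof. by elim/big_rec2: _ => [|i a b _ <-]; rewrite ?br0r ?brDr. Qed.

Lemma ip_ad x y z : ip Q (br x y) z = - ip Q y (br x z).
Proof. by rewrite br_anti ipNl hL.2.2.2.2. Qed.

(** Filtering as the vanishing of [Q([x,y],z)] on triples of eigenvectors, by the description of
    [F_a] through orthogonality. *)
Lemma filteringP A : symmetric_op Q A ->
  (filtering br A <-> forall a b c x y z, x *m A = a *: x -> y *m A = b *: y ->
     z *m A = c *: z -> a + b < c -> ip Q (br x y) z = 0).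
Proof.
move=> sA; split=> [fA a b c x y z xa yb zc abc|h a b x y].
  by apply: (inF_orth hQ sA _ zc abc); apply: fA; exact: (inF_eigen hQ sA).
move=> [s [hs ->]] [t [ht ->]]; apply: (inF_intro hQ sA) => z c zc abc.
rewrite br_suml ip_suml big_seq big1// => p ps.
rewrite br_sumr ip_suml big_seq big1// => q qt.
have [pa [_ pe]] := hs p ps; have [qa [_ qe]] := ht q qt.
rewrite brZl brZr !ipZl (h _ _ _ _ _ _ pe qe zc) ?mulr0//.
by apply: le_lt_trans abc; exact: lerD.
Qed.

(** As [x] lies in [F_0], bracketing with [x] does not raise eigenvalues; being skew for [Q], it
    does not lower them either. So it preserves every eigenspace. *)
Lemma filtering_kernel_commute A x : symmetric_op Q A -> filtering br A ->
  x *m A = 0 -> forall y, br x (y *m A) = br x y *m A.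
Proof.
move=> sA /(filteringP sA) fA xA.
have [U [d [hU ed]]] := spectral_op hQ sA.
have xA0 : x *m A = 0 *: x by rewrite scale0r.
have basis i : br x (row i U *m A) = br x (row i U) *m A.
  rewrite ed brZr (orthonormal_expand (br x (row i U)) hU).
  rewrite scaler_sumr mulmx_suml; apply: eq_bigr => j _.
  rewrite -scalemxAl ed !scalerA mulrC.
  case: (ltgtP (d i) (d j)) => [ij|ji|->//].
    by rewrite (fA _ _ _ _ _ _ xA0 (ed i) (ed j)) ?add0r// !mul0r.
  by rewrite ip_ad (ipC hQ) (fA _ _ _ _ _ _ xA0 (ed j) (ed i)) ?add0r// oppr0 !mul0r.
move=> y; rewrite (orthonormal_expand y hU) mulmx_suml !br_sumr mulmx_suml.
by apply: eq_bigr => i _; rewrite -scalemxAl !brZr -scalemxAl basis.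
Qed.

Variable cA : set 'M[R]_n.

(** The cone over [X[k]]. Without the trace normalisation its elements can be rescaled and built up
    by adding multiples of [coproj]; commutation with [ad(X)] for [X] in [k] returns through
    [filtering_kernel_commute]. *)
Definition filtering_cone k : set 'M[R]_n :=
  [set A | [/\ symmetric_op Q A, filtering br A, (forall x, 0 <= ip Q (x *m A) x),
    (forall a, cA a -> a *m A = A *m a) & (forall x, x \in k -> x *m A = 0)]].

Lemma XkE k A : Xk br Q cA k A <-> filtering_cone k A /\ \tr A = 1.
Proof.
split.
  move=> [[sA /(nonneg_spectrumP hQ sA) pA [tA cAA] kA _] [_ fA _ _]].
  by split.
move=> [[sA fA pA cAA kA] tA].
have nA : nonneg_spectrum A by apply/(nonneg_spectrumP hQ sA).
split; split=> // x y xk; apply: filtering_kernel_commute => //; exact: kA.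
Qed.

Lemma filtering_cone_le k l A : (k <= l)%VS -> filtering_cone l A -> filtering_cone k A.
Proof. by move=> /subvP kl [sA fA pA cAA lA]; split=> // x /kl; exact: lA. Qed.

Lemma filtering_cone0 k : filtering_cone k 0.
Proof.
have s0 : symmetric_op Q 0 by move=> x y; rewrite !mulmx0 ip0l ip0r.
split=> //; try by move=> *; rewrite ?mulmx0 ?mul0mx ?ip0l.
apply/(filteringP s0) => a b c x y z; rewrite !mulmx0 => /esym/eqP.
rewrite scaler_eq0 => /orP[/eqP->|/eqP->]; last by rewrite br0l ip0l.
move=> /esym/eqP; rewrite scaler_eq0 => /orP[/eqP->|/eqP->]; last by rewrite br0r ip0l.
move=> /esym/eqP; rewrite scaler_eq0 => /orP[/eqP->|/eqP->]; last by rewrite ip0r.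
by rewrite addr0 ltxx.
Qed.

Lemma filtering_coneZ k A t : 0 <= t -> filtering_cone k A -> filtering_cone k (t *: A).
Proof.
rewrite le_eqVlt => /predU1P[<-|t0]; first by rewrite scale0r => _; exact: filtering_cone0.
move=> [sA /(filteringP sA) fA pA cAA kA].
have sB : symmetric_op Q (t *: A) by move=> x y; rewrite -!scalemxAr ipZl ipZr// sA.
have eig x a : x *m (t *: A) = a *: x -> x *m A = (t^-1 * a) *: x.
  by rewrite -scalemxAr -scalerA => <-; rewrite scalerA mulVf ?scale1r// gt_eqF.
split=> //.
- apply/(filteringP sB) => a b c x y z /eig xa /eig yb /eig zc abc.
  apply: (fA _ _ _ _ _ _ xa yb zc).
  by rewrite -mulrDr ltr_pM2l// invr_gt0.
- by move=> x; rewrite -scalemxAr ipZl mulr_ge0// ltW.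
- by move=> a ca; rewrite -scalemxAr -scalemxAl cAA.
- by move=> x xk; rewrite -scalemxAr kA// scaler0.
Qed.

Variable h : {vspace 'rV[R]_n}.
Hypothesis hA : compact_aut_group br Q h cA.

Lemma coproj_commute k a : A_invariant cA k -> cA a ->
  a *m coproj Q k = coproj Q k *m a.
Proof.
move=> ik ca; rewrite mulmxBl mulmxBr mulmx1 mul1mx; congr (_ - _).
have [_ _ inv aut _] := hA.
apply: (oproj_commute hQ) => [x xk|x xp y yk]; first exact: ik.
have [[au _] [_ iso]] := aut a ca.
have ya : y = (y *m invmx a) *m a by rewrite mulmxKV.
by rewrite ya iso; apply: xp; apply: ik => //; exact: inv.
Qed.

(* An eigenvector of [A + c (1 - 1_k)] splits into a component in [k], which is
   nonzero only for the eigenvalue 0, and an eigenvector of [A] whose eigenvalue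
   is smaller by [c]. *)
Lemma filtering_coneD k A c : subalgebra br k -> A_invariant cA k -> 0 <= c ->
  filtering_cone k A -> filtering_cone k (A + c *: coproj Q k).
Proof.
move=> sk ik c0 [sA fA pA cAA kA]; set B := A + _.
have comm := filtering_kernel_commute sA fA.
have {}fA := (filteringP sA).1 fA.
have sB : symmetric_op Q B.
  move=> x y; rewrite !mulmxDr -!scalemxAr ipDl ipDr// ipZl ipZr// sA.
  by rewrite (coproj_sym hQ).
have pB x : 0 <= ip Q (x *m B) x.
  rewrite mulmxDr -scalemxAr ipDl ipZl addr_ge0// mulr_ge0//.
  exact: (coproj_psd hQ).
split=> //; last first.
- by move=> x xk; rewrite mulmxDr -scalemxAr kA// (coproj_kill hQ)// scaler0 addr0.
- by move=> a ca; rewrite mulmxDr mulmxDl -scalemxAr -scalemxAl cAA// coproj_commute.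
pose P := oproj Q k.
have PA x : x *m P *m A = 0 by apply: kA; exact: (oproj_mem hQ).
have AP x : x *m A *m P = 0.
  apply: (ip_eq0 hQ); rewrite (oproj_sym hQ) sA -mulmxA.
  by rewrite (mulmxA (x *m A *m P)) PA ip0r.
have split_eig x a : x *m B = a *: x -> exists x1 x2, [/\ x = x1 + x2, x1 \in k,
    a *: x1 = 0, (forall u, u \in k -> ip Q x2 u = 0) & x2 *m A = (a - c) *: x2].
  move=> xB; exists (x *m P), (x - x *m P).
  have Pk : x *m P \in k by exact: (oproj_mem hQ).
  have aP : a *: (x *m P) = 0.
    rewrite scalemxAl -xB mulmxDr mulmxDl AP add0r -scalemxAr -scalemxAl.
    by rewrite mul_coproj mulmxBl (oproj_id hQ (x := x *m P))// subrr scaler0.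
  split=> //; first by rewrite addrC subrK.
    by move=> u uk; exact: (oproj_orth hQ).
  rewrite mulmxBl PA subr0; move: xB; rewrite mulmxDr -scalemxAr mul_coproj => /eqP.
  by rewrite eq_sym -subr_eq => /eqP <-; rewrite scalerBl [a *: (x - _)]scalerBr aP subr0.
apply/(filteringP sB) => a b g x y z xa yb zg abg.
have [->|x0] := eqVneq x 0; first by rewrite br0l ip0l.
have [->|y0] := eqVneq y 0; first by rewrite br0r ip0l.
(* Nonnegative [a] and [b] make [g] positive and larger than each of them; in particular [z] has no
   component in [k]. *)
have a0 : 0 <= a by have := pB x; rewrite xa ipZl pmulr_lge0// hQ.2.
have b0 : 0 <= b by have := pB y; rewrite yb ipZl pmulr_lge0// hQ.2.
have g0 : 0 < g by apply: le_lt_trans abg; rewrite addr_ge0.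
have [x1 [x2 [-> x1k _ x2k x2A]]] := split_eig x a xa.
have [y1 [y2 [-> y1k _ y2k y2A]]] := split_eig y b yb.
have [z1 [z2 [-> _ /eqP + z2k z2A]]] := split_eig z g zg.
rewrite scaler_eq0 gt_eqF//= => /eqP ->; rewrite add0r.
(* Four brackets are treated. Within [k] the bracket stays in [k], orthogonal to [z2]. A mixed one
   is an eigenvector of [A] for [a - c] or [b - c], both below [g - c]. The last uses filtering of
   [A], as [(a - c) + (b - c) < g - c]. *)
have T1 : ip Q (br x1 y1) z2 = 0 by rewrite ipC// z2k// sk.
have T2 u v s : u \in k -> v *m A = (s - c) *: v -> s < g -> ip Q (br u v) z2 = 0.
  move=> uk vA sg; apply: (eigen_orth hQ sA _ z2A (a := s - c)).
    by rewrite -(comm u (kA u uk)) vA brZr.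
  by rewrite lt_eqF// ltrD2r.
rewrite brDl !brDr !ipDl T1 (T2 x1 y2 b)//; last by lra.
rewrite (br_anti x2 y1) ipNl (T2 y1 x2 a)//; last by lra.
by rewrite (fA _ _ _ _ _ _ x2A y2A z2A) ?oppr0 ?addr0//; lra.
Qed.

(** The kernel of [A] is a subalgebra: for [x] in it [A] commutes with [ad(x)], so [A] kills [[x,y]]
    once it kills [y]. *)
Lemma filtering_cone_join k l m A : is_join_subalgebra br k l m ->
  filtering_cone k A -> filtering_cone l A -> filtering_cone m A.
Proof.
move=> [_ _ _ minm] [sA fA pA cAA kA] [_ _ _ _ lA]; split=> //.
pose K := lker (linfun (mulmxr A : 'rV[R]_n -> 'rV[R]_n)).
have KE x : (x \in K) = (x *m A == 0) by rewrite memv_ker lfunE.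
have /subvP mK : (m <= K)%VS.
  apply: minm.
  - move=> x y; rewrite !KE => /eqP xA /eqP yA.
    by rewrite -(filtering_kernel_commute sA fA xA) yA br0r.
  - by apply/subvP => x xk; rewrite KE kA.
  - by apply/subvP => x xl; rewrite KE lA.
by move=> x /mK; rewrite KE => /eqP.
Qed.

Lemma Xk_chibar k : subalgebra br k -> A_invariant cA k -> k != fullv ->
  Xk br Q cA k (chibar Q k).
Proof.
move=> sk ik kf; have cd := codim_gt0 kf; apply/XkE; split.
  rewrite chibarE; apply: filtering_coneZ; first by rewrite invr_ge0.
  have := filtering_coneD sk ik ler01 (filtering_cone0 k).
  by rewrite scale1r add0r.
by rewrite chibarE linearZ /= coproj_trace// mulVf// pnatr_eq0 -lt0n.
Qed.

(** A point of the segment is a rescaled [A] plus a nonnegative multiple of [coproj Q k], which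
    [filtering_coneD] allows. *)
Lemma Xk_star k A t : subalgebra br k -> A_invariant cA k -> k != fullv ->
  Xk br Q cA k A -> 0 <= t <= 1 -> Xk br Q cA k (t *: A + (1 - t) *: chibar Q k).
Proof.
move=> sk ik kf /XkE[CA tA] /andP[t0 t1]; have cd := codim_gt0 kf; apply/XkE; split.
  rewrite chibarE scalerA; apply: filtering_coneD => //; last exact: filtering_coneZ.
  by rewrite mulr_ge0 ?subr_ge0// invr_ge0.
have /XkE[_ tc] := Xk_chibar sk ik kf.
by rewrite linearD linearZ [X in _ + X]linearZ /= tA tc !mulr1 addrC subrK.
Qed.

End FilteringOperators.

(** * The pieces as images of real algebraic sets *)

Section TensorCube.
Variables (R : realType) (n : nat).
Local Notation W := (n * (n * n))%N.
Local Notation unindex := mxtens.mxtens_unindex.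
Implicit Types (x y z : 'rV[R]_n) (M U : 'M[R]_n).

Definition tens_i (k : 'I_W) : 'I_n := (unindex k).1.
Definition tens_j (k : 'I_W) : 'I_n := (unindex (unindex k).2).1.
Definition tens_l (k : 'I_W) : 'I_n := (unindex (unindex k).2).2.

Definition tens3 x y z : 'rV[R]_W := \row_k (x 0 (tens_i k) * (y 0 (tens_j k) * z 0 (tens_l k))).
Definition tensmx3 (A B C : 'M[R]_n) : 'M[R]_W := mxtens.tensmx A (mxtens.tensmx B C).

Lemma tensmx3E A B C i j : tensmx3 A B C i j =
  A (tens_i i) (tens_i j) * (B (tens_j i) (tens_j j) * C (tens_l i) (tens_l j)).
Proof. by rewrite !mxE. Qed.

Lemma sum_tens (F G H : 'I_n -> R) :
  \sum_k F (tens_i k) * (G (tens_j k) * H (tens_l k)) =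
  (\sum_i F i) * ((\sum_j G j) * (\sum_l H l)).
Proof. by rewrite (mxtens.mulr_sum G H) mxtens.mulr_sum. Qed.

Lemma mul_tens3 x y z A B C :
  tens3 x y z *m tensmx3 A B C = tens3 (x *m A) (y *m B) (z *m C).
Proof.
apply/rowP => k; rewrite !mxE -sum_tens; apply: eq_bigr => i _.
by rewrite !mxE; ring.
Qed.

Lemma tensmx3_mul A B C A' B' C' :
  tensmx3 A B C *m tensmx3 A' B' C' = tensmx3 (A *m A') (B *m B') (C *m C').
Proof. by rewrite /tensmx3 !mxtens.tensmx_mul. Qed.

Lemma tensmx3_tr A B C : (tensmx3 A B C)^T = tensmx3 A^T B^T C^T.
Proof. by rewrite /tensmx3 !mxtens.trmx_tens. Qed.

Lemma tens_eq (k k' : 'I_W) :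
  (k == k') = [&& tens_i k == tens_i k', tens_j k == tens_j k' & tens_l k == tens_l k'].
Proof.
apply/eqP/and3P => [->|[/eqP h1 /eqP h2 /eqP h3]]; first by rewrite !eqxx.
apply: (can_inj (@mxtens.mxtens_unindexK n (n * n)%N)).
have : (unindex k).2 = (unindex k').2.
  apply: (can_inj (@mxtens.mxtens_unindexK n n)).
  by move: h2 h3; rewrite /tens_j /tens_l; case: (unindex _) => a b;
    case: (unindex _) => a' b' /= -> ->.
by move: h1; rewrite /tens_i; case: (unindex k) => a b;
  case: (unindex k') => a' b' /= -> ->.
Qed.

Lemma tensmx3_1 : tensmx3 1%:M 1%:M 1%:M = 1%:M.
Proof.
apply/matrixP => i j; rewrite tensmx3E !mxE tens_eq.
by do 3!case: eqP => _; rewrite ?mul1r ?mul0r ?mulr0.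
Qed.

(** On a tensor of eigenvectors for [a], [b], [c] the eigenvalue is [c - b - a], positive exactly
    where filtering requires [Q([x,y],z)] to vanish. *)
Definition tens_op M : 'M[R]_W :=
  tensmx3 1%:M 1%:M M - tensmx3 1%:M M 1%:M - tensmx3 M 1%:M 1%:M.

Lemma tens_op_tr M : M^T = M -> (tens_op M)^T = tens_op M.
Proof. by move=> MT; rewrite !linearB /= !tensmx3_tr !trmx1 MT. Qed.

Lemma tens3Zr x y z a : tens3 x y (a *: z) = a *: tens3 x y z.
Proof. by apply/rowP => k; rewrite !mxE; ring. Qed.
Lemma tens3Zm x y z a : tens3 x (a *: y) z = a *: tens3 x y z.
Proof. by apply/rowP => k; rewrite !mxE; ring. Qed.
Lemma tens3Zl x y z a : tens3 (a *: x) y z = a *: tens3 x y z.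
Proof. by apply/rowP => k; rewrite !mxE; ring. Qed.

Lemma tens_op_eigen M x y z a b c : x *m M = a *: x -> y *m M = b *: y ->
  z *m M = c *: z -> tens3 x y z *m tens_op M = (c - b - a) *: tens3 x y z.
Proof.
move=> xa yb zc; rewrite !mulmxBr !mul_tens3 !mulmx1 xa yb zc.
by rewrite tens3Zr tens3Zm tens3Zl !scalerBl.
Qed.

Lemma row_tensmx3 A B C k :
  row k (tensmx3 A B C) = tens3 (row (tens_i k) A) (row (tens_j k) B) (row (tens_l k) C).
Proof. by apply/rowP => i; rewrite mxE tensmx3E !mxE. Qed.

Lemma tens_op_diag M U (d : 'I_n -> R) : U *m U^T = 1%:M ->
  (forall i, row i U *m M = d i *: row i U) ->
  exists E : 'M[R]_W, [/\ E *m E^T = 1%:M,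
    (forall k, row k E = tens3 (row (tens_i k) U) (row (tens_j k) U) (row (tens_l k) U)) &
    tens_op M = E^T *m diag_mx (\row_k (d (tens_l k) - d (tens_j k) - d (tens_i k))) *m E].
Proof.
move=> hU hd; exists (tensmx3 U U U); split.
- by rewrite tensmx3_tr tensmx3_mul hU tensmx3_1.
- by move=> k; rewrite row_tensmx3.
have EE : (tensmx3 U U U)^T *m tensmx3 U U U = 1%:M.
  by rewrite tensmx3_tr tensmx3_mul (mulmx1C hU) tensmx3_1.
rewrite -[LHS]mul1mx -EE -!mulmxA; congr (_ *m _); apply/row_matrixP => k.
rewrite row_mul row_tensmx3 (tens_op_eigen (hd _) (hd _) (hd _)).
by rewrite -row_tensmx3 mul_diag_mx; apply/rowP => i; rewrite !mxE.
Qed.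

End TensorCube.

(** * Positive square roots and absolute values of symmetric matrices *)

Section PsdRoot.
Variables (R : realType) (m : nat).
Local Notation dot := (ip (1%:M : 'M[R]_m)).
Let I1 := @inner_product1 R m.
Implicit Types (S T Y L : 'M[R]_m) (v w : 'rV[R]_m).

Lemma sym1 S : S^T = S -> symmetric_op 1%:M S.
Proof. by move=> hS; apply/symmetric_opP; rewrite hS mulmx1 mul1mx. Qed.

Lemma sqr_psd S v : S^T = S -> dot (v *m (S *m S)) v = dot (v *m S) (v *m S).
Proof. by move=> /sym1 hS; rewrite mulmxA hS. Qed.

(** [Y^2 - a^2] factors as [(Y - a)(Y + a)], and [Y + a] is injective for [a > 0]. For [a = 0] the
    length of [v Y] vanishes. *)
Lemma psd_root_eigen Y v (a : R) : Y^T = Y -> (forall w, 0 <= dot (w *m Y) w) ->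
  0 <= a -> v *m (Y *m Y) = a ^+ 2 *: v -> v *m Y = a *: v.
Proof.
move=> hY pY; rewrite le_eqVlt => /predU1P[<-|a0] vY.
  rewrite scale0r; apply: (ip_eq0 I1).
  by rewrite -(sqr_psd _ hY) vY expr0n scale0r ip0l.
apply/eqP; rewrite -subr_eq0; set w := v *m Y - a *: v.
have wY : w *m Y = - a *: w.
  rewrite /w mulmxBl -mulmxA vY -scalemxAl scalerBr scalerA mulNr -expr2.
  by rewrite !scaleNr opprK addrC.
have := pY w; rewrite wY ipZl mulNr oppr_ge0 pmulr_rle0// => ww.
by apply/eqP/(ip_eq0 I1)/eqP; rewrite eq_le ww ip_ge0.
Qed.

Lemma basis_ext (U B C : 'M[R]_m) : U *m U^T = 1%:M ->
  (forall i, row i U *m B = row i U *m C) -> B = C.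
Proof.
move=> hU h; have : U *m B = U *m C by apply/row_matrixP => i; rewrite !row_mul h.
by move=> /(congr1 (mulmx U^T)); rewrite !mulmxA (mulmx1C hU) !mul1mx.
Qed.

Lemma psd_root_uniq S T : S^T = S -> T^T = T ->
  (forall w, 0 <= dot (w *m S) w) -> (forall w, 0 <= dot (w *m T) w) ->
  S *m S = T *m T -> S = T.
Proof.
move=> hS hT pS pT ST; have [U [d [hU UT]]] := real_spectral hT.
have ed i : row i U *m T = d 0 i *: row i U.
  by rewrite -row_mul UT mul_diag_mx; apply/rowP => j; rewrite !mxE.
have d0 i : 0 <= d 0 i.
  have := pT (row i U); rewrite ed ipZl ip_rows mulmx1 hU mxE eqxx mulr1.
  exact.
apply: (basis_ext hU) => i; rewrite ed; apply: psd_root_eigen => //.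
by rewrite ST mulmxA ed -scalemxAl ed scalerA expr2.
Qed.

(* [S] plays the role of the square root of [|L|]. *)
Lemma abs_root_orth S L v c (a : R) : S^T = S -> L^T = L ->
  S *m S *m (S *m S) = L *m L -> c *m (S *m S + L) = 0 ->
  v *m L = a *: v -> 0 < a -> dot c v = 0.
Proof.
move=> hS hL SL cS vL a0.
have hY : (S *m S)^T = S *m S by rewrite trmx_mul hS.
have vY : v *m (S *m S) = a *: v.
  apply: psd_root_eigen => //; last 2 first.
  - exact: ltW.
  - by rewrite SL mulmxA vL -scalemxAl vL scalerA expr2.
  by move=> w; rewrite (sqr_psd w hS) ip_ge0.
have : dot (c *m (S *m S + L)) v = 0 by rewrite cS ip0l.
have -> : dot (c *m (S *m S + L)) v = dot c (v *m (S *m S + L)).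
  by rewrite (sym1 _ c v)// linearD /= hY hL.
rewrite mulmxDr vY vL ipDr// ipZr// -mulr2n => /eqP; rewrite mulrn_eq0 /= mulf_eq0.
by rewrite gt_eqF//= => /eqP.
Qed.

Lemma diag_psd_root E (d : 'rV[R]_m) : E *m E^T = 1%:M -> (forall k, 0 <= d 0 k) ->
  exists S, [/\ S^T = S, (forall w, 0 <= dot (w *m S) w) & S *m S = E^T *m diag_mx d *m E].
Proof.
move=> hE d0; pose s : 'rV[R]_m := \row_k Num.sqrt (d 0 k).
exists (E^T *m diag_mx s *m E); split.
- by rewrite !trmx_mul trmxK tr_diag_mx mulmxA.
- move=> w; rewrite !mulmxA /ip mulmx1.
  have -> : w *m E^T *m diag_mx s *m E *m w^T = (w *m E^T) *m diag_mx s *m (w *m E^T)^T.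
    by rewrite trmx_mul trmxK !mulmxA.
  rewrite -mulmxA !mxE; apply: sumr_ge0 => k _; rewrite mul_diag_mx !mxE.
  by rewrite mulrCA mulr_ge0// ?sqrtr_ge0// -expr2 sqr_ge0.
- rewrite -!mulmxA (mulmxA E) hE mul1mx (mulmxA (diag_mx _)) mulmx_diag.
  by congr (_ *m (diag_mx _ *m _)); apply/rowP => k; rewrite !mxE -expr2 sqr_sqrtr.
Qed.

(** In the eigenbasis [E] the root has entries [sqrt |d|], and [S^2 + L] has entries [|d| + d], zero
    wherever [d <= 0]. *)
Lemma abs_root_ex L E (d : 'rV[R]_m) (c : 'rV[R]_m) : E *m E^T = 1%:M ->
  L = E^T *m diag_mx d *m E -> (forall k, 0 < d 0 k -> dot c (row k E) = 0) ->
  exists S, [/\ S^T = S, (forall w, 0 <= dot (w *m S) w),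
    S *m S *m (S *m S) = L *m L & c *m (S *m S + L) = 0].
Proof.
move=> hE LE hc; pose F (e : 'rV[R]_m) := E^T *m diag_mx e *m E.
have [|S [ST Sp SS]] := @diag_psd_root E (\row_k `|d 0 k|) hE.
  by move=> k; rewrite mxE.
exists S; split=> //; rewrite SS LE.
- rewrite -!mulmxA !(mulmxA E) hE !mul1mx !(mulmxA (diag_mx _)) !mulmx_diag.
  congr (_ *m (diag_mx _ *m _)); apply/rowP => k; rewrite !mxE.
  by rewrite -!expr2 real_normK ?num_real.
- have -> : F (\row_k `|d 0 k|) + F d = F (\row_k (`|d 0 k| + d 0 k)).
    rewrite /F -mulmxDl -mulmxDr; congr (_ *m _ *m _); apply/matrixP => i j.
    by rewrite !mxE -mulrnDl.
  rewrite /F !mulmxA; suff -> : c *m E^T *m diag_mx (\row_k (`|d 0 k| + d 0 k)) = 0.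
    by rewrite mul0mx.
  rewrite mul_mx_diag; apply/rowP => k; rewrite !mxE.
  have [dk|dk] := ltP 0 (d 0 k); last by rewrite ler0_norm// addNr mulr0.
  have := hc k dk; rewrite /ip mulmx1 mxE => h.
  by rewrite (eq_bigr (fun i => c 0 i * (row k E)^T i 0)) ?h ?mul0r// => i _; rewrite !mxE.
Qed.

End PsdRoot.

Lemma sum_tens3 (R : realType) n (F : 'I_n -> 'I_n -> 'I_n -> R) :
  \sum_i \sum_j \sum_l F i j l =
  \sum_(t < n * (n * n)) F (tens_i t) (tens_j t) (tens_l t).
Proof.
have E m p (H : 'I_m -> 'I_p -> R) : \sum_i \sum_j H i j =
    \sum_(t < m * p) H (mxtens.mxtens_unindex t).1 (mxtens.mxtens_unindex t).2.
  rewrite pair_big; apply: reindex => /=.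
  by exists (@mxtens.mxtens_index m p) => i; rewrite (mxtens.mxtens_indexK, mxtens.mxtens_unindexK).
by under eq_bigr do rewrite E; rewrite E.
Qed.

Section PolyMx.
Variables (R : realType) (N : nat).

Definition polymx a b (F : 'rV[R]_N -> 'M[R]_(a, b)) :=
  forall i j, polyfun (fun z => F z i j).

Lemma polymx_cst a b (C : 'M[R]_(a, b)) : polymx (fun=> C).
Proof. by move=> i j; exact: polyfun_cst. Qed.

Lemma polymxD a b (F G : 'rV[R]_N -> 'M[R]_(a, b)) :
  polymx F -> polymx G -> polymx (fun z => F z + G z).
Proof.
by move=> pF pG i j; apply: polyfun_ext (polyfunD (pF i j) (pG i j)) => z; rewrite mxE.
Qed.

Lemma polymxB a b (F G : 'rV[R]_N -> 'M[R]_(a, b)) :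
  polymx F -> polymx G -> polymx (fun z => F z - G z).
Proof.
move=> pF pG i j.
by apply: polyfun_ext (polyfunD (pF i j) (polyfunN (pG i j))) => z; rewrite !mxE.
Qed.

Lemma polymxM a b c (F : 'rV[R]_N -> 'M[R]_(a, b)) (G : 'rV[R]_N -> 'M[R]_(b, c)) :
  polymx F -> polymx G -> polymx (fun z => F z *m G z).
Proof.
move=> pF pG i j.
have : polyfun (fun z => \sum_k F z i k * G z k j).
  by apply: polyfun_sum => k _; exact: polyfunM.
by apply: polyfun_ext => z; rewrite mxE.
Qed.

Lemma polymx_tr a b (F : 'rV[R]_N -> 'M[R]_(a, b)) : polymx F -> polymx (fun z => (F z)^T).
Proof. by move=> pF i j; apply: polyfun_ext (pF j i) => z; rewrite mxE. Qed.

Lemma polymx_vec a b (F : 'rV[R]_N -> 'M[R]_(a, b)) : polymx F -> polymx (fun z => mxvec (F z)).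
Proof.
move=> pF i j; rewrite (ord1 i); case/mxvec_indexP: j => u v.
by apply: polyfun_ext (pF u v) => z; rewrite mxvecE.
Qed.

Lemma polymx_tens_op n (F : 'rV[R]_N -> 'M[R]_n) : polymx F -> polymx (fun z => tens_op (F z)).
Proof.
have pT (A B C : 'rV[R]_N -> 'M[R]_n) : polymx A -> polymx B -> polymx C ->
    polymx (fun z => tensmx3 (A z) (B z) (C z)).
  move=> pA pB pC i j; apply: polyfun_ext (polyfunM (pA (tens_i i) (tens_i j))
    (polyfunM (pB (tens_j i) (tens_j j)) (pC (tens_l i) (tens_l j)))) => z.
  by rewrite tensmx3E.
have p1 : polymx (fun=> 1%:M : 'M[R]_n) by exact: polymx_cst.
by move=> pF; apply: polymxB; [apply: polymxB|]; exact: pT.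
Qed.

Definition frob a b (A : 'M[R]_(a, b)) : R := \sum_i \sum_j A i j ^+ 2.

Lemma frob_ge0 a b (A : 'M[R]_(a, b)) : 0 <= frob A.
Proof. by apply: sumr_ge0 => i _; apply: sumr_ge0 => j _; rewrite sqr_ge0. Qed.

Lemma frob_ge a b (A : 'M[R]_(a, b)) i j : A i j ^+ 2 <= frob A.
Proof.
rewrite /frob (bigD1 i)//= (bigD1 j)//= -addrA lerDl addr_ge0//.
  by apply: sumr_ge0 => l _; rewrite sqr_ge0.
by apply: sumr_ge0 => l _; apply: sumr_ge0 => q _; rewrite sqr_ge0.
Qed.

Lemma frob0 a b : frob (0 : 'M[R]_(a, b)) = 0.
Proof. by rewrite /frob big1// => i _; rewrite big1// => j _; rewrite mxE expr0n. Qed.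

Lemma frob_eq0 a b (A : 'M[R]_(a, b)) : frob A = 0 -> A = 0.
Proof.
move=> A0; apply/matrixP => i j; rewrite mxE; apply/eqP; rewrite -sqrf_eq0.
by rewrite eq_le sqr_ge0 andbT -A0 frob_ge.
Qed.

Lemma polyfun_frob a b (F : 'rV[R]_N -> 'M[R]_(a, b)) : polymx F -> polyfun (fun z => frob (F z)).
Proof.
move=> pF; apply: polyfun_sum => i _; apply: polyfun_sum => j _.
exact: polyfun_sqr.
Qed.

Lemma polymx_continuous a b (F : 'rV[R]_N -> 'M[R]_(a, b)) : polymx F -> continuous F.
Proof.
move=> pF x A /nbhs_ballP[e /= e0 he].
have : \forall z \near x, forall ij : 'I_a * 'I_b, `|F x ij.1 ij.2 - F z ij.1 ij.2| < e.
  apply: (filter_forall (nbhs_filter (x : 'rV[R]_N))) => ij.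
  exact: (cvgr_dist_lt _ _ (polyfun_continuous (pF ij.1 ij.2) (x := x))).
by apply: filterS => z hz; apply: he; split=> // i j; exact: (hz (i, j)).
Qed.

Lemma frob_trE a b (A : 'M[R]_(a, b)) : frob A = \tr (A *m A^T).
Proof. by apply: eq_bigr => i _; rewrite mxE; apply: eq_bigr => j _; rewrite mxE expr2. Qed.

End PolyMx.

(** Condenses infinitely many linear conditions, such as commuting with all of [cA], into one matrix
    equation. A subspace of largest dimension inside [P] is all of [P], and [F] projects onto its
    orthogonal complement. *)
Lemma linear_conditions (R : realType) (N : nat) (P : 'rV[R]_N -> Prop) :
  P 0 -> (forall a x y, P x -> P y -> P (a *: x + y)) ->
  exists F : 'M[R]_N, forall x, P x <-> x *m F = 0.
Proof.
move=> P0 PD.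
pose ok m := `[< exists2 U : {vspace 'rV[R]_N}, \dim U = m & forall x, x \in U -> P x >].
have ok0 : exists m, ok m.
  by exists 0%N; apply/asboolP; exists 0%VS; rewrite ?dimv0// => x; rewrite memv0 => /eqP->.
have okb m : ok m -> (m <= \dim {: 'rV[R]_N})%N.
  by move=> /asboolP[U <- _]; rewrite dimvS ?subvf.
case: (ex_maxnP ok0 okb) => m /asboolP[U dU UP] maxU.
have PU x : P x -> x \in U.
  move=> Px; apply/negPn/negP => xU.
  have : ok (\dim (U + <[x]>)%VS).
    apply/asboolP; exists (U + <[x]>)%VS => // y /memv_addP[u uU [w /vlineP[a ->] ->]].
    by rewrite addrC; apply: PD => //; exact: UP.
  move=> /maxU; rewrite -dU leqNgt => /negP; apply; rewrite ltn_neqAle dimvS ?addvSl// andbT.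
  apply: contraNN xU => /eqP d; have /eqP -> : U == (U + <[x]>)%VS.
    by rewrite eqEdim addvSl d leqnn.
  by apply: (subvP (addvSr _ _)); exact: memv_line.
have I1 := inner_product1 R N.
exists (coproj 1%:M U) => x; split=> [/PU xU|]; first exact: (coproj_kill I1).
rewrite mul_coproj => /eqP; rewrite subr_eq0 => /eqP ->; apply: UP.
exact: (oproj_mem I1).
Qed.

(** * Algebraic certificates for membership in X[k] *)

Section Certificate.
Variables (R : realType) (n : nat).
Variables (br : 'rV[R]_n -> 'rV[R]_n -> 'rV[R]_n) (Q : 'M[R]_n).
Hypothesis hL : compact_lie_algebra br Q.
Variables (cA : set 'M[R]_n) (h k : {vspace 'rV[R]_n}).
Hypothesis hA : compact_aut_group br Q h cA.
Hypotheses (sk : subalgebra br k) (ik : A_invariant cA k) (kf : k != fullv).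
Let hQ : inner_product Q := hL.1.

Local Notation W := (n * (n * n))%N.
Local Notation N := (n * n + (n * n + W * W))%N.

Definition certM (z : 'rV[R]_N) : 'M[R]_n := vec_mx (lsubmx z).
Definition certT (z : 'rV[R]_N) : 'M[R]_n := vec_mx (lsubmx (rsubmx z)).
Definition certS (z : 'rV[R]_N) : 'M[R]_W := vec_mx (rsubmx (rsubmx z)).
Definition cert_of (M T : 'M[R]_n) (S : 'M[R]_W) : 'rV[R]_N :=
  row_mx (mxvec M) (row_mx (mxvec T) (mxvec S)).

Lemma certMK M T S : certM (cert_of M T S) = M.
Proof. by rewrite /certM row_mxKl mxvecK. Qed.
Lemma certTK M T S : certT (cert_of M T S) = T.
Proof. by rewrite /certT row_mxKr row_mxKl mxvecK. Qed.
Lemma certSK M T S : certS (cert_of M T S) = S.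
Proof. by rewrite /certS !row_mxKr mxvecK. Qed.
Lemma cert_ofK z : cert_of (certM z) (certT z) (certS z) = z.
Proof. by rewrite /cert_of !vec_mxK !hsubmxK. Qed.

Lemma polymx_certM : polymx certM.
Proof. by move=> i j; apply: polyfun_ext (polyfun_coord _ _) => z; rewrite !mxE. Qed.
Lemma polymx_certT : polymx certT.
Proof. by move=> i j; apply: polyfun_ext (polyfun_coord _ _) => z; rewrite !mxE. Qed.
Lemma polymx_certS : polymx certS.
Proof. by move=> i j; apply: polyfun_ext (polyfun_coord _ _) => z; rewrite !mxE. Qed.

Variable G : 'M[R]_n.
Hypothesis hG : G *m Q *m G^T = 1%:M.
Let hGK : Q *m G^T *m G = 1%:M := orthonormalK hG.

(** [op_of] and [mx_of] pass between operators and matrices in the [Q]-orthonormal basis [G], where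
    [Q]-symmetric means symmetric. *)
Definition op_of (M : 'M[R]_n) : 'M[R]_n := Q *m G^T *m M *m G.
Definition mx_of (A : 'M[R]_n) : 'M[R]_n := G *m A *m Q *m G^T.

Lemma mx_ofK A : op_of (mx_of A) = A.
Proof.
rewrite /op_of /mx_of !mulmxA hGK mul1mx -!mulmxA (mulmxA Q) hGK.
by rewrite mulmx1.
Qed.

Lemma op_ofK M : mx_of (op_of M) = M.
Proof.
rewrite /op_of /mx_of !mulmxA hG mul1mx -!mulmxA (mulmxA G) hG.
by rewrite mulmx1.
Qed.

Lemma mul_op_of (M : 'M[R]_n) (x : 'rV[R]_n) : x *m op_of M = (x *m Q *m G^T) *m M *m G.
Proof. by rewrite /op_of !mulmxA. Qed.

Lemma coordK (x : 'rV[R]_n) : x *m Q *m G^T *m G = x.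
Proof. by rewrite -!mulmxA (mulmxA Q) hGK mulmx1. Qed.

Lemma coordG (x : 'rV[R]_n) : x *m G *m Q *m G^T = x.
Proof. by rewrite -!mulmxA (mulmxA G) hG mulmx1. Qed.

Lemma op_of_tr M : \tr (op_of M) = \tr M.
Proof. by rewrite /op_of mxtrace_mulC !mulmxA hG mul1mx. Qed.

Lemma op_of_sym M : M^T = M <-> symmetric_op Q (op_of M).
Proof.
rewrite symmetric_opP; split=> [hM|].
  rewrite /op_of !trmx_mul trmxK hQ.1 hM !mulmxA.
  by rewrite -!mulmxA; congr (_ *m (_ *m (_ *m _))); rewrite mulmxA.
move=> sA; have E : M = G *m (op_of M *m Q) *m G^T by rewrite -[LHS]op_ofK /mx_of !mulmxA.
by rewrite {1}E trmx_mul (trmx_mul G) trmxK mulmxA (trmx_mul _ Q) hQ.1 -sA -E.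
Qed.

Definition struct_tensor : 'rV[R]_W :=
  \row_t ip Q (br (row (tens_i t) G) (row (tens_j t) G)) (row (tens_l t) G).

Lemma struct_tensorE (x y z : 'rV[R]_n) :
  ip 1%:M struct_tensor (tens3 x y z) = ip Q (br (x *m G) (y *m G)) (z *m G).
Proof.
rewrite /ip mulmx1 mxE -/(ip Q _ _) !mulmx_sum_row (br_suml hL) ip_suml.
rewrite (eq_bigr (fun i => \sum_j \sum_l
  x 0 i * (y 0 j * (z 0 l * ip Q (br (row i G) (row j G)) (row l G))))); last first.
  move=> i _; rewrite (brZl hL) (br_sumr hL) ipZl ip_suml mulr_sumr; apply: eq_bigr => j _.
  rewrite (brZr hL) ipZl (ip_sumr hQ) !mulr_sumr; apply: eq_bigr => l _.
  by rewrite (ipZr hQ).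
rewrite (sum_tens3 (fun i j l => x 0 i * (y 0 j * (z 0 l * ip Q (br (row i G) (row j G)) (row l G))))).
by apply: eq_bigr => t _; rewrite !mxE; ring.
Qed.

Variable F : 'M[R]_(n * n).
Hypothesis hF : forall A : 'M[R]_n, mxvec A *m F = 0 <->
  (forall a, cA a -> a *m A = A *m a) /\ (forall x, x \in k -> x *m A = 0).

(** Equations only: [T] forces [M] to be positive, [S *m S] is the absolute value of [tens_op M],
    and the fourth clause puts the structure tensor into the nonpositive eigenspaces. No sign is
    imposed on [T] and [S], so one operator may have several certificates. *)
Definition certificate (z : 'rV[R]_N) : Prop :=
  let M := certM z in let T := certT z in let S := certS z in
  [/\ M^T = M, T^T = T /\ T *m T = M, S^T = S /\ S *m S *m (S *m S) = tens_op M *m tens_op M,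
      struct_tensor *m (S *m S + tens_op M) = 0 & mxvec (op_of M) *m F = 0 /\ \tr M = 1].

Definition cert_fun (z : 'rV[R]_N) : R :=
  let M := certM z in let T := certT z in let S := certS z in
  frob (M^T - M) + (frob (T^T - T) + (frob (T *m T - M) + (frob (S^T - S) +
  (frob (S *m S *m (S *m S) - tens_op M *m tens_op M) +
  (frob (struct_tensor *m (S *m S + tens_op M)) +
  (frob (mxvec (op_of M) *m F) + (\tr M - 1) ^+ 2)))))).

Lemma cert_funP z : cert_fun z = 0 <-> certificate z.
Proof.
rewrite /cert_fun /certificate; set M := certM z; set T := certT z; set S := certS z.
have E (a b : R) : 0 <= a -> 0 <= b -> (a + b = 0 <-> a = 0 /\ b = 0).
  move=> a0 b0; split=> [/eqP|[-> ->]]; last by rewrite addr0.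
  by rewrite paddr_eq0// => /andP[/eqP -> /eqP ->].
have F0 a b (B : 'M[R]_(a, b)) : frob B = 0 <-> B = 0.
  by split=> [/frob_eq0//|->]; rewrite frob0.
have FB a b (B C : 'M[R]_(a, b)) : frob (B - C) = 0 <-> B = C.
  by rewrite F0; split=> [/eqP|->]; rewrite ?subrr// subr_eq0 => /eqP.
have S0 (a : R) : (a - 1) ^+ 2 = 0 <-> a = 1.
  by split=> [/eqP|->]; rewrite ?subrr ?expr0n// sqrf_eq0 subr_eq0 => /eqP.
by rewrite !E ?addr_ge0 ?frob_ge0 ?sqr_ge0// !FB !F0 S0; split;
  [move=> [? [? [? [? [? [? [? ?]]]]]]]|move=> [? [? ?] [? ?] ? [? ?]]].
Qed.

Lemma cert_fun_ge0 z : 0 <= cert_fun z.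
Proof. by rewrite /cert_fun !addr_ge0 ?frob_ge0 ?sqr_ge0. Qed.

Lemma polymx_op_of : polymx (fun z => op_of (certM z)).
Proof. exact: polymxM (polymxM (polymx_cst _ (Q *m G^T)) polymx_certM) (polymx_cst _ G). Qed.

Lemma polyfun_cert_fun : polyfun cert_fun.
Proof.
have pM := polymx_certM; have pT := polymx_certT; have pS := polymx_certS.
have pL := polymx_tens_op pM.
have pSS := polymxM pS pS.
do 2!(apply: polyfunD; first by apply: polyfun_frob; apply: polymxB => //; exact: polymx_tr).
apply: polyfunD.
  by apply: polyfun_frob; apply: polymxB => //; exact: polymxM.
apply: polyfunD.
  by apply: polyfun_frob; apply: polymxB => //; exact: polymx_tr.
apply: polyfunD.
  by apply: polyfun_frob; apply: polymxB; exact: polymxM.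
apply: polyfunD.
  by apply: polyfun_frob; apply: polymxM; [exact: polymx_cst|exact: polymxD].
apply: polyfunD.
  apply: polyfun_frob; apply: polymxM; [|exact: polymx_cst].
  by apply: polymx_vec; exact: polymx_op_of.
apply: polyfun_sqr; apply: polyfunD; last exact: polyfun_cst.
by apply: polyfun_sum => i _; exact: pM.
Qed.

Lemma certificate_Xk z : certificate z -> Xk br Q cA k (op_of (certM z)).
Proof.
move=> [MT [TT TM] [ST SL] cS [/hF[cAA kA] tM]].
set M := certM z in MT TM SL cS cAA kA tM *; set T := certT z in TT TM; set S := certS z in ST SL cS.
have sA : symmetric_op Q (op_of M) by apply/op_of_sym.
apply/(XkE hL); split; last by rewrite op_of_tr.
have coord (x : 'rV[R]_n) a : x *m op_of M = a *: x -> x *m Q *m G^T *m M = a *: (x *m Q *m G^T).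
  rewrite mul_op_of => /(congr1 (fun u => u *m Q *m G^T)); rewrite coordG => ->.
  by rewrite -!scalemxAl.
split=> //.
- apply/(filteringP hL sA) => a b c x y w /coord xa /coord yb /coord wc abc.
  have vL := tens_op_eigen xa yb wc.
  have := abs_root_orth ST (tens_op_tr MT) SL cS vL.
  rewrite struct_tensorE !coordK; apply; lra.
- move=> x; rewrite mul_op_of; set u := x *m Q *m G^T.
  have -> : ip Q (u *m M *m G) x = ip 1%:M (u *m T) (u *m T).
    rewrite -[x]coordK -/u /ip mulmx1 -TM !trmx_mul TT !mulmxA.
    by rewrite -(mulmxA _ G Q) -(mulmxA _ (G *m Q)) hG mulmx1.
  exact: (ip_ge0 (inner_product1 R n)).
Qed.

Definition psd_mx m (S : 'M[R]_m) := forall w, 0 <= ip 1%:M (w *m S) w.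

Lemma Xk_certificate A : Xk br Q cA k A -> exists z,
  [/\ certificate z, psd_mx (certT z), psd_mx (certS z) & op_of (certM z) = A].
Proof.
move=> /(XkE hL)[[sA fA pA cAA kA] tA]; pose M := mx_of A.
have AM : op_of M = A by exact: mx_ofK.
have MT : M^T = M by apply/op_of_sym; rewrite AM.
have [V [d [hV VM]]] := real_spectral MT.
have ed i : row i V *m M = d 0 i *: row i V.
  by rewrite -row_mul VM mul_diag_mx; apply/rowP => j; rewrite !mxE.
pose u i := row i V *m G.
have ud i : u i *m A = d 0 i *: u i.
  by rewrite -AM mul_op_of /u coordG ed scalemxAl.
have uu i j : ip Q (u i) (u j) = (i == j)%:R.
  rewrite /ip trmx_mul !mulmxA -(mulmxA _ G Q) -(mulmxA _ (G *m Q)) hG mulmx1.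
  by have := @ip_rows R n 1%:M n V V i j; rewrite /ip !mulmx1 => ->; rewrite hV mxE.
have d0 i : 0 <= d 0 i.
  by have := pA (u i); rewrite ud ipZl uu eqxx mulr1.
have VV := mulmx1C hV.
have MV : M = V^T *m diag_mx d *m V by rewrite -mulmxA -VM mulmxA VV mul1mx.
have [T [TT Tp]] := diag_psd_root hV d0; rewrite -MV => TM.
have [E [hE rE LE]] := tens_op_diag hV ed.
have [|S [ST Sp SL cS]] := abs_root_ex (c := struct_tensor) hE LE.
  move=> t; rewrite mxE => dt; rewrite rE struct_tensorE.
  apply: ((filteringP hL sA).1 fA _ _ _ _ _ _ (ud _) (ud _) (ud _)).
  by move: dt; lra.
exists (cert_of M T S); rewrite /certificate certMK certTK certSK; split=> //; split=> //.
split; first by apply/hF; rewrite AM.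
by rewrite -op_of_tr AM.
Qed.

(** [tr M = 1] is the squared Frobenius norm of [T]; this bounds [T], then [M = T^2], then
    [tens_op M], a combination of three tensors. [S] is bounded through [S^4 = (tens_op M)^2]. *)
Lemma certificate_bounded : exists B, forall z, certificate z -> cube B z.
Proof.
pose n1 : R := n%:R + 1.
have n10 : 0 <= n%:R :> R by [].
pose C : R := 3 * n1.
have sumB m (a b : 'I_m -> R) (x y : R) : 0 <= x -> 0 <= y -> (forall i, `|a i| <= x) ->
    (forall i, `|b i| <= y) -> `|\sum_i a i * b i| <= m%:R * (x * y).
  move=> x0 y0 ha hb; apply: le_trans (ler_norm_sum _ _ _) _.
  rewrite mulr_natl -[X in _ *+ X](card_ord m) -sumr_const; apply: ler_sum => i _.
  by rewrite normrM ler_pM.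
exists (n1 + W%:R * (W%:R * (C * C)) + 1) => z [MT [TT TM] [ST SL] _ [_ tM]].
set M := certM z in MT TM SL tM; set T := certT z in TT TM; set S := certS z in ST SL.
have T1 i j : `|T i j| <= 1.
  rewrite -(@ler_pXn2r _ 2)// ?nnegrE// expr1n real_normK ?num_real//.
  have -> : 1 = frob T by rewrite frob_trE TT TM tM.
  exact: frob_ge.
have M1 i j : `|M i j| <= n1.
  rewrite -TM mxE; apply: le_trans (sumB _ _ _ 1 1 _ _ _ _) _ => //.
  by rewrite /n1 mulr1 mulr1 lerDl.
have n11 : 1 <= n1 by rewrite /n1 lerDr.
have one i j : `|(1%:M : 'M[R]_n) i j| <= 1 by rewrite mxE; case: (i == j); rewrite ?normr1 ?normr0.
have L1 i j : `|tens_op M i j| <= C.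
  have tb (X Y Z : 'M[R]_n) (x y w : R) : (forall i j, `|X i j| <= x) -> (forall i j, `|Y i j| <= y) ->
      (forall i j, `|Z i j| <= w) -> `|tensmx3 X Y Z i j| <= x * (y * w).
    by move=> hX hY hZ; rewrite tensmx3E !normrM; do 2!(apply: ler_pM => //; try exact: mulr_ge0).
  have -> : tens_op M i j = tensmx3 1%:M 1%:M M i j - tensmx3 1%:M M 1%:M i j -
    tensmx3 M 1%:M 1%:M i j by rewrite !mxE.
  apply: le_trans (ler_normB _ _) _; apply: le_trans (lerD (ler_normB _ _) (lexx _)) _.
  have h1 := tb _ _ _ _ _ _ one one M1; have h2 := tb _ _ _ _ _ _ one M1 one.
  have h3 := tb _ _ _ _ _ _ M1 one one.
  by rewrite /C; lra.
have C0 : 0 <= C by rewrite /C; lra.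
pose B0 : R := W%:R * (W%:R * (C * C)).
have B00 : 0 <= B0.
  by apply: mulr_ge0; [|apply: mulr_ge0; [|exact: mulr_ge0]]; exact: ler0n.
have fS : frob (S *m S) <= B0.
  rewrite frob_trE trmx_mul ST SL /B0 mulr_natl -[X in _ *+ X](card_ord W) -sumr_const.
  apply: ler_sum => i _; apply: le_trans (ler_norm _) _; rewrite mxE.
  by apply: sumB.
(* [(S i j)^2] is at most the diagonal entry [(S^2) i i], whose square is at most [B0]; adding 1
   avoids square roots. *)
have S1 i j : `|S i j| <= 1 + B0.
  have t2 : (S *m S) i i ^+ 2 <= B0 by apply: le_trans fS; exact: frob_ge.
  have t1 : (S *m S) i i <= 1 + B0.
    have := sqr_ge0 ((S *m S) i i - 1); nra.
  have sij : S i j ^+ 2 <= (S *m S) i i.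
    have -> : (S *m S) i i = \sum_q S i q ^+ 2.
      rewrite -{2}ST mxE; apply: eq_bigr => q _.
      by rewrite [S^T _ _]mxE expr2.
    by rewrite (bigD1 j)//= lerDl; apply: sumr_ge0 => q _; rewrite sqr_ge0.
  rewrite -(@ler_pXn2r _ 2)// ?nnegrE ?addr_ge0// real_normK ?num_real//.
  by nra.
rewrite -/B0 => i; rewrite -[z]cert_ofK /cert_of mxE.
case: (fintype.split i) => [q|q]; last rewrite mxE; [|case: (fintype.split q) => {}q];
  case/mxvec_indexP: q => a b; rewrite mxvecE.
- by have := M1 a b; lra.
- by have := T1 a b; lra.
- by have := S1 a b; lra.
Qed.

Lemma psd_mx_closed m (X : 'rV[R]_N -> 'M[R]_m) : polymx X -> closed [set z | psd_mx (X z)].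
Proof.
move=> pX.
have -> : [set z | psd_mx (X z)] = \bigcap_(w in [set: 'rV[R]_m])
    (fun z => (w *m X z *m 1%:M *m w^T) 0 0) @^-1` [set t | 0 <= t].
  by apply/seteqP; split=> z /= hz w; [move=> _|]; exact: hz.
apply: closed_bigI => w _; apply: closed_comp => [z _|]; last exact: closed_ge.
apply: polyfun_continuous.
exact: (polymxM (polymxM (polymxM (polymx_cst _ w) pX) (polymx_cst _ 1%:M)) (polymx_cst _ w^T)).
Qed.

Lemma Xk_compact_extensor : compact (Xk br Q cA k) /\ absolute_extensor (Xk br Q cA k).
Proof.
have [B hB] := certificate_bounded.
(* On certificates with positive roots [p] is injective, so by compactness its inverse [sigma] is a
   continuous section. It lands in the full zero set, to which the neighbourhood retraction
   applies. *)
pose Zp := [set z | cert_fun z = 0] `&` [set z | psd_mx (certT z) /\ psd_mx (certS z)].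
have cZ : compact [set z | cert_fun z = 0].
  have -> : [set z | cert_fun z = 0] = cube B `&` cert_fun @^-1` [set 0].
    apply/seteqP; split=> z /= => [h0|[]//]; split=> //; apply: hB; exact/cert_funP.
  apply: compact_closedI; first exact: cube_compact.
  apply: closed_comp => [z _|]; last exact: closed_eq.
  by apply: polyfun_continuous; exact: polyfun_cert_fun.
have cZp : compact Zp.
  apply: compact_closedI => //.
  by apply: (@closedI _ [set z | psd_mx (certT z)] [set z | psd_mx (certS z)]); apply: psd_mx_closed; [exact: polymx_certT|exact: polymx_certS].
pose p z := op_of (certM z).
have cp : continuous p by apply: polymx_continuous; exact: polymx_op_of.
have pZ : p @` [set z | cert_fun z = 0] = Xk br Q cA k.
  apply/seteqP; split=> [_ [z /cert_funP cz <-]|A XA]; first exact: certificate_Xk.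
  by have [z [cz _ _ <-]] := Xk_certificate XA; exists z => //; exact/cert_funP.
have cX : compact (Xk br Q cA k).
  by rewrite -pZ; apply: continuous_compact => //; exact: continuous_subspaceT.
split=> //.
have sec A : exists z, Xk br Q cA k A -> Zp z /\ p z = A.
  have [XA|] := pselect (Xk br Q cA k A); last by exists 0.
  have [z [cz tz sz pz]] := Xk_certificate XA; exists z => _; split=> //; split=> //.
  exact/cert_funP.
have [sigma sP] := choice sec.
have pZp : p @` Zp = Xk br Q cA k.
  apply/seteqP; split=> [_ [z [zZ _] <-]|A /sP[]]; first by rewrite -pZ; exists z.
  by exists (sigma A).
have sK z : Zp z -> sigma (p z) = z.
  move=> Zz; have Xz : Xk br Q cA k (p z) by rewrite -pZp; exists z.
  have [] := sP _ Xz; move: (sigma (p z)) => w Zw pw.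
  have Mwz : certM w = certM z by rewrite -[certM w]op_ofK -[certM z]op_ofK -!/(p _) pw.
  case: Zw Zz => /cert_funP[_ [TT TM] [ST SL] _ _] [Tp Sp].
  case=> /cert_funP[_ [TT' TM'] [ST' SL'] _ _] [Tp' Sp'].
  have Twz : certT w = certT z by apply: psd_root_uniq => //; rewrite TM TM' Mwz.
  have Swz : certS w = certS z.
    apply: psd_root_uniq => //; apply: psd_root_uniq.
    - by rewrite trmx_mul ST.
    - by rewrite trmx_mul ST'.
    - by move=> v; rewrite (sqr_psd v ST) (ip_ge0 (inner_product1 _ _)).
    - by move=> v; rewrite (sqr_psd v ST') (ip_ge0 (inner_product1 _ _)).
    - by rewrite SL SL' Mwz.
  by rewrite -[w]cert_ofK Mwz Twz Swz cert_ofK.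
apply: (@star_shaped_absolute_extensor R _ _ (chibar Q k) N cert_fun p sigma).
- exact: (Xk_chibar hL hA).
- exact: compact_bounded.
- by move=> A t XA t01; exact: (Xk_star hL hA).
- exact: polyfun_cert_fun.
- exact: cert_fun_ge0.
- by exists B => z /cert_funP/hB.
- exact: cp.
- rewrite -pZp; apply: compact_inverse_continuous => //.
  exact: continuous_subspaceT.
- by move=> A XA; have [[]] := sP A XA.
- by move=> z z0; rewrite -pZ; exists z.
Qed.

End Certificate.

Lemma Xk_compact_absolute_extensor (R : realType) (n : nat)
    (br : 'rV[R]_n -> 'rV[R]_n -> 'rV[R]_n) (Q : 'M[R]_n)
    (cA : set 'M[R]_n) (h k : {vspace 'rV[R]_n}) :
  compact_lie_algebra br Q -> compact_aut_group br Q h cA ->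
  subalgebra br k -> A_invariant cA k -> k != fullv ->
  compact (Xk br Q cA k) /\ absolute_extensor (Xk br Q cA k).
Proof.
move=> hL hA sk ik kf; have [G hG] := orthonormal_basis hL.1.
pose P (v : 'rV[R]_(n * n)) := (forall a, cA a -> a *m vec_mx v = vec_mx v *m a) /\
  (forall x, x \in k -> x *m vec_mx v = 0).
have [||F hF] := @linear_conditions R (n * n) P.
- by split=> *; rewrite linear0 ?mulmx0 ?mul0mx.
- move=> a x y [x1 x2] [y1 y2]; split=> [b cb|w wk]; rewrite linearP /=.
    by rewrite mulmxDr mulmxDl -scalemxAr -scalemxAl x1// y1.
  by rewrite mulmxDr -scalemxAr x2// y2// scaler0 addr0.
apply: (Xk_compact_extensor hL hA sk ik kf hG (F := F)) => A.
by rewrite -hF /P mxvecK.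
Qed.

(** * Gluing homotopies piece by piece *)

Section Gluing.
Variables (R : realType) (V : normedModType R) (I : eqType).
Variables (X : I -> set V) (P : set V) (r : V -> V).

Definition piece_union (s : seq I) : set V := [set x | exists2 i, i \in s & X i x].

(** A point shared by the new piece and an older one lies in an older piece contained in the new
    one. The older homotopy preserves pieces, so over the overlap it already stays in the new
    piece. *)
Fixpoint glueable (s : seq I) : Prop :=
  if s is k :: s' then
    (forall l x, l \in s' -> X k x -> X l x -> exists m, [/\ m \in s', X m x & X m `<=` X k])
    /\ glueable s'
  else True.

Hypotheses (cP : closed P).
Hypothesis rP : forall x, P x -> r x = x.

Lemma piece_union_closed s : (forall i, i \in s -> closed (X i)) -> closed (piece_union s).
Proof.
elim: s => [|k s IH] cX.
  have -> : piece_union [::] = set0 by apply/seteqP; split=> x // -[].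
  exact: closed0.
have -> : piece_union (k :: s) = X k `|` piece_union s.
  apply/seteqP; split=> x.
    by move=> [i]; rewrite in_cons => /predU1P[->|ins] Xx; [left|right; exists i].
  move=> [Xx|[i ins Xx]]; first by exists k; rewrite // mem_head.
  by exists i => //; rewrite in_cons ins orbT.
apply: closedU; first by apply: cX; rewrite mem_head.
by apply: IH => i ins; apply: cX; rewrite in_cons ins orbT.
Qed.

Definition on_itv (A : set V) : set (V * R) := [set p | A p.1 /\ 0 <= p.2 <= 1].

Lemma on_itv_closed A : closed A -> closed (on_itv A).
Proof.
move=> cA; have -> : on_itv A = fst @^-1` A `&`
    (snd @^-1` [set t | 0 <= t] `&` snd @^-1` [set t | t <= 1]).
  by apply/seteqP; split=> -[x t] /= [Ax h]; split=> //; apply/andP.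
apply: closedI; first by apply: closed_comp => // p _; exact: cvg_fst.
by apply: closedI; apply: closed_comp => [p _|];
  [exact: cvg_snd|exact: closed_ge|exact: cvg_snd|exact: closed_le].
Qed.

(** Induction from the end of the list: for the head [k], the homotopy over [X k] is prescribed on a
    closed part of the cylinder, with values in [X k], and filled in because [X k] is an absolute
    extensor. *)
Lemma homotopy_glue (s : seq I) : glueable s ->
  (forall i, i \in s -> closed (X i) /\ absolute_extensor (X i)) ->
  {within piece_union s, continuous r} ->
  (forall i x, i \in s -> X i x -> X i (r x)) ->
  exists H : V * R -> V,
  [/\ {within on_itv (piece_union s), continuous H},
      (forall i x t, i \in s -> X i x -> 0 <= t <= 1 -> X i (H (x, t))),
      (forall x, piece_union s x -> H (x, 0) = x),
      (forall x, piece_union s x -> H (x, 1) = r x) &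
      (forall x t, piece_union s x -> P x -> 0 <= t <= 1 -> H (x, t) = x)].
Proof.
elim: s => [_ _ _ _|k s IH [gk gs] hX cr rX].
  exists fst; split=> //.
  - have -> : on_itv (piece_union [::]) = set0 by apply/seteqP; split=> x // -[[]].
    exact: continuous_subspace0.
  - by move=> x [].
have subU x : piece_union s x -> piece_union (k :: s) x.
  by move=> [i ins Xx]; exists i => //; rewrite in_cons ins orbT.
have subk x : X k x -> piece_union (k :: s) x by exists k; rewrite // mem_head.
have hXs i : i \in s -> closed (X i) /\ absolute_extensor (X i).
  by move=> ins; apply: hX; rewrite in_cons ins orbT.
have [cXk aeXk] := hX k (mem_head _ _).
have cU : closed (piece_union s) by apply: piece_union_closed => i /hXs[].
have [||H [cH HX H0 H1 HP]] := IH gs hXs.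
- exact: continuous_subspaceW cr.
- by move=> i x ins; apply: rX; rewrite in_cons ins orbT.
(* The prescribed part: [C1] over the older pieces, [C2] stationary over [P] and at time 0, [C3]
   equal to [r] at time 1. Where they overlap, the properties of [H] and [rP] make the prescriptions
   agree. *)
pose f (p : V * R) : V := if pselect (piece_union s p.1) then H p else
  if pselect (P p.1 \/ p.2 = 0) then p.1 else r p.1.
pose C1 := on_itv (X k `&` piece_union s).
pose C2 := on_itv (X k) `&` [set p | P p.1 \/ p.2 = 0].
pose C3 := on_itv (X k) `&` [set p | p.2 = 1].
have f1 p : C1 p -> f p = H p by move=> [[_ Up] _]; rewrite /f; case: pselect.
have f2 p : C2 p -> f p = p.1.
  move=> [[Xp tp] hp]; rewrite /f; case: pselect => [Up|nU] /=; last by case: pselect.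
  by case: hp; case: p Xp tp Up => x t /= Xp tp Up; [move=> Px; rewrite HP|move=> ->; rewrite H0].
have f3 p : C3 p -> f p = r p.1.
  move=> [[Xp tp] hp]; rewrite /f; case: pselect => [Up|nU] /=.
    by case: p hp Xp tp Up => x t /= -> _ _ Up; rewrite H1.
  case: pselect => //= hp'; case: hp' => [Px|p0] /=; first by rewrite rP.
  by move: p0; rewrite hp => /eqP; rewrite oner_eq0.
have cC1 : closed C1 by apply: on_itv_closed; exact: closedI.
have cC2 : closed C2.
  apply: closedI; first exact: on_itv_closed.
  have -> : [set p : V * R | P p.1 \/ p.2 = 0] = fst @^-1` P `|` snd @^-1` [set 0] by [].
  apply: closedU; first by apply: closed_comp => // p _; exact: cvg_fst.
  by apply: closed_comp => [p _|]; [exact: cvg_snd|exact: closed_eq].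
have cC3 : closed C3.
  apply: closedI; first exact: on_itv_closed.
  have -> : [set p : V * R | p.2 = 1] = snd @^-1` [set 1] by [].
  by apply: closed_comp => [p _|]; [exact: cvg_snd|exact: closed_eq].
have cfst (D : set (V * R)) : {within D, continuous (fst : V * R -> V)}.
  by apply: continuous_subspaceT => p; exact: cvg_fst.
have cf : {within (C1 `|` C2) `|` C3, continuous f}.
  apply: withinU_continuous => //; first exact: closedU.
    apply: withinU_continuous => //.
      apply: (@subspace_eq_continuous _ _ _ H) => [p /set_mem/f1 //|].
      by apply: continuous_subspaceW cH => p [[_ Up] tp].
    by apply: (@subspace_eq_continuous _ _ _ fst) => [p /set_mem/f2 //|].
  apply: (@subspace_eq_continuous _ _ _ (r \o fst)) => [p /set_mem/f3 //|].
  apply: within_comp_continuous (cfst C3) cr _.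
  by move=> p [[/subk]].
have fX p : ((C1 `|` C2) `|` C3) p -> X k (f p).
  case=> [[Cp|Cp]|Cp].
  - rewrite f1//; case: Cp => [[Xp [l ls Xlp]] tp].
    have [m [ms Xmp mk]] := gk l p.1 ls Xp Xlp; apply: mk.
    by case: p tp Xmp {Xp Xlp} => x t /= tp Xmp; exact: HX.
  - by rewrite f2//; case: Cp => [[]].
  - by rewrite f3//; apply: rX; [rewrite mem_head|case: Cp => [[]]].
have [h [ch hXk hf]] := aeXk (V * R)%type _ f (closedU (closedU cC1 cC2) cC3) cf fX.
pose H' p := if pselect (piece_union s p.1) then H p else h p.
have H'1 p : on_itv (piece_union s) p -> H' p = H p.
  by move=> [Up _]; rewrite /H'; case: pselect.
have H'2 p : on_itv (X k) p -> H' p = h p.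
  move=> [Xp tp]; rewrite /H'; case: pselect => // Up.
  have Cp : C1 p by split.
  by rewrite hf ?f1//; left; left.
have Usplit p : on_itv (piece_union (k :: s)) p -> on_itv (piece_union s) p \/ on_itv (X k) p.
  move=> [[i]]; rewrite in_cons => /predU1P[->|ins] Xx tp; [by right; split|left].
  by split=> //; exists i.
have zero01 : 0 <= (0 : R) <= 1 by rewrite lexx ler01.
have one01 : 0 <= (1 : R) <= 1 by rewrite lexx ler01.
exists H'; split.
- have -> : on_itv (piece_union (k :: s)) = on_itv (piece_union s) `|` on_itv (X k).
    apply/seteqP; split=> p; first exact: Usplit.
    by move=> [[/subU]|[/subk]].
  apply: withinU_continuous; [exact: on_itv_closed|exact: on_itv_closed| |].
    by apply: (@subspace_eq_continuous _ _ _ H) => // p /set_mem/H'1.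
  apply: (@subspace_eq_continuous _ _ _ h) => [p /set_mem/H'2 //|].
  exact: continuous_subspaceT.
- move=> i x t; rewrite in_cons => /predU1P[->|ins] Xx tt.
    by rewrite H'2//; exact: hXk.
  by rewrite H'1; [exact: HX|split=> //; exists i].
- move=> x Ux; have [Up|Xp] := Usplit (x, 0) (conj Ux zero01).
    by rewrite H'1// H0//; case: Up.
  have C2p : C2 (x, 0) by split=> //; right.
  by rewrite H'2// hf ?f2//; left; right.
- move=> x Ux; have [Up|Xp] := Usplit (x, 1) (conj Ux one01).
    by rewrite H'1// H1//; case: Up.
  have C3p : C3 (x, 1) by split.
  by rewrite H'2// hf ?f3//; right.
- move=> x t Ux Px tt; have [Up|Xp] := Usplit (x, t) (conj Ux tt).
    by rewrite H'1// HP//; case: Up.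
  have C2p : C2 (x, t) by split=> //; left.
  by rewrite H'2// hf ?f2//; left; right.
Qed.

End Gluing.

(** * Weights on chains of subalgebras *)

Section Weights.
Variables (R : realType) (n : nat) (Q : 'M[R]_n).
Hypothesis hQ : inner_product Q.
Variable s : seq {vspace 'rV[R]_n}.
Hypothesis us : uniq s.
Implicit Types (k l f : {vspace 'rV[R]_n}) (u : {vspace 'rV[R]_n} -> R) (x y : 'rV[R]_n).

Definition chain_weights u :=
  (forall k, k \in s -> 0 <= u k) /\
  (forall k l, k \in s -> l \in s -> u k != 0 -> u l != 0 -> (k <= l)%VS || (l <= k)%VS).

Definition weighted_op u : 'M[R]_n := \sum_(k <- s) u k *: coproj Q k.

(* The smallest [a] such that [l] lies in the span of the eigenvectors of
   [weighted_op u] with eigenvalue at most [a]. *)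
Definition level u l : R := \sum_(k <- s | ~~ (l <= k)%VS) u k.

Lemma mul_weighted_op u x : x *m weighted_op u = \sum_(k <- s) u k *: (x *m coproj Q k).
Proof. by rewrite mulmx_sumr; apply: eq_bigr => k _; rewrite -scalemxAr. Qed.

Lemma coproj_ip_le k x : ip Q (x *m coproj Q k) x <= ip Q x x.
Proof.
rewrite mul_coproj ipBl gerDl oppr_le0.
have -> : ip Q (x *m oproj Q k) x = ip Q (x *m oproj Q k) (x *m oproj Q k).
  by rewrite -[RHS](oproj_sym hQ) (oproj_id hQ (oproj_mem hQ k x)).
exact: ip_ge0.
Qed.

Lemma support_extremal u (T : pred {vspace 'rV[R]_n}) : chain_weights u ->
  (exists2 k, k \in s & T k && (u k != 0)) ->
  (exists l, [/\ l \in s, T l, u l != 0 &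
    forall k, k \in s -> T k -> u k != 0 -> (l <= k)%VS]) /\
  (exists l, [/\ l \in s, T l, u l != 0 &
    forall k, k \in s -> T k -> u k != 0 -> (k <= l)%VS]).
Proof.
move=> [_ ch] [k0 k0s /andP[Tk0 uk0]].
pose ok m := has (fun k => [&& T k, u k != 0 & \dim k == m]) s.
have okP k : k \in s -> T k -> u k != 0 -> ok (\dim k).
  by move=> ks Tk uk; apply/hasP; exists k => //; rewrite Tk uk eqxx.
have ex : exists m, ok m by exists (\dim k0); exact: okP.
have bd m : ok m -> (m <= n)%N.
  move=> /hasP[l _ /and3P[_ _ /eqP <-]].
  by have := dimvS (subvf l); rewrite dimvf /dim /= mul1n.
split.
  case: (ex_minnP ex) => m /hasP[l ls /and3P[Tl ul /eqP <-]] minm.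
  exists l; split=> // k ks Tk uk; have /orP[//|kl] := ch l k ls ks ul uk.
  by have /eqP -> : k == l by rewrite eqEdim kl minm ?okP.
case: (ex_maxnP ex bd) => m /hasP[l ls /and3P[Tl ul /eqP <-]] maxm.
exists l; split=> // k ks Tk uk; have /orP[lk|//] := ch l k ls ks ul uk.
by have /eqP -> : l == k by rewrite eqEdim lk maxm ?okP.
Qed.

Lemma level_ge0 u l : chain_weights u -> 0 <= level u l.
Proof. by move=> [u0 _]; rewrite /level big_seq_cond sumr_ge0// => k /andP[/u0]. Qed.

(** Let [g] be the largest member of the support not containing [l], and [y] the part orthogonal to
    [g] of some [x] in [l] outside [g]. Members that do not contain [l] lie in [g], so their
    coprojections fix [y]; the others contain [g] and [x], and kill [y]. *)
Lemma level_eigen u l : chain_weights u -> 0 < level u l ->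
  exists y x, [/\ x \in l, y *m weighted_op u = level u l *: y & 0 < ip Q y x].
Proof.
move=> cu D0.
have [|_ [g [gs lg ug gmax]]] := @support_extremal u (fun k => ~~ (l <= k)%VS) cu.
  apply: contrapT => /forall2NP h; move: D0; rewrite /level big_seq_cond big1 ?ltxx// => k /andP[ks lk].
  by have [//|/negP] := h k; rewrite lk /= negbK => /eqP.
have [x xl xg] : exists2 x, x \in l & x \notin g.
  by apply/subvPn.
pose y := x *m coproj Q g.
have yE : y = x - x *m oproj Q g by rewrite /y mul_coproj.
exists y, x; split=> //.
- rewrite mul_weighted_op (bigID (fun k => ~~ (l <= k)%VS)) /= [X in _ + X]big_seq_cond.
  rewrite [X in _ + X]big1 ?addr0; last first.
    move=> k /andP[ks /negPn lk]; have [->|uk] := eqVneq (u k) 0; first by rewrite scale0r.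
    have gk : (g <= k)%VS.
      have /orP[//|kg] := cu.2 g k gs ks ug uk.
      by move: lg; rewrite (subv_trans lk kg).
    have xk : x \in k by exact: (subvP lk).
    have pk : x *m oproj Q g \in k by apply: (subvP gk); exact: (oproj_mem hQ).
    by rewrite (coproj_kill hQ) ?scaler0// yE rpredB.
  rewrite /level scaler_suml big_seq_cond [RHS]big_seq_cond; apply: eq_bigr => k /andP[ks lk].
  have [->|uk] := eqVneq (u k) 0; first by rewrite !scale0r.
  have kg := gmax k ks lk uk.
  rewrite mul_coproj (oproj_perp hQ) ?subr0// => w wk.
  by rewrite yE (oproj_orth hQ)// (subvP kg).
- have -> : ip Q y x = ip Q y y.
    by rewrite {3}yE ipBr// [X in _ - X](_ : _ = 0) ?subr0// yE (oproj_orth hQ)// (oproj_mem hQ).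
  apply: hQ.2; apply: contra xg => /eqP y0.
  have -> : x = x *m oproj Q g by apply/eqP; rewrite -subr_eq0 -yE y0.
  exact: (oproj_mem hQ).
Qed.

(** Levels depend on the operator only. If [level v l] were larger, it would be an eigenvalue with
    an eigenvector [y] not orthogonal to [l], while on an invariant subspace [f] containing [l] the
    operator is bounded by [level u l]. Projecting [y] to [f] would give 0. *)
Lemma level_le_of_op u v l : chain_weights u -> chain_weights v ->
  weighted_op u = weighted_op v -> level v l <= level u l.
Proof.
move=> cu cv uv; rewrite leNgt; apply/negP => lt.
have [y [x [xl yv yx]]] := level_eigen cv (le_lt_trans (level_ge0 l cu) lt).
have sup f : (forall k, k \in s -> (l <= k)%VS -> u k != 0 -> (f <= k)%VS) ->
    forall w, w \in f -> ip Q (w *m weighted_op u) w <= level u l * ip Q w w.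
  move=> hf w wf; rewrite mul_weighted_op ip_suml /level mulr_suml [leRHS]big_seq_cond.
  rewrite (bigID (fun k => ~~ (l <= k)%VS)) /= [X in _ + X]big_seq_cond.
  rewrite [X in _ + X]big1 ?addr0; last first.
    move=> k /andP[ks /negPn lk]; have [->|uk] := eqVneq (u k) 0; first by rewrite scale0r ip0l.
    by rewrite (coproj_kill hQ) ?scaler0 ?ip0l// (subvP (hf k ks lk uk)).
  rewrite big_seq_cond; apply: ler_sum => k /andP[ks _].
  by rewrite ipZl ler_wpM2l ?coproj_ip_le//; apply: cu.1.
(* [f] is the smallest member of the support that contains [l], or the whole space if there is
   none. *)
have [f [lf fsup finv]] : exists f, [/\ (l <= f)%VS,
    (forall w, w \in f -> ip Q (w *m weighted_op u) w <= level u l * ip Q w w) &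
    (forall w, w \in f -> w *m weighted_op u \in f)].
  have [ex|nex] := pselect (exists2 k, k \in s & (l <= k)%VS && (u k != 0)).
    have [[f [fs lf uf fmin]] _] := support_extremal (T := fun k => (l <= k)%VS) cu ex.
    exists f; split=> // w wf; first by apply: sup wf => k ks lk uk; exact: fmin.
    rewrite mul_weighted_op big_seq; apply: rpred_sum => k ks.
    have [->|uk] := eqVneq (u k) 0; first by rewrite scale0r mem0v.
    apply: rpredZ; have /orP[fk|kf] := cu.2 f k fs ks uf uk.
      by rewrite (coproj_kill hQ) ?mem0v// (subvP fk).
    by rewrite mul_coproj rpredB// (subvP kf)// (oproj_mem hQ).
  exists fullv; split=> [|w _|w _]; rewrite ?subvf ?memvf//.
  by apply: (sup fullv) (memvf w) => k ks lk uk; case: nex; exists k; rewrite // lk uk.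
set A := weighted_op u in uv fsup finv; rewrite -uv in yv.
have sA : symmetric_op Q A.
  move=> w z; rewrite !mul_weighted_op ip_suml ip_sumr//; apply: eq_bigr => k _.
  by rewrite ipZl ipZr// (coproj_sym hQ).
have AP : A *m oproj Q f = oproj Q f *m A.
  apply: (oproj_commute hQ) => // w wp z zf.
  by rewrite sA; apply: wp; exact: finv.
pose p := y *m oproj Q f.
have pA : p *m A = level v l *: p by rewrite /p -mulmxA -AP mulmxA yv scalemxAl.
have pf : p \in f by exact: (oproj_mem hQ).
have p0 : p = 0.
  apply: (ip_eq0 hQ); apply/eqP; rewrite eq_le ip_ge0// andbT.
  have := fsup p pf; rewrite pA ipZl -subr_le0 -mulrBl pmulr_rle0// subr_gt0.
  exact: lt.
have : ip Q (y - p) x = 0 by apply: (oproj_orth hQ); exact: (subvP lf).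
by rewrite p0 subr0 => yx0; rewrite yx0 ltxx in yx.
Qed.

Lemma weight_sum_le u (T T' : pred {vspace 'rV[R]_n}) : chain_weights u ->
  (forall j, j \in s -> T j -> u j != 0 -> T' j) ->
  \sum_(j <- s | T j) u j <= \sum_(j <- s | T' j) u j.
Proof.
move=> cu TT; rewrite big_mkcond [leRHS]big_mkcond big_seq [leRHS]big_seq.
apply: ler_sum => j js; have uj := cu.1 j js.
case: ifPn => [Tj|_]; last by case: ifP.
have [->|uj0] := eqVneq (u j) 0; first by case: ifP.
by rewrite (TT j js Tj uj0).
Qed.

(** This sum runs over the members that do not strictly contain [k]: it is the level just above [k]
    in the chain. *)
Lemma level_succ u k : k \in s ->
  level u k + u k = \sum_(j <- s | ~~ (k <= j)%VS || (j == k)) u j.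
Proof.
move=> ks; rewrite [RHS](bigID (fun j => j == k)) /= [LHS]addrC; congr (_ + _).
  rewrite [RHS]big_mkcond (bigD1_seq k)//= subvv eqxx /= big1 ?addr0// => j /negbTE ->.
  by rewrite andbF.
apply: eq_bigl => j; case: eqP => [->|_]; first by rewrite subvv.
by rewrite orbF andbT.
Qed.

Variable K : seq {vspace 'rV[R]_n}.
Hypotheses (KT : fullv \in K) (sK : forall k, (k \in s) = (k \in K) && (k != fullv)).

(** For [k] proper the default [d fullv] of the minimum is one of its terms, since [fullv] belongs
    to [K] and is not contained in [k]. *)
Definition gap_weight (d : {vspace 'rV[R]_n} -> R) k : R :=
  Num.max 0 (\big[Num.min/d fullv]_(l <- K | ~~ (l <= k)%VS) d l -
             \big[Num.max/0]_(l <- K | (l <= k)%VS) d l).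

(** Levels grow with the subspace, so the maximum is [level u k]. The minimum is at most the level
    of the next larger member of the support, or of [fullv], which is at most [level u k + u k]. *)
Lemma gap_weight_level u k : chain_weights u -> k \in s -> gap_weight (level u) k = u k.
Proof.
move=> cu ks; have /andP[kK kT] : (k \in K) && (k != fullv) by rewrite -sK.
have uk0 := cu.1 k ks.
rewrite /gap_weight; set m := \big[Num.min/_]_(l <- K | _) _; set M := \big[Num.max/_]_(l <- K | _) _.
have ME : M = level u k.
  apply/eqP; rewrite eq_le; apply/andP; split.
    rewrite /M; apply: bigmax_le => [|l lk]; first exact: level_ge0.
    rewrite /level [leRHS](bigID (fun j => ~~ (l <= j)%VS)) /=.
    rewrite [X in _ <= X + _](_ : _ = \sum_(j <- s | ~~ (l <= j)%VS) u j).
      by rewrite lerDl big_seq_cond sumr_ge0// => j /andP[/cu.1].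
    apply: eq_bigl => j; case: (boolP (l <= j)%VS) => lj; rewrite ?andbF ?andbT//.
    by apply: contra lj => kj; exact: subv_trans lk kj.
  by apply: le_bigmax_seq; rewrite // subvv.
have [l [lK lk lm]] : exists l, [/\ l \in K, ~~ (l <= k)%VS & level u l <= level u k + u k].
  pose T j := (k <= j)%VS && (j != k).
  have [ex|nex] := pselect (exists2 j, j \in s & T j && (u j != 0)).
    have [[l [ls /andP[kl lk] ul lmin]] _] := support_extremal cu ex.
    exists l; split; first by move: ls; rewrite sK => /andP[].
      by apply: contra lk => lk; rewrite eqEsubv lk kl.
    rewrite level_succ//; apply: weight_sum_le => // j js lj uj.
    have [->|jk] := eqVneq j k; first by rewrite orbT.
    rewrite orbF; apply: contra lj => kj; apply: lmin => //.
    by rewrite /T kj jk.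
  exists fullv; split=> //.
    by apply: contra kT => Tk; rewrite eqEsubv subvf Tk.
  rewrite level_succ//; apply: weight_sum_le => // j js _ uj.
  have [->|jk] := eqVneq j k; first by rewrite orbT.
  rewrite orbF; apply/negP => kj; apply: nex; exists j => //.
  by rewrite /T kj jk uj.
have mle : m <= level u k + u k.
  by apply: le_trans lm; exact: ge_bigmin_seq.
rewrite ME.
(* For zero weight the upper bound on [m] suffices, as the positive part returns 0. For nonzero
   weight, comparability of [k] with the support yields the reverse inequality. *)
have [u0|u0] := eqVneq (u k) 0.
  by rewrite max_l ?u0// subr_le0 (le_trans mle)// u0 addr0.
have mE : m = level u k + u k.
  apply/eqP; rewrite eq_le mle /=.
  have low j : ~~ (j <= k)%VS -> level u k + u k <= level u j.
    move=> jk; rewrite level_succ//; apply: weight_sum_le => // i is_.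
    move=> /orP[ki|/eqP->//] ui.
    have /orP[ki'|ik] := cu.2 k i ks is_ u0 ui; first by rewrite ki' in ki.
    by apply: contra jk => ji; exact: subv_trans ji ik.
  rewrite /m; apply: le_bigmin => [|j /low//]; apply: low.
  by apply: contra kT => Tk; rewrite eqEsubv subvf Tk.
by rewrite mE addrAC subrr add0r max_r.
Qed.

End Weights.

Lemma sum_support (T : eqType) (V : nmodType) (s t : seq T) (F : T -> V) :
  uniq s -> uniq t -> {subset t <= s} -> (forall k, k \in s -> k \notin t -> F k = 0) ->
  \sum_(k <- s) F k = \sum_(k <- t) F k.
Proof.
move=> us ut ts F0.
have pe : perm_eq t [seq k <- s | k \in t].
  apply: uniq_perm => //; first exact: filter_uniq.
  by move=> k; rewrite mem_filter; case: (boolP (k \in t)) => // /ts ->.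
rewrite [RHS](perm_big _ pe) big_filter [RHS]big_mkcond [LHS]big_seq [RHS]big_seq; apply: eq_bigr => k ks.
by case: ifPn => // /(F0 k ks).
Qed.

(** * The polyhedron in terms of weights *)

Section Polyhedron.
Variables (R : realType) (n : nat) (Q : 'M[R]_n).
Hypothesis hQ : inner_product Q.
Variable K : seq {vspace 'rV[R]_n}.
Implicit Types (k l : {vspace 'rV[R]_n}) (u : {vspace 'rV[R]_n} -> R).

Definition proper_members := undup (Ksharp K).
Local Notation s := proper_members.

Lemma proper_members_uniq : uniq s. Proof. exact: undup_uniq. Qed.

Lemma mem_proper_members k : (k \in s) = (k \in K) && (k != fullv).
Proof. by rewrite mem_undup mem_filter andbC. Qed.

Definition codim k : R := (n - \dim k)%:R.

Lemma codim_pos k : k \in s -> 0 < codim k.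
Proof. by rewrite mem_proper_members => /andP[_ /codim_gt0]; rewrite ltr0n. Qed.

(** [chibar] is [coproj] divided by the codimension, so [u k * codim k] is the barycentric
    coordinate at [k]; the condition says that the operator has trace 1. *)
Definition normalized u := \sum_(k <- s) u k * codim k = 1.

Lemma weighted_op_trace u : \tr (weighted_op Q s u) = \sum_(k <- s) u k * codim k.
Proof. by rewrite linear_sum; apply: eq_bigr => k _; rewrite linearZ /= coproj_trace. Qed.

Let lt_sub k l := (k <= l)%VS && (k != l).

Lemma lt_sub_trans : transitive lt_sub.
Proof.
move=> l k m /andP[kl kl'] /andP[lm lm']; rewrite /lt_sub (subv_trans kl lm) /=.
apply: contra lm' => /eqP km; rewrite eqEsubv lm /=.
by rewrite -km.
Qed.

Lemma support_chain u : chain_weights s u -> exists t, [/\ uniq t,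
  (forall k, (k \in t) = (k \in s) && (u k != 0)) & sorted lt_sub t].
Proof.
move=> [_ ch]; pose e k l := (\dim k <= \dim l)%N.
pose t := sort e [seq k <- s | u k != 0].
have ut : uniq t by rewrite sort_uniq filter_uniq// proper_members_uniq.
have mt k : (k \in t) = (k \in s) && (u k != 0) by rewrite mem_sort mem_filter andbC.
exists t; split=> //.
have et : transitive e by move=> a b c; exact: leq_trans.
have st : sorted e t by apply: sort_sorted => k l; exact: leq_total.
rewrite (sorted_pairwise lt_sub_trans).
have pe : pairwise e t by rewrite -(sorted_pairwise et).
have pu : pairwise [rel k l | k != l] t by rewrite -uniq_pairwise.
have pa : pairwise [rel k l | e k l && (k != l)] t by rewrite pairwise_relI pe.
apply: (@sub_in_pairwise _ [in t] _ _ _ _ _ pa); last exact/allP.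
move=> k l; rewrite /= !mt => /andP[ks uk] /andP[ls ul] /andP[kl ne].
rewrite /lt_sub ne andbT; have /orP[//|lk] := ch k l ks ls uk ul.
by have /eqP -> : l == k by rewrite eqEdim lk; exact: kl.
Qed.

Lemma polyhedronP A : polyhedron Q K A <->
  exists u, [/\ chain_weights s u, normalized u & A = weighted_op Q s u].
Proof.
have us := proper_members_uniq.
split.
  move=> [phi [phi0 phiK phis] [w [w0 w1 ->]]].
  have tr' : transitive (fun k l => lt_sub l k).
    by move=> l k m h1 h2; exact: lt_sub_trans h2 h1.
  have pw : pairwise (fun k l => lt_sub l k) phi by rewrite -(sorted_pairwise tr').
  have uphi : uniq phi.
    by apply: sorted_uniq phis; [exact: tr'|move=> k; rewrite eqxx andbF].
  have phis' : {subset phi <= s} by move=> k /phiK; rewrite mem_undup.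
  (* Extends the barycentric coordinates by 0: for [k] outside [phi] the index equals the size and
     [insub] fails. *)
  pose W k := oapp w 0 (insub (index k phi)).
  have WE (i : 'I_(size phi)) : W (nth 0%VS phi i) = w i.
    by rewrite /W index_uniq// valK.
  have W0 k : k \notin phi -> W k = 0.
    by rewrite -index_mem => h; rewrite /W insubN.
  have sumW (V : nmodType) (F : R -> {vspace 'rV[R]_n} -> V) :
      \sum_(i < size phi) F (w i) (nth 0%VS phi i) = \sum_(k <- phi) F (W k) k.
    by rewrite (big_nth 0%VS) big_mkord; apply: eq_bigr => i _; rewrite WE.
  exists (fun k => W k / codim k); split.
  - split=> [k ks|k l _ _].
      apply: divr_ge0; last exact: ltW (codim_pos ks).
      by rewrite /W; case: insub => //= i; exact: w0.
    rewrite !mulf_eq0 !negb_or => /andP[Wk _] /andP[Wl _].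
    have kp : k \in phi by apply: contraNT Wk => /W0 ->.
    have lp : l \in phi by apply: contraNT Wl => /W0 ->.
    have /(pairwiseP 0%VS) hp := pw.
    case: (ltngtP (index k phi) (index l phi)) => [kl|lk|kl].
    - have := hp _ _ _ _ kl; rewrite !inE !index_mem !nth_index// => /(_ kp lp)/andP[-> _].
      by rewrite orbT.
    - by have := hp _ _ _ _ lk; rewrite !inE !index_mem !nth_index// => /(_ lp kp)/andP[-> _].
    - by rewrite -(nth_index 0%VS kp) kl nth_index// subvv.
  - rewrite /normalized (sum_support us uphi)//; last first.
      by move=> k _ /W0 ->; rewrite !mul0r.
    rewrite big_seq (eq_bigr W) => [|k kp]; last first.
      by rewrite divfK// gt_eqF// codim_pos// phis'.
    by rewrite -big_seq -(sumW _ (fun a _ => a)).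
  - rewrite (sumW _ (fun a k => a *: chibar Q k)) /weighted_op (sum_support us uphi)//; last first.
      by move=> k _ /W0 ->; rewrite mul0r scale0r.
    by apply: eq_bigr => k _; rewrite chibarE scalerA.
move=> [u [cu nu ->]]; have [t [ut mt st]] := support_chain cu.
have ts : {subset t <= s} by move=> k; rewrite mt => /andP[].
have u0 k : k \in s -> k \notin t -> u k = 0.
  by move=> ks; rewrite mt ks /= negbK => /eqP.
have t0 : (0 < size t)%N.
  rewrite lt0n; apply/eqP => /size0nil t0; move: nu; rewrite /normalized.
  rewrite big_seq big1 => [/eqP|k ks]; first by rewrite eq_sym oner_eq0.
  by rewrite u0 ?t0// mul0r.
exists (rev t); first split.
- by rewrite size_rev.
- by move=> k; rewrite mem_rev => /ts; rewrite mem_undup.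
- by rewrite rev_sorted.
have ru : uniq (rev t) by rewrite rev_uniq.
have rs : {subset rev t <= s} by move=> k; rewrite mem_rev => /ts.
exists (fun i => u (nth 0%VS (rev t) i) * codim (nth 0%VS (rev t) i)); split.
- move=> i; have ks : nth 0%VS (rev t) i \in s by apply: rs; exact: mem_nth.
  by rewrite mulr_ge0// ?(ltW (codim_pos ks))//; exact: cu.1.
- rewrite -nu (sum_support us ru)// => [|k ks]; last first.
    by rewrite mem_rev => /(u0 k ks) ->; rewrite mul0r.
  by rewrite (big_nth 0%VS) big_mkord.
- rewrite /weighted_op (sum_support us ru)// => [|k ks]; last first.
    by rewrite mem_rev => /(u0 k ks) ->; rewrite scale0r.
  rewrite (big_nth 0%VS) big_mkord; apply: eq_bigr => i _.
  rewrite chibarE scalerA mulfK// gt_eqF// codim_pos// rs// mem_nth//.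
Qed.

Variables (br : 'rV[R]_n -> 'rV[R]_n -> 'rV[R]_n) (cA : set 'M[R]_n) (h : {vspace 'rV[R]_n}).
Hypotheses (hL : compact_lie_algebra br Q) (hA : compact_aut_group br Q h cA).
Hypothesis hK : forall k, k \in K -> subalgebra br k /\ A_invariant cA k.

(** Terms are added from the largest subalgebra down: the sum over the members above [k] kills [k],
    so [filtering_coneD] can add the multiple of [coproj Q k]. *)
Lemma weighted_op_cone u m : chain_weights s u ->
  (forall k, k \in s -> u k != 0 -> (m <= k)%VS) ->
  filtering_cone br Q cA m (weighted_op Q s u).
Proof.
move=> cu mu; have [t [ut mt st]] := support_chain cu.
have ts : {subset t <= s} by move=> k; rewrite mt => /andP[].
rewrite /weighted_op (sum_support proper_members_uniq ut ts); last first.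
  by move=> k ks; rewrite mt ks /= negbK => /eqP ->; rewrite scale0r.
have {mu}mt' k : k \in t -> (m <= k)%VS by rewrite mt => /andP[/mu]; apply.
elim: t m ts st mt' {mt ut} => [|k t IH] m ts st mt.
  by rewrite big_nil; exact: filtering_cone0.
have ks : k \in s by apply: ts; rewrite mem_head.
have /hK[sk ik] : k \in K by move: ks; rewrite mem_proper_members => /andP[].
rewrite big_cons addrC; apply: (filtering_cone_le (mt k (mem_head _ _))).
apply: (filtering_coneD hL hA) => //; first exact: cu.1.
apply: IH.
- by move=> j jt; apply: ts; rewrite in_cons jt orbT.
- exact: path_sorted st.
- move=> j jt; move: st; rewrite /= (path_sortedE lt_sub_trans) => /andP[/allP/(_ j jt)].
  by move=> /andP[].
Qed.

End Polyhedron.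

Lemma big_continuous (S T : topologicalType) (I : Type) (op : T -> T -> T)
    (z : S -> T) (F : I -> S -> T) (r : seq I) (P : pred I) :
  (forall f g : S -> T, continuous f -> continuous g ->
     continuous (fun x => op (f x) (g x))) ->
  continuous z -> (forall i, P i -> continuous (F i)) ->
  continuous (fun x => \big[op/z x]_(i <- r | P i) F i x).
Proof.
move=> cop cz cF; elim: r => [|i r IH].
  have -> : (fun x => \big[op/z x]_(i <- [::] | P i) F i x) = z.
    by apply/funext => x; rewrite big_nil.
  exact: cz.
have [Pi|Pi] := boolP (P i).
  have -> : (fun x => \big[op/z x]_(i <- i :: r | P i) F i x) =
      (fun x => op (F i x) (\big[op/z x]_(i <- r | P i) F i x)).
    by apply/funext => x; rewrite big_cons Pi.
  by apply: cop => //; exact: cF.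
have -> : (fun x => \big[op/z x]_(i <- i :: r | P i) F i x) =
    (fun x => \big[op/z x]_(i <- r | P i) F i x).
  by apply/funext => x; rewrite big_cons (negbTE Pi).
exact: IH.
Qed.

Lemma sum_continuous (R : realType) (S : topologicalType) (V : pseudoMetricNormedZmodType R) (I : Type)
    (F : I -> S -> V) (r : seq I) (P : pred I) :
  (forall i, P i -> continuous (F i)) ->
  continuous (fun x => \sum_(i <- r | P i) F i x).
Proof.
move=> cF; apply: (@big_continuous S V I +%R (fun=> 0)) => //.
  by move=> f g cf cg x; apply: cvgD; [exact: cf|exact: cg].
by move=> x; exact: cvg_cst.
Qed.

(** * Partial traces, a continuous test for killing a subspace *)

Section TraceForm.
Variables (R : realType) (n : nat) (Q : 'M[R]_n).
Hypothesis hQ : inner_product Q.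
Implicit Types (A : 'M[R]_n) (k l : {vspace 'rV[R]_n}).

Definition partial_trace l A : R := \tr (oproj Q l *m A).

Lemma partial_trace_sum l A : symmetric_op Q A -> exists2 U : 'M[R]_n,
  U *m Q *m U^T = 1%:M & partial_trace l A =
    \sum_i ip Q (row i U *m oproj Q l *m A) (row i U *m oproj Q l).
Proof.
move=> sA; have [U hU] := orthonormal_basis hQ; exists U => //.
have PP : oproj Q l *m oproj Q l = oproj Q l.
  by apply: mulmx_ext => x; rewrite mulmxA (oproj_id hQ)// (oproj_mem hQ).
pose B := oproj Q l *m A *m oproj Q l.
have -> : partial_trace l A = \tr B by rewrite /B mxtrace_mulC mulmxA PP.
rewrite -[B]mulmx1 -(orthonormalK hU) !mulmxA mxtrace_mulC /mxtrace.
apply: eq_bigr => i _; rewrite -(oproj_sym hQ) /B /ip -!row_mul !mulmxA.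
by rewrite [RHS]mxE [LHS]mxE [RHS]mxE; apply: eq_bigr => j _; rewrite !mxE.
Qed.

Lemma partial_trace_ge0 l A : symmetric_op Q A -> (forall x, 0 <= ip Q (x *m A) x) ->
  0 <= partial_trace l A.
Proof. by move=> sA pA; have [U _ ->] := partial_trace_sum l sA; apply: sumr_ge0. Qed.

Lemma partial_trace_eq0 l A : symmetric_op Q A -> (forall x, 0 <= ip Q (x *m A) x) ->
  (partial_trace l A == 0) = `[< forall x, x \in l -> x *m A = 0 >].
Proof.
move=> sA pA; apply/idP/asboolP => [/eqP|lA]; last first.
  rewrite /partial_trace [X in \tr X](_ : _ = 0) ?mxtrace0//.
  by apply: mulmx_ext => x; rewrite mulmx0 mulmxA lA// (oproj_mem hQ).
have [U hU ->] := partial_trace_sum l sA => /eqP; rewrite psumr_eq0// => /allP h x xl.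
rewrite -(oproj_id hQ xl) (orthonormal_expand x hU) !mulmx_suml big1// => i _.
rewrite -!scalemxAl (psd_kernel hQ sA pA) ?scaler0//.
by apply/eqP/h; rewrite mem_index_enum.
Qed.

Lemma partial_trace_continuous l : continuous (partial_trace l).
Proof.
have -> : partial_trace l = fun A : 'M[R]_n => \sum_i \sum_j oproj Q l i j * A j i.
  by apply/funext => A; apply: eq_bigr => i _; rewrite mxE.
apply: sum_continuous => i _; apply: sum_continuous => j _ A.
apply: (@cvgM R _ (nbhs A) _ (fun=> oproj Q l i j) (fun B : 'M[R]_n => B j i)); first exact: cvg_cst.
exact: (@coord_continuous R n n j i A).
Qed.

Lemma partial_trace_weighted s u l : partial_trace l (weighted_op Q s u) =
  \sum_(k <- s) u k * partial_trace l (coproj Q k).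
Proof.
rewrite /partial_trace mulmx_sumr linear_sum; apply: eq_bigr => k _.
by rewrite -scalemxAr linearZ.
Qed.

Lemma partial_trace_coproj_gt0 l k : (0 < partial_trace l (coproj Q k)) = ~~ (l <= k)%VS.
Proof.
have sC := coproj_sym hQ k; have pC := coproj_psd hQ k.
rewrite lt0r partial_trace_ge0// andbT partial_trace_eq0//; congr (~~ _).
apply/asboolP/subvP => [h x xl|lk x xl]; last by rewrite (coproj_kill hQ)// lk.
have /eqP := h x xl; rewrite mul_coproj subr_eq0 => /eqP ->.
exact: (oproj_mem hQ).
Qed.

(** Both quantities are combinations, with positive coefficients, of the weights of the members not
    containing [l], hence comparable up to a constant independent of the weights. *)
Lemma partial_trace_level (s : seq {vspace 'rV[R]_n}) l :
  exists2 M : R, 1 <= M & forall u, chain_weights s u ->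
    partial_trace l (weighted_op Q s u) <= M * level s u l /\
    level s u l <= M * partial_trace l (weighted_op Q s u).
Proof.
pose c k := partial_trace l (coproj Q k).
have c0 k : 0 <= c k by apply: partial_trace_ge0; [exact: coproj_sym|exact: coproj_psd].
(* The inverse of 0 is 0, so members containing [l], where [c k = 0], contribute nothing. *)
pose M := 1 + \sum_(k <- s) (c k + (c k)^-1).
have cM k : k \in s -> c k + (c k)^-1 <= M.
  move=> ks; rewrite /M (big_rem k ks) /= addrCA lerDl addr_ge0//.
  by apply: sumr_ge0 => j _; rewrite addr_ge0// invr_ge0.
have M1 : 1 <= M by rewrite lerDl sumr_ge0// => j _; rewrite addr_ge0// invr_ge0.
exists M => // u [u0 _]; rewrite partial_trace_weighted.
rewrite [level s u l]big_mkcond /= !mulr_sumr.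
split; rewrite big_seq [leRHS]big_seq; apply: ler_sum => k ks; rewrite -/(c k); have uk := u0 k ks.
- have [lk|lk] := boolP (l <= k)%VS.
    have := partial_trace_coproj_gt0 l k; rewrite lk /= -/(c k) lt0r c0 andbT => /negbFE/eqP ->.
    by rewrite !mulr0.
  rewrite mulrC ler_wpM2r// (le_trans _ (cM k ks))// lerDl invr_ge0//.
- case: ifPn => [lk|_]; last by rewrite mulr_ge0 ?mulr_ge0// (le_trans ler01).
  have ck : 0 < c k by rewrite partial_trace_coproj_gt0.
  rewrite mulrCA ler_peMr// -(@mulVf _ (c k)) ?gt_eqF// ler_wpM2r//.
  by rewrite (le_trans _ (cM k ks))// lerDr.
Qed.

End TraceForm.

(** * Compactness of the polyhedron and continuity of its weights *)

Section WeightCoordinates.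
Variables (R : realType) (n : nat) (Q : 'M[R]_n).
Hypothesis hQ : inner_product Q.
Variable K : seq {vspace 'rV[R]_n}.
Hypothesis KT : fullv \in K.
Implicit Types (k l : {vspace 'rV[R]_n}) (u : {vspace 'rV[R]_n} -> R).
Local Notation s := (proper_members K).

Definition weight_of (x : 'rV[R]_(size s)) k : R :=
  if insub (index k s) is Some i then x 0 i else 0.

Lemma weight_of_continuous k : continuous (weight_of^~ k).
Proof.
rewrite /weight_of; case: insub => [i|]; last exact: cst_continuous.
move=> x; exact: (@coord_continuous R 1 (size s) 0 i x).
Qed.

Lemma weight_of_nth x (i : 'I_(size s)) : weight_of x (nth 0%VS s i) = x 0 i.
Proof. by rewrite /weight_of index_uniq ?proper_members_uniq// valK. Qed.

Lemma weight_of_row u k : k \in s ->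
  weight_of (\row_i u (nth 0%VS s i)) k = u k.
Proof.
move=> ks.
rewrite -[in LHS](nth_index 0%VS ks).
have hk : (index k s < size s)%N by rewrite index_mem.
by rewrite (weight_of_nth _ (Ordinal hk)) mxE /= nth_index.
Qed.

Definition weight_polytope : set 'rV[R]_(size s) :=
  [set x | chain_weights s (weight_of x) /\ normalized K (weight_of x)].

Lemma weight_polytope_cube : weight_polytope `<=` cube 1.
Proof.
move=> x [[x0 _] nx] i; set k := nth 0%VS s i.
have ks : k \in s by exact: mem_nth.
have cd : 1 <= codim k :> R.
  by rewrite ler1n; move: ks; rewrite mem_proper_members => /andP[_ /codim_gt0].
rewrite -(weight_of_nth x i) -/k ger0_norm ?x0// -nx (big_rem k ks) /=.
rewrite (le_trans (ler_peMr (x0 k ks) cd))// lerDl big_seq sumr_ge0// => j /mem_rem js.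
by rewrite mulr_ge0 ?x0// ltW// codim_pos.
Qed.

Lemma weight_polytope_compact : compact weight_polytope.
Proof.
apply: (subclosed_compact _ (@cube_compact R _ 1) weight_polytope_cube).
(* Comparability on the support becomes a closed condition: the product of the weights vanishes at
   every incomparable pair. *)
have -> : weight_polytope = \bigcap_(k in [set` s]) ((weight_of^~ k) @^-1` [set t | 0 <= t])
   `&` \bigcap_(p in [set p | [/\ p.1 \in s, p.2 \in s & ~~ ((p.1 <= p.2)%VS || (p.2 <= p.1)%VS)]])
        ((fun x => weight_of x p.1 * weight_of x p.2) @^-1` [set t | t = 0])
   `&` (fun x => \sum_(k <- s) weight_of x k * codim k) @^-1` [set t | t = 1].
  apply/seteqP; split=> x.
    move=> [[x0 ch] nx]; split=> //; split=> // -[k l] /= [ks ls kl].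
    apply/eqP; rewrite mulf_eq0; apply: contraR kl; rewrite negb_or => /andP[xk xl].
    exact: ch.
  move=> [[x0 ch] nx]; split=> //; split=> // k l ks ls xk xl.
  apply: contraT => kl; have /= /eqP := ch (k, l) (And3 ks ls kl).
  by rewrite mulf_eq0 (negbTE xk) (negbTE xl).
have cw := weight_of_continuous.
apply: closedI; first apply: closedI.
- apply: closed_bigI => k _; apply: closed_comp => [x _|]; [exact: cw|exact: closed_ge].
- apply: closed_bigI => p _; apply: closed_comp => [x _|]; last exact: closed_eq.
  by apply: (@cvgM R _ (nbhs x) _ (weight_of^~ p.1) (weight_of^~ p.2)); exact: cw.
- apply: closed_comp => [x _|]; last exact: closed_eq.
  move: x; apply: sum_continuous => k _ x.
  by apply: (@cvgM R _ (nbhs x) _ (weight_of^~ k) (fun=> codim k)); [exact: cw|exact: cvg_cst].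
Qed.

Lemma weighted_op_continuous : continuous (fun x => weighted_op Q s (weight_of x)).
Proof.
apply: sum_continuous => k _ x; apply: continuousZr_tmp; exact: weight_of_continuous.
Qed.

Lemma weighted_op_inj x y : weight_polytope x -> weight_polytope y ->
  weighted_op Q s (weight_of x) = weighted_op Q s (weight_of y) -> x = y.
Proof.
move=> [cx _] [cy _] xy; apply/rowP => i; rewrite -!weight_of_nth; set k := nth 0%VS s i.
have ks : k \in s by exact: mem_nth.
have us := proper_members_uniq K; have sK := @mem_proper_members R n K.
rewrite -(gap_weight_level us KT sK cx ks) -(gap_weight_level us KT sK cy ks).
congr gap_weight; apply/funext => l; apply/eqP; rewrite eq_le.
by rewrite !(level_le_of_op hQ).
Qed.

Lemma polyhedron_image :
  polyhedron Q K = (fun x => weighted_op Q s (weight_of x)) @` weight_polytope.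
Proof.
apply/seteqP; split=> A.
  move=> /polyhedronP[u [[u0 ch] nu ->]]; exists (\row_i u (nth 0%VS s i)).
    split; first split=> [k ks|k l ks ls]; rewrite ?weight_of_row//; [exact: u0|exact: ch|].
    rewrite /normalized -nu big_seq [RHS]big_seq; apply: eq_bigr => k ks.
    by rewrite weight_of_row.
  rewrite /weighted_op big_seq [RHS]big_seq; apply: eq_bigr => k ks.
  by rewrite weight_of_row.
by move=> [x [cx nx] <-]; apply/polyhedronP; exists (weight_of x).
Qed.

Lemma polyhedron_compact : compact (polyhedron Q K).
Proof.
rewrite polyhedron_image; apply: continuous_compact; last exact: weight_polytope_compact.
exact/continuous_subspaceT/weighted_op_continuous.
Qed.

(** Weights are determined by the operator, so they are continuous on the polyhedron by compactness;
    Tietze extends them to all operators, where they may lose their sign and chain conditions. *)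
Lemma polyhedron_weights : exists2 w : 'M[R]_n -> 'rV[R]_(size s), continuous w &
  forall x, weight_polytope x -> w (weighted_op Q s (weight_of x)) = x.
Proof.
pose phi x := weighted_op Q s (weight_of x).
pose psi A := xget 0 [set x | weight_polytope x /\ phi x = A].
have psiK x : weight_polytope x -> psi (phi x) = x.
  move=> Px; have [Py yx] : [set y | weight_polytope y /\ phi y = phi x] (psi (phi x)).
    by apply: xgetPex; exists x.
  exact: weighted_op_inj.
have hM : hausdorff_space 'M[R]_n by exact: norm_hausdorff.
have cpsi : {within polyhedron Q K, continuous psi}.
  rewrite polyhedron_image; apply: compact_inverse_continuous => //.
    exact: weight_polytope_compact.
  exact/continuous_subspaceT/weighted_op_continuous.
have [|w cw hw] := tietze_row (M := 1) (compact_closed hM polyhedron_compact) cpsi.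
  by rewrite polyhedron_image => A [x Px <-]; rewrite psiK//; exact: weight_polytope_cube.
exists w => // x Px; rewrite hw ?psiK// polyhedron_image; exists x => //.
Qed.

End WeightCoordinates.

(** * Gap weights of arbitrary level functions *)

Section GapWeights.
Variables (R : realType) (n : nat) (K : seq {vspace 'rV[R]_n}).
Implicit Types (k l : {vspace 'rV[R]_n}) (d : {vspace 'rV[R]_n} -> R).

Lemma gap_weight_ge0 d k : 0 <= gap_weight K d k.
Proof. by rewrite le_max lexx. Qed.

Lemma gap_weight_lt d k l : gap_weight K d k != 0 -> k \in K -> l \in K ->
  ~~ (l <= k)%VS -> Num.max 0 (d k) < d l.
Proof.
move=> g0 kK lK lk; have : 0 < gap_weight K d k by rewrite lt0r g0 gap_weight_ge0.
rewrite lt_max ltxx /= subr_gt0 => h.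
apply: (le_lt_trans _ (lt_le_trans h _)); last exact: ge_bigmin_seq.
rewrite ge_max bigmax_ge_id /=; apply: le_bigmax_seq; rewrite ?subvv//.
Qed.

(** Incomparable [k] and [l] of nonzero weight would give both [d k < d l] and [d l < d k], whatever
    the function [d]. *)
Lemma gap_weight_chain d : chain_weights (proper_members K) (gap_weight K d).
Proof.
split=> [k _|k l]; first exact: gap_weight_ge0.
rewrite !mem_proper_members => /andP[kK _] /andP[lK _] gk gl.
apply: contraT; rewrite negb_or => /andP[kl lk].
have := gap_weight_lt gk kK lK lk; have := gap_weight_lt gl lK kK kl.
by rewrite !gt_max => /andP[_ h1] /andP[_ /(lt_trans h1)]; rewrite ltxx.
Qed.

Lemma gap_weight_gt0 d k : k != fullv -> (forall l, l \in K -> (l <= k)%VS -> d l <= 0) ->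
  (forall l, l = fullv \/ l \in K -> ~~ (l <= k)%VS -> 0 < d l) -> 0 < gap_weight K d k.
Proof.
move=> kT dle dgt; rewrite lt_max ltxx /= subr_gt0.
have Tk : ~~ (fullv <= k)%VS by apply: contra kT => Tk; rewrite eqEsubv subvf Tk.
apply: (@le_lt_trans _ _ 0).
  by rewrite big_seq_cond; apply: bigmax_le => // l /andP[]; exact: dle.
rewrite big_seq_cond; apply: lt_bigmin => [|l /andP[lK]]; apply: dgt; rewrite ?Tk//.
  by left.
by right.
Qed.

Lemma gap_weight_continuous (S : topologicalType) (d : S -> {vspace 'rV[R]_n} -> R) k :
  (forall l, continuous (d^~ l)) -> continuous (fun A => gap_weight K (d A) k).
Proof.
move=> cd; have cmax (f g : S -> R) : continuous f -> continuous g ->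
  continuous (fun x => Num.max (f x) (g x)) by exact: max_fun_continuous.
have cmin (f g : S -> R) : continuous f -> continuous g ->
  continuous (fun x => Num.min (f x) (g x)) by exact: min_fun_continuous.
apply: (cmax (fun=> 0)); first exact: cst_continuous.
move=> A; apply: cvgB; move: A.
  by apply: (big_continuous (z := fun A => d A fullv)) => // l _; exact: cd.
by apply: (big_continuous (z := fun=> 0)) => //; first exact: cst_continuous.
Qed.

End GapWeights.

(** * The retraction and the order of gluing *)

Section Retraction.
Variables (R : realType) (n : nat).
Variables (br : 'rV[R]_n -> 'rV[R]_n -> 'rV[R]_n) (Q : 'M[R]_n).
Variables (h : {vspace 'rV[R]_n}) (cA : set 'M[R]_n) (K : seq {vspace 'rV[R]_n}).
Hypotheses (hL : compact_lie_algebra br Q) (hA : compact_aut_group br Q h cA).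
Hypothesis hK : forall k, k \in K -> subalgebra br k /\ A_invariant cA k.
Hypothesis KT : fullv \in K.
Hypothesis hJ : forall k l, k \in K -> l \in K ->
  exists2 m, m \in K & is_join_subalgebra br k l m.
Let hQ : inner_product Q := hL.1.
Implicit Types (k l : {vspace 'rV[R]_n}) (A : 'M[R]_n).
Local Notation s := (proper_members K).
Local Notation X := (XK br Q cA K).
Local Notation Xk := (Xk br Q cA).

Lemma XKP A : X A <-> exists2 k, k \in s & Xk k A.
Proof. by split=> -[k ks Xk]; exists k; move: ks; rewrite ?mem_undup. Qed.

(** The join is killed by [A], and it is proper because an operator of trace 1 is not zero. *)
Lemma Xk_join k l A : k \in K -> l \in K -> filtering_cone br Q cA k A ->
  filtering_cone br Q cA l A -> \tr A = 1 ->
  exists m, [/\ m \in s, (k <= m)%VS, (l <= m)%VS & Xk m A].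
Proof.
move=> kK lK Ck Cl trA; have [m mK jm] := hJ kK lK; have [_ km lm _] := jm.
have Cm := filtering_cone_join hL jm Ck Cl.
exists m; split=> //; last exact/(XkE hL).
rewrite mem_proper_members mK; apply/eqP => mE.
move: trA; rewrite (_ : A = 0) ?mxtrace0 => [/esym/eqP|]; first by rewrite oner_eq0.
by apply: mulmx_ext => x; rewrite mulmx0; case: Cm => _ _ _ _; apply; rewrite mE memvf.
Qed.

(* The levels of the polyhedron extend continuously to all operators; squeezing
   the extension between multiples of [partial_trace l] makes it vanish exactly
   where the operator kills [l]. *)
Lemma level_extension : exists d : 'M[R]_n -> {vspace 'rV[R]_n} -> R,
  [/\ (forall l, continuous (d^~ l)),
      (forall A, polyhedron Q K A -> exists u, [/\ chain_weights s u, normalized K u,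
         A = weighted_op Q s u & d A =1 level s u]) &
      (forall A l, X A -> 0 <= d A l /\ (d A l = 0 <-> forall x, x \in l -> x *m A = 0))].
Proof.
have [w cw hw] := polyhedron_weights hQ KT.
have /choice[M hM] : forall l, exists M : R, 1 <= M /\ forall u, chain_weights s u ->
    partial_trace Q l (weighted_op Q s u) <= M * level s u l /\
    level s u l <= M * partial_trace Q l (weighted_op Q s u).
  by move=> l; have [M ? ?] := partial_trace_level hQ s l; exists M.
pose g A l := partial_trace Q l A.
have M0 l : 0 < M l by have [/(lt_le_trans ltr01)] := hM l.
pose d A l := Num.min (Num.max (level s (weight_of (w A)) l) ((M l)^-1 * g A l)) (M l * g A l).
exists d; split.
- move=> l; have cg c : continuous (fun A => c * g A l).
    move=> A; apply: (@cvgM R _ (nbhs A) _ (fun=> c) (g^~ l)); first exact: cvg_cst.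
    exact: partial_trace_continuous.
  apply: min_fun_continuous; last exact: cg.
  apply: max_fun_continuous; last exact: cg.
  apply: sum_continuous => k _.
  have ck : continuous ((@weight_of R n K)^~ k \o w).
    by move=> A; apply: continuous_comp; [exact: cw|exact: weight_of_continuous].
  exact: ck.
- move=> A; rewrite polyhedron_image => -[x Px <-]; exists (weight_of x).
  have [cx nx] := Px; split=> // l; rewrite /d hw//.
  have [_ /(_ _ cx)[h1 h2]] := hM l.
  have mx : Num.max (level s (weight_of x) l)
      ((M l)^-1 * g (weighted_op Q s (weight_of x)) l) = level s (weight_of x) l.
    by apply/max_idPl; rewrite mulrC ler_pdivrMr// mulrC.
  by rewrite mx; exact/min_idPl.
- move=> A l /XKP[k ks /XkE[//|[sA _ pA _ _] _]].
  have g0 : 0 <= g A l by exact: partial_trace_ge0.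
  have Mg : 0 <= (M l)^-1 * g A l by rewrite mulr_ge0// invr_ge0 ltW.
  have ge0 : 0 <= d A l.
    by rewrite /d le_min le_max Mg orbT /= mulr_ge0// ltW.
  split=> //; have := partial_trace_eq0 hQ l sA pA; rewrite -/(g A l) => gE.
  split=> [d0|/asboolP]; last first.
    rewrite -gE => /eqP g00; apply/eqP; rewrite eq_le ge0 andbT.
    by rewrite /d ge_min; apply/orP; right; rewrite g00 mulr0.
  apply/asboolP; rewrite -gE; apply: contraT => gn.
  have gp : 0 < g A l by rewrite lt0r gn.
  suff : 0 < d A l by rewrite d0 ltxx.
  by rewrite /d lt_min lt_max [X in _ || X]mulr_gt0 ?invr_gt0// orbT mulr_gt0.
Qed.

Lemma retraction_exists : exists r : 'M[R]_n -> 'M[R]_n,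
  [/\ {within X, continuous r}, (forall A, X A -> polyhedron Q K (r A)),
      (forall A, polyhedron Q K A -> r A = A) &
      (forall k A, k \in s -> Xk k A -> Xk k (r A))].
Proof.
have [d [cd dP dX]] := level_extension.
pose om A := \sum_(k <- s) gap_weight K (d A) k * codim k.
pose v A k := (om A)^-1 * gap_weight K (d A) k.
have om0 A : X A -> 0 < om A.
  move=> XA; have [k0 k0s Xk0] := (XKP A).1 XA.
  (* For [k] of largest dimension with [A] in [X[k]], any [l] killed by [A] has its join with [k]
     equal to [k]. So [d A] vanishes exactly on the members inside [k], and the gap at [k] is
     positive. *)
  pose ok m := `[< exists k, [/\ k \in s, Xk k A & \dim k = m] >].
  have ex : exists m, ok m by exists (\dim k0); apply/asboolP; exists k0.
  have bd m : ok m -> (m <= n)%N.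
    move=> /asboolP[l [_ _ <-]].
    by have := dimvS (subvf l); rewrite dimvf /dim /= mul1n.
  case: (ex_maxnP ex bd) => m /asboolP[k [ks Xkk dk]] maxm.
  have /andP[kK kT] : (k \in K) && (k != fullv) by rewrite -mem_proper_members.
  have [Ck trA] := (XkE hL cA k A).1 Xkk.
  have kill0 : forall x, x \in k -> x *m A = 0 by case: Ck.
  have gk : 0 < gap_weight K (d A) k.
    apply: gap_weight_gt0 => // l lK lk.
      by rewrite ((dX A l XA).2.2 _)// => x xl; rewrite kill0// (subvP lk).
    have {}lK : l \in K by case: lK => [->|].
    rewrite lt0r (dX A l XA).1 andbT; apply: contra lk => /eqP/(dX A l XA).2 lA.
    have Cl : filtering_cone br Q cA l A by case: Ck => sA fA pA cAA _; split.
    have [m' [ms km lm Xm]] := Xk_join kK lK Ck Cl trA.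
    have : (\dim m' <= m)%N by apply: maxm; apply/asboolP; exists m'.
    rewrite -dk => dm; have /eqP -> : k == m' by rewrite eqEdim km dm.
    exact: lm.
  rewrite /om (big_rem k ks) /=; apply: ltr_wpDr.
    rewrite big_seq sumr_ge0// => j /mem_rem js.
    by rewrite mulr_ge0 ?gap_weight_ge0// ltW// (codim_pos js).
  by rewrite mulr_gt0// (codim_pos ks).
have cv A : X A -> chain_weights s (v A).
  move=> XA; have [g0 gc] := gap_weight_chain K (d A); split=> [k ks|k l ks ls].
    by rewrite mulr_ge0 ?g0// invr_ge0 ltW ?om0.
  by rewrite !mulf_eq0 !negb_or => /andP[_ gk] /andP[_ gl]; exact: gc.
have nv A : X A -> normalized K (v A).
  move=> XA; rewrite /normalized; under eq_bigr do rewrite -mulrA.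
  by rewrite -mulr_sumr -/(om A) mulVf// gt_eqF// om0.
exists (fun A => weighted_op Q s (v A)); split.
- apply: continuous_in_subspaceT => A /set_mem XA.
  have cg k := @gap_weight_continuous R n K 'M[R]_n d k cd.
  have com : {for A, continuous om}.
    move: {XA} A; apply: sum_continuous => k _ A.
    by apply: (@cvgM R _ (nbhs A) _ (fun A => gap_weight K (d A) k) (fun=> codim k));
      [exact: cg|exact: cvg_cst].
  have -> : (fun B => weighted_op Q s (v B)) =
      (fun B => (om B)^-1 *: \sum_(k <- s) gap_weight K (d B) k *: coproj Q k).
    by apply/funext => B; rewrite scaler_sumr; apply: eq_bigr => k _; rewrite scalerA.
  apply: (@cvgZ _ _ _ (nbhs A) _ (fun B => (om B)^-1)).
    by apply: (@cvgV _ _ (nbhs A)) => //; rewrite gt_eqF// om0.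
  move: {XA com} A; apply: sum_continuous => k _ A.
  by apply: (@cvgZr_tmp _ _ _ (nbhs A) _ (fun B => gap_weight K (d B) k)); exact: cg.
- by move=> A XA; apply/polyhedronP; exists (v A); split; [exact: cv|exact: nv|].
- move=> A /dP[u [cu nu -> du]].
  have gu k : k \in s -> gap_weight K (d (weighted_op Q s u)) k = u k.
    move=> ks; rewrite (funext du); apply: gap_weight_level ks => //.
      exact: proper_members_uniq.
    exact: mem_proper_members.
  have om1 : om (weighted_op Q s u) = 1.
    by rewrite /om -nu big_seq [RHS]big_seq; apply: eq_bigr => k ks; rewrite gu.
  rewrite /weighted_op big_seq [RHS]big_seq; apply: eq_bigr => k ks.
  by rewrite /v -/(weighted_op Q s u) om1 invr1 mul1r gu.
- move=> k A ks XkA; have XA : X A by apply/XKP; exists k.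
  have [Ck trA] := (XkE hL cA k A).1 XkA.
  apply/(XkE hL); split; last by rewrite weighted_op_trace//; exact: nv.
  (* The pieces are preserved: a nonzero gap at [j] with [k] not inside [j] would force [d A k > 0],
     but [A] kills [k]. *)
  apply: (weighted_op_cone hL hA hK) => [|j js]; first exact: cv.
  rewrite mulf_eq0 negb_or => /andP[_ gj]; apply: contraT => kj.
  have jK : j \in K by move: js; rewrite mem_proper_members => /andP[].
  have kK : k \in K by move: ks; rewrite mem_proper_members => /andP[].
  have := gap_weight_lt gj jK kK kj; rewrite gt_max => /andP[+ _].
  by rewrite ((dX A k XA).2.2 _) ?ltxx//; case: Ck.
Qed.

(** A point of the polyhedron lies in the piece of the smallest member of its support. *)
Lemma polyhedron_sub : polyhedron Q K `<=` X.
Proof.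
move=> A /polyhedronP[u [cu nu ->]]; apply/XKP.
have [|[k [ks _ _ kmin]] _] := support_extremal (T := predT) cu.
  apply: contrapT => /forall2NP u0; move: nu; rewrite /normalized big_seq big1 => [/eqP|k ks].
    by rewrite eq_sym oner_eq0.
  by have [//|/negP] := u0 k; rewrite negbK => /eqP ->; rewrite mul0r.
exists k => //; apply/(XkE hL); split; last by rewrite weighted_op_trace.
by apply: (weighted_op_cone hL hA hK) => // l ls; exact: kmin.
Qed.

Let by_dim k l := (\dim k <= \dim l)%N.

(** The list increases in dimension, and gluing starts at its end. The join [m] of [k] with a later
    [l] also comes later: an earlier [m] would have dimension at most that of [k] and so equal it,
    and [m = k] would put [l] inside [k] with no smaller dimension, hence [l = k]. *)
Lemma glueable_by_dim : glueable Xk (sort by_dim s).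
Proof.
have tot : total by_dim by move=> k l; exact: leq_total.
have tr : transitive by_dim by move=> k l m; exact: leq_trans.
have us : uniq (sort by_dim s) by rewrite sort_uniq proper_members_uniq.
have ss : sorted by_dim (sort by_dim s) by exact: sort_sorted.
have ts : {subset sort by_dim s <= s} by move=> k; rewrite mem_sort.
have full m : m \in s -> m \in sort by_dim s by rewrite mem_sort.
suff gen t1 t : sort by_dim s = t1 ++ t -> sorted by_dim (t1 ++ t) -> uniq (t1 ++ t) ->
    glueable Xk t by exact: (gen [::]).
elim: t t1 => //= k t IH t1 E st ut; split; last first.
  by apply: (IH (rcons t1 k)); rewrite cat_rcons.
have inS j : j \in k :: t -> j \in s by move=> jt; apply: ts; rewrite E mem_cat jt orbT.
have ks := inS k (mem_head _ _).
move=> l A lt XkA XlA; have ls : l \in s by apply: inS; rewrite in_cons lt orbT.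
have kK : k \in K by move: ks; rewrite mem_proper_members => /andP[].
have lK : l \in K by move: ls; rewrite mem_proper_members => /andP[].
have [Ck trA] := (XkE hL cA k A).1 XkA; have [Cl _] := (XkE hL cA l A).1 XlA.
have [m [ms km lm Xm]] := Xk_join kK lK Ck Cl trA.
exists m; split=> //; last first.
  move=> B /(XkE hL)[Cb tb]; apply/(XkE hL); split=> //.
  exact: filtering_cone_le km Cb.
move: (full m ms); rewrite E mem_cat in_cons => /or3P[mt1|/eqP mk|//].
  move: st; rewrite sorted_pairwise// pairwise_cat => /and3P[/allrelP ar _ _].
  have dm := ar m k mt1 (mem_head _ _).
  have mk : k == m by rewrite eqEdim km.
  by move: ut; rewrite cat_uniq => /and3P[_ /hasPn/(_ k (mem_head _ _))]; rewrite (eqP mk) mt1.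
have lk : (l <= k)%VS by rewrite -mk.
have kl : by_dim k l.
  move: st; rewrite sorted_pairwise// pairwise_cat /= => /and3P[_ _ /andP[/allP/(_ l lt)]].
  by [].
have lkE : l == k by rewrite eqEdim lk.
by move: ut; rewrite cat_uniq /= => /and3P[_ _ /andP[]]; rewrite -(eqP lkE) lt.
Qed.

End Retraction.

Unset Implicit Arguments.

Theorem theorem5p1 (R : realType) (n : nat)
    (br : 'rV[R]_n -> 'rV[R]_n -> 'rV[R]_n) (Q : 'M[R]_n)
    (h : {vspace 'rV[R]_n}) (cA : set 'M[R]_n) (K : seq {vspace 'rV[R]_n}) :
  compact_lie_algebra br Q ->
  subalgebra br h -> h != fullv ->
  compact_aut_group br Q h cA ->
  (forall k, k \in K ->
     [/\ subalgebra br k, A_invariant cA k, (h <= k)%VS & h != k]) ->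
  fullv \in K ->
  (forall k l, k \in K -> l \in K ->
     exists2 m, m \in K & is_join_subalgebra br k l m) ->
  compact (XK br Q cA K) /\
  strong_deformation_retract (polyhedron Q K) (XK br Q cA K).
Proof.
move=> hL _ _ hA hK KT hJ; set X := XK br Q cA K.
have hK' k : k \in K -> subalgebra br k /\ A_invariant cA k by move=> /hK[].
have hM : hausdorff_space 'M[R]_n by exact: norm_hausdorff.
have piece k : k \in proper_members K ->
    compact (Xk br Q cA k) /\ absolute_extensor (Xk br Q cA k).
  rewrite mem_proper_members => /andP[/hK'[sk ik] kT].
  exact: Xk_compact_absolute_extensor hL hA sk ik kT.
pose t := sort (fun k l : {vspace 'rV[R]_n} => (\dim k <= \dim l)%N) (proper_members K).
have XE : X = piece_union (Xk br Q cA) t.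
  by apply/seteqP; split=> A [k kt XA]; exists k => //; move: kt; rewrite mem_sort mem_undup.
have [r [cr rP rid rX]] := retraction_exists hL hA hK' KT hJ.
have piece' k : k \in t -> closed (Xk br Q cA k) /\ absolute_extensor (Xk br Q cA k).
  by rewrite mem_sort => /piece[ck ak]; split=> //; exact: compact_closed.
split.
  have -> : X = \bigcup_(k in [set` t]) Xk br Q cA k by rewrite XE; apply/seteqP; split.
  rewrite bigcup_seq big_seq; elim/big_rec: _ => [|k Y kt cY]; first exact: compact0.
  by apply: compactU => //; move: kt; rewrite mem_sort => /piece[].
split; first exact: (polyhedron_sub hL hA hK').
have gt := glueable_by_dim cA hL hJ.
have cP := compact_closed hM (@polyhedron_compact R n Q K).
have [|i A|H [cH HX H0 H1 HP]] := homotopy_glue cP rid gt piece'; first by rewrite -XE.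
  by rewrite mem_sort; exact: rX.
exists (fun A a => H (A, a)); split.
- have -> : (fun p : 'M[R]_n * R => H (p.1, p.2)) = H by apply/funext => -[].
  by rewrite XE.
- move=> A a; rewrite XE => -[k kt XA] a01; exists k => //; exact: HX.
- by rewrite XE.
- by move=> A XA; rewrite H1 -?XE//; exact: rP.
- move=> A a PA a01; apply: HP => //; rewrite -XE; exact: (polyhedron_sub hL hA hK').
Qed.
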